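(* Let $\mathcal O\subset\mathbb R^d$ be a bounded smooth domain. Let $\psi:\mathbb R\to[0,\infty)$ be convex and lower-semicontinuous with $\psi(0)=0$ and $\psi(x)=\psi(-x)$ for all $x\in\mathbb R$, such that $\psi(x)\le C(1+|x|)$ for all $x\in\mathbb R$ and some $C>0$, and such that there exists $y>0$ with $\psi(y)>0$. Let $\varphi:H^{-1}\to[0,\infty]$ be given by $\varphi(u)=\|\psi(u)\|_{TV}$ if $u\in\mathcal M(\mathcal O)\cap H^{-1}$ and $\varphi(u)=+\infty$ otherwise. Let $u\in\mathcal M(\mathcal O)\cap H^{-1}$. Then there exists a sequence $(u_n)_{n\in\mathbb N}\subset L^2(\mathcal O)$ such that, as $n\to\infty$, $$u_n\rightharpoonup u\ \text{ weakly in }H^{-1}\qquad\text{and}\qquad\varphi(u_n)\to\varphi(u).$$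
   Context: $H^{-1}$ is the dual of $H^1_0(\mathcal O)$ (with norm $\|\nabla u\|_{L^2}$). $\mathcal M(\mathcal O)$: signed Radon measures on $\mathcal O$ with finite total variation, identified with the dual of $\mathcal C_0^0(\mathcal O)$ (continuous functions vanishing at the boundary); $\|\mu\|_{TV}=|\mu|(\mathcal O)$. $\mathcal M(\mathcal O)\cap H^{-1}$ is the set of $\mu\in\mathcal M(\mathcal O)$ for which there is $C\ge0$ with $\int\eta\,\mathrm d\mu\le C\|\eta\|_{H^1_0}$ for all $\eta\in \mathcal C_c^1(\mathcal O)$; such $\mu$ is identified with the element of $H^{-1}$ obtained by continuous extension of $\eta\mapsto\int\eta\,\mathrm d\mu$ from $\mathcal C^1_c(\mathcal O)$ to $H^1_0(\mathcal O)$. Functions in $L^2(\mathcal O)$ are identified with the measures having them as Lebesgue densities. Convex function of a measure: let $\psi^*(x)=\sup_{y\in\mathbb R}(xy-\psi(y))$ and $\mathcal D_\psi=\{v\in \mathcal C^0_c(\mathcal O):\psi^*(v)\in L^1(\mathcal O)\}$. For $\mu\in\mathcal M(\mathcal O)$, $\psi(\mu)\in\mathcal M(\mathcal O)$ is the positive measure given by $\int_{\mathcal O}\eta\,\psi(\mu)=\sup\{\int v\eta\,\mathrm d\mu-\int\psi^*(v)\eta\,\mathrm dx: v\in\mathcal D_\psi\}$ for $0\le\eta\in \mathcal C_0^0(\mathcal O)$, extended to general $\eta$ by $\eta=(\eta\vee0)-((-\eta)\vee 0)$. One has $\|\psi(\mu)\|_{TV}=\sup\{\int v\,\mathrm d\mu-\int\psi^*(v)\,\mathrm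 dx:v\in\mathcal D_\psi\}$. *)

(* Defs.v *)
From HB Require Import structures.
From mathcomp Require Import all_boot all_order all_algebra.
From mathcomp Require Import all_classical all_reals all_analysis.
From mathcomp Require Import measurable_realfun.

Set Implicit Arguments.
Unset Strict Implicit.
Unset Printing Implicit Defensive.

Import Order.TTheory GRing.Theory Num.Theory.
Import numFieldNormedType.Exports.

Local Open Scope classical_set_scope.
Local Open Scope ring_scope.

(* The measurable sets of R^n are the Borel sets. *)
Definition rV_borel (R : realType) (n : nat) : set (set 'rV[R]_n) :=
  <<s [set A : set 'rV[R]_n | open A] >>.

Definition rV_borel_display : measure_display.
Proof. exact: default_measure_display. Qed.

HB.instance Definition _ (R : realType) (n : nat) :=
  @isMeasurable.Build rV_borel_display 'rV[R]_n (@rV_borel R n)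
    (@sigma_algebra0 _ setT _) (@sigma_algebraC _ _)
    (@sigma_algebra_bigcup _ setT _).

Lemma open_measurable_rV (R : realType) (n : nat) (A : set 'rV[R]_n) :
  open A -> measurable A.
Proof. by move=> oA; apply: sub_sigma_algebra. Qed.

Lemma continuous_measurable_rV (R : realType) (n : nat) (f : 'rV[R]_n -> R) :
  continuous f -> measurable_fun setT f.
Proof.
move=> /continuousP cf; apply: (measurability _ (RGenOpens.measurableE R)).
move=> _ [_ [a [b ->]] <-]; rewrite setTI.
by apply: open_measurable_rV; apply/cf; exact: interval_open.
Qed.

Lemma measurable_fun_rV d (T : measurableType d) (R : realType) (n : nat)
    (f : T -> 'rV[R]_n) :
  (forall i, measurable_fun setT (fun t => f t ord0 i)) -> measurable_fun setT f.
Proof.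
move=> mf; apply: (@measurability _ _ _ _ _ _ [set A : set 'rV[R]_n | open A]).
  by [].
move=> _ [A oA <-]; rewrite setTI.
pose B (p : 'rV[rat]_n * rat) : set 'rV[R]_n :=
  ball (map_mx ratr p.1 : 'rV[R]_n) (ratr p.2 : R).
have -> : A = \bigcup_(p in [set p | B p `<=` A]) B p.
  apply/seteqP; split => [x Ax|x [p /= BA /BA]//].
  have /nbhs_ballP[e /= e0 eA] : nbhs x A by move: oA; rewrite openE; exact.
  have /rat_in_itvoo[r] : 0 < e / 2 by rewrite divr_gt0.
  rewrite in_itv/= => /andP[r0 re].
  have xq i : exists q : rat, `|x ord0 i - ratr q| < ratr r.
    have /rat_in_itvoo[q] : x ord0 i - ratr r < x ord0 i + ratr r.
      by rewrite ltrBlDr -addrA ltrDl addr_gt0.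
    by rewrite in_itv/= => qx; exists q; rewrite distrC ltr_distl.
  have [q qP] := choice xq.
  exists (\row_i q i, r) => /=; last first.
    by split => // i j; rewrite /ball/= !mxE distrC (ord1 i).
  move=> y [_ yr]; apply: eA; split => // i j; rewrite (ord1 i).
  move: (yr ord0 j); rewrite /ball/= !mxE => yqr.
  rewrite [ltRHS]splitr (le_lt_trans (ler_distD (ratr (q j)) _ _))// ltrD//.
    exact: lt_trans (qP j) re.
  exact: lt_trans yqr re.
rewrite preimage_bigcup bigcup_mkcond; apply: countable_bigcupT_measurable => //.
move=> p; case: ifPn => // _.
have [r0|r0] := boolP (0 < ratr p.2 :> R); last first.
  rewrite (_ : _ @^-1` _ = set0)//; apply/seteqP; split => // t [/=].
  by rewrite (negbTE r0).
have -> : f @^-1` B p =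
    \bigcap_(i in [set: 'I_n])
      (fun t => f t ord0 i) @^-1` ball (ratr (p.1 ord0 i) : R) (ratr p.2).
  apply/seteqP; split => [t [_ ft] i _|t ft].
    by have := ft ord0 i; rewrite mxE.
  by split => // i j; rewrite (ord1 i) mxE; exact: ft.
apply: fin_bigcap_measurable => // i _.
rewrite -[X in measurable X]setTI; apply: mf => //; apply: open_measurable.
exact: ball_open.
Qed.

Definition rV_cons (R : realType) (n : nat) (p : R * 'rV[R]_n) : 'rV[R]_n.+1 :=
  row_mx (p.1)%:M p.2.

Lemma measurable_rV_cons (R : realType) (n : nat) :
  measurable_fun setT (@rV_cons R n).
Proof.
apply: measurable_fun_rV => i.
have [j ij|j ij] := split_ordP (i : 'I_(1 + n)).
  rewrite (_ : (fun _ => _) = fst)//; apply/funext => p.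
  rewrite /rV_cons ij; apply: (etrans (row_mxEl _ _ _ _)).
  by rewrite !mxE (ord1 j).
rewrite (_ : (fun _ => _) = (fun v : 'rV_n => v ord0 j) \o snd).
  apply: measurableT_comp => //; apply: continuous_measurable_rV.
  exact: coord_continuous.
by apply/funext => p; rewrite /rV_cons ij; exact: (row_mxEr _ _ _ _).
Qed.

(* Lebesgue measure on R^n: the n-fold product of the Lebesgue measure of R. *)
Fixpoint lebesgue_rV (R : realType) (n : nat) : set 'rV[R]_n -> \bar R :=
  match n with
  | 0 => \d_(0 : 'rV[R]_0)
  | m.+1 => pushforward (@lebesgue_measure R \x @lebesgue_rV R m)%E (@rV_cons R m)
  end.
Arguments lebesgue_rV R n : clear implicits.

Lemma lebesgue_rVP (R : realType) (n : nat) :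
  exists m : {sigma_finite_measure set 'rV[R]_n -> \bar R},
    lebesgue_rV R n = m :> (set _ -> _).
Proof.
elim: n => [|n [m /= ->]]; first by exists \d_(0 : 'rV[R]_0).
pose P : {measure set (measurableTypeR R * 'rV[R]_n)%type -> \bar R} :=
  (@lebesgue_measure R \x m)%E.
have mc := @measurable_rV_cons R n.
pose Q := pushforward P (@rV_cons R n).
have Q0 : Q set0 = 0%E by rewrite /Q /pushforward preimage_set0 measure0.
have Q_ge0 A : (0 <= Q A)%E by exact: measure_ge0.
have Q_sigma : semi_sigma_additive Q.
  by apply: (@measure_semi_sigma_additive _ _ _ (pushforward P (@rV_cons R n))).
pose uncons (v : 'rV[R]_n.+1) : (measurableTypeR R * 'rV[R]_n)%type :=
  (v ord0 ord0, \row_i v ord0 (lift ord0 i)).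
have munc : measurable_fun setT uncons.
  apply/measurable_fun_pair => /=.
    by apply: continuous_measurable_rV; exact: coord_continuous.
  apply: measurable_fun_rV => i; under eq_fun do rewrite mxE.
  by apply: continuous_measurable_rV; exact: coord_continuous.
have consK p : uncons (rV_cons p) = p.
  case: p => x v; rewrite /uncons /rV_cons /=; congr pair.
    rewrite (_ : ord0 = lshift n (ord0 : 'I_1)); last exact/val_inj.
    by apply: (etrans (row_mxEl _ _ _ _)); rewrite mxE.
  apply/rowP => i; rewrite mxE.
  rewrite (_ : lift ord0 i = rshift 1 i); last exact/val_inj.
  exact: (row_mxEr _ _ _ _).
have Q_sfin : sigma_finite setT Q.
  have /sigma_finiteP[F [FT ndF Foo]] := sigma_finiteT (@lebesgue_measure R).
  have /sigma_finiteP[G [GT ndG Goo]] := sigma_finiteT m.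
  exists (fun k => uncons @^-1` (F k `*` G k)).
    rewrite -preimage_bigcup (_ : \bigcup_n _ = setT) ?preimage_setT//.
    apply/seteqP; split => // -[x y] _.
    have [i _ Fx] : (\bigcup_i F i) x by rewrite -FT.
    have [j _ Gy] : (\bigcup_i G i) y by rewrite -GT.
    exists (maxn i j) => //; split => /=.
      by move: x Fx; exact/subsetPset/ndF/leq_maxl.
    by move: y Gy; exact/subsetPset/ndG/leq_maxr.
  move=> k; have [mF Fk] := Foo k; have [mG Gk] := Goo k; split.
    by rewrite -[X in measurable X]setTI; apply: munc => //; exact: measurableX.
  rewrite /Q /pushforward -comp_preimage (_ : uncons \o _ = id); last first.
    by apply/funext => p /=; rewrite consK.
  rewrite preimage_id /P /= product_measure1E//.
  by rewrite lte_mul_pinfty// ge0_fin_numE.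
change (exists m0 : {sigma_finite_measure set 'rV[R]_n.+1 -> \bar R},
  Q = m0 :> (set _ -> _)).
clearbody Q.
pose Qm := isMeasure.Build _ _ _ Q Q0 Q_ge0 Q_sigma.
pose Q1 : {measure set _ -> \bar R} := HB.pack Q Qm.
pose Qs := Measure_isSigmaFinite.Build _ _ _ Q1 Q_sfin.
by exists (HB.pack_for {sigma_finite_measure set _ -> \bar R} Q Qm Qs).
Qed.

Section lebesgue_rV_measure.
Context (R : realType) (n : nat).

Let lebesgue_rV0 : lebesgue_rV R n set0 = 0%E.
Proof. by have [m ->] := lebesgue_rVP R n; exact: measure0. Qed.

Let lebesgue_rV_ge0 A : (0 <= lebesgue_rV R n A)%E.
Proof. by have [m ->] := lebesgue_rVP R n; exact: measure_ge0. Qed.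

Let lebesgue_rV_sigma_additive : semi_sigma_additive (lebesgue_rV R n).
Proof.
by have [m ->] := lebesgue_rVP R n; exact: measure_semi_sigma_additive.
Qed.

HB.instance Definition _ := isMeasure.Build _ _ _ (lebesgue_rV R n)
  lebesgue_rV0 lebesgue_rV_ge0 lebesgue_rV_sigma_additive.

Let lebesgue_rV_sigma_finite : sigma_finite setT (lebesgue_rV R n).
Proof. by have [m ->] := lebesgue_rVP R n; exact: sigma_finiteT. Qed.

HB.instance Definition _ := Measure_isSigmaFinite.Build _ _ _ (lebesgue_rV R n)
  lebesgue_rV_sigma_finite.

End lebesgue_rV_measure.

Section smooth_functions.
Context (R : realType) (n : nat).
Implicit Types (f : 'rV[R]_n -> R) (O : set 'rV[R]_n).

Definition rV_basis (i : 'I_n) : 'rV[R]_n := delta_mx ord0 i.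

Definition partial (i : 'I_n) f : 'rV[R]_n -> R := 'D_(rV_basis i) f.

Fixpoint Ck (k : nat) f : Prop :=
  match k with
  | 0 => continuous f
  | k'.+1 => [/\ continuous f,
      forall i x, derivable f x (rV_basis i) &
      forall i, Ck k' (partial i f)]
  end.

Definition Csmooth f : Prop := forall k, Ck k f.

Definition tsupport f : set 'rV[R]_n := closure [set x | f x != 0].

(* C^k functions with compact support in O, extended by 0 outside of O. *)
Definition Cc (k : nat) O : set ('rV[R]_n -> R) :=
  [set f | [/\ Ck k f, compact (tsupport f) & tsupport f `<=` O]].

(* Continuous functions on the closure of O vanishing on the boundary of O,
   extended by 0 outside of O (for bounded O). *)
Definition C00 O : set ('rV[R]_n -> R) :=
  [set f | continuous f /\ forall x, ~ O x -> f x = 0].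

End smooth_functions.

Section domain.
Context (R : realType) (d : nat).
Implicit Types O : set 'rV[R]_d.

(* Near each boundary point, up to relabelling and reorienting the coordinate
   axes, O is the region on one side of the graph of a smooth function of the
   d - 1 other coordinates. *)
Definition smooth_boundary O : Prop :=
  forall x0, (closure O `\` O°) x0 ->
  exists r : R, exists i : 'I_d, exists b : bool, exists g : 'rV[R]_d.-1 -> R,
    [/\ 0 < r, Csmooth g &
        forall x, ball x0 r x ->
          (O x <-> g (col' i x) < (-1) ^+ b * x ord0 i)].

Definition bounded_smooth_domain O : Prop :=
  [/\ O !=set0, open O, connected O, bounded_set O & smooth_boundary O].

End domain.

(* The dual of a seminormed space, given as a linear subspace V of E and a
   seminorm p on V.  Elements of the dual are functions on E of which only the
   restriction to V matters. *)
Section dual.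
Context (R : realType) (E : lmodType R).
Implicit Types (V : set E) (p : E -> R).

Definition dual V p : set (E -> R) :=
  [set F | (forall (a : R) u v, V u -> V v -> F (a *: u + v) = a * F u + F v) /\
           exists C : R, forall v, V v -> `|F v| <= C * p v].

Definition dual_norm V p (F : E -> R) : R :=
  sup [set `|F v| | v in [set v | V v /\ p v <= 1]].

Definition weak_cvg V p (u_ : nat -> E) (u : E) : Prop :=
  forall L, dual V p L -> L (u_ n) @[n --> \oo] --> L u.

End dual.

Section sobolev.
Context (R : realType) (d : nat).
Implicit Types (O : set 'rV[R]_d) (v : 'rV[R]_d -> R).
Local Notation leb := (lebesgue_rV R d).

Definition L2 O : set ('rV[R]_d -> R) :=
  [set v : 'rV[R]_d -> R |
    measurable_fun O v /\ leb.-integrable O (fun x => (v x ^+ 2)%:E)].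

Definition sqrL2norm O v : R := \int[leb]_(x in O) (v x ^+ 2).

Definition weak_gradient O v (g : 'I_d -> 'rV[R]_d -> R) : Prop :=
  (forall i, L2 O (g i)) /\
  forall i eta, Cc 1 O eta ->
    \int[leb]_(x in O) (v x * partial i eta x) =
    - \int[leb]_(x in O) (g i x * eta x).

Definition H1 O : set ('rV[R]_d -> R) :=
  [set v : 'rV[R]_d -> R | L2 O v /\ exists g, weak_gradient O v g].

(* The weak gradient of v in H1 O, unique up to negligible sets. *)
Definition grad O v : 'I_d -> 'rV[R]_d -> R :=
  xget (fun _ => 0) [set g | weak_gradient O v g].

Definition sqr_grad_norm O v : R := \sum_(i < d) sqrL2norm O (grad O v i).

Definition H1norm O v : R := Num.sqrt (sqrL2norm O v + sqr_grad_norm O v).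

(* The closure of the compactly supported C^1 functions in H1 O. *)
Definition H10 O : set ('rV[R]_d -> R) :=
  [set v : 'rV[R]_d -> R | H1 O v /\
    forall e : R, 0 < e ->
      exists2 eta : 'rV[R]_d -> R, Cc 1 O eta & H1norm O (eta - v) < e].

Definition H10norm O v : R := Num.sqrt (sqr_grad_norm O v).

Definition Hm1 O : set (('rV[R]_d -> R) -> R) := dual (H10 O) (H10norm O).

Definition Hm1norm O : (('rV[R]_d -> R) -> R) -> R :=
  dual_norm (H10 O) (H10norm O).

End sobolev.

Section radon_measures.
Context (R : realType) (d : nat).
Implicit Types (O : set 'rV[R]_d) (mu : {charge set 'rV[R]_d -> \bar R}).
Local Notation leb := (lebesgue_rV R d).

(* Charges take finite values, hence have finite total variation, and finite
   Borel measures on R^d are Radon; a measure on O is a charge on R^d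
   concentrated on O. *)
Definition radon O : set ({charge set 'rV[R]_d -> \bar R}) :=
  [set mu | forall A, measurable A -> mu A = mu (A `&` O)].

Definition charge_integral mu (f : 'rV[R]_d -> R) : R :=
  let: exist P hP := cid (Hahn_decomposition mu) in
  let: exist N PN := cid hP in
  \int[jordan_pos PN]_x f x - \int[jordan_neg PN]_x f x.

Definition radon_Hm1 O : set ({charge set 'rV[R]_d -> \bar R}) :=
  [set mu | radon O mu /\ exists2 C : R, 0 <= C &
     forall eta, Cc 1 O eta -> charge_integral mu eta <= C * H10norm O eta].

(* F is the continuous extension to H10 of eta |-> \int eta dmu.  By density of
   Cc 1 O in H10 O its restriction to H10 O is unique. *)
Definition represents O mu (F : ('rV[R]_d -> R) -> R) : Prop :=
  Hm1 O F /\ forall eta, Cc 1 O eta -> F eta = charge_integral mu eta.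

(* The default value 0 is not reached when mu is in radon_Hm1 O. *)
Definition Hm1_of O mu : ('rV[R]_d -> R) -> R :=
  xget 0 [set F | represents O mu F].

Definition has_L2_density O mu : Prop :=
  exists2 f, L2 O f & forall A, measurable A ->
    mu A = (\int[leb]_(x in A `&` O) (f x)%:E)%E.

End radon_measures.

Section convex_function_of_measure.
Context (R : realType) (d : nat) (psi : R -> R).
Implicit Types (O : set 'rV[R]_d) (mu : {charge set 'rV[R]_d -> \bar R}).
Local Notation leb := (lebesgue_rV R d).
Local Open Scope ereal_scope.

Definition conjugate (x : R) : \bar R :=
  ereal_sup (range (fun y : R => (x * y - psi y)%:E)).

Definition conjugate_dom O : set ('rV[R]_d -> R) :=
  [set v : 'rV[R]_d -> R |
    Cc 0 O v /\ leb.-integrable O (fun x => conjugate (v x))].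

Definition psi_measure_pos O mu (eta : 'rV[R]_d -> R) : \bar R :=
  ereal_sup [set (charge_integral mu (fun x => v x * eta x)%R)%:E
                 - \int[leb]_(x in O) (conjugate (v x) * (eta x)%:E)
            | v in conjugate_dom O].

(* psi(mu), as an element of the dual of C00 O, with which the measures on O are
   identified: psi_measure O mu eta is the integral of eta against psi(mu). *)
Definition psi_measure O mu (eta : 'rV[R]_d -> R) : \bar R :=
  psi_measure_pos O mu (fun x => Num.max (eta x) 0%R)
  - psi_measure_pos O mu (fun x => Num.max (- eta x)%R 0%R).

(* The identification of measures on O with the dual of C00 O is isometric: the
   total variation |nu|(O) is the supremum of \int eta dnu over |eta| <= 1. *)
Definition TVnorm O (L : ('rV[R]_d -> R) -> \bar R) : \bar R :=
  ereal_sup [set L eta | eta in [set eta | C00 O eta /\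
    forall x, (`|eta x| <= 1)%R]].

(* A measure representing F is unique, since it is determined by its integrals
   against Cc 1 O. *)
Definition phi O (F : ('rV[R]_d -> R) -> R) : \bar R :=
  if pselect (exists mu, radon_Hm1 O mu /\ represents O mu F) is left h
  then TVnorm O (psi_measure O (sval (cid h))) else +oo.

End convex_function_of_measure.

(* Main.v *)
Require Import Defs.
From mathcomp Require Import all_boot all_order all_algebra.
From mathcomp Require Import all_classical all_reals all_analysis.
From mathcomp Require Import measurable_realfun ring lra.

(* The approximants solve [w - eps Laplace w = u] in [O] up to a small error,
   so that [int w v] is close to [int v du] for [v] in [C^1_c(O)].  The only
   exact property of the resolvent that is needed is that testing with [T(w)],
   for [T] nondecreasing and [T 0 = 0], gives
   [int w T(w) <= int T(w) du + error], since [int grad w . grad T(w) >= 0].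
   Choosing [T] close to the derivative of [psi] makes [T(w)] almost optimal in
   the duality formula of [phi(w)], so [int psi(w) <= phi(u) + error]; lower
   semicontinuity of a supremum gives the other inequality.

   No completeness or elliptic regularity is used: [w] is an almost minimizer
   in [C^1_c(O)] of the energy of the resolvent equation, and every estimate is
   made on [C^1_c(O)]. *)

Set Implicit Arguments.
Unset Strict Implicit.
Unset Printing Implicit Defensive.

Import Order.TTheory GRing.Theory Num.Theory.
Import numFieldNormedType.Exports.

Local Open Scope classical_set_scope.
Local Open Scope ring_scope.

(** * Calculus in [R^n] *)

(** The whole argument runs on [dual_energy], the duality formula restricted to test functions in
    [Cc 1 O]: there an element of $H^{-1}$, the measure representing it and an $L^2$ density give
    the same functional. Two obstacles shape the proof. The conjugate of [psi] may be infinite, so a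
    smoothed test function may leave the domain of the formula; since [psi] is not identically [0],
    its conjugate is finite near [0], and a slight shrinking restores admissibility. Moreover $u$ is
    merely in $H^{-1}$, so testing the resolvent equation with $w$ keeps $\varepsilon\|\nabla w\|$
    bounded but not small; smallness comes from an interpolation bound $|u(v)|\le e\|\nabla
    v\|+K_e\|v\|$ in $L^2$ norms. The convergence in $H^{-1}$ is then even in norm.

    The function [T] depends only on [psi] and the accuracy wanted. Its Lipschitz constant
    degenerates with that accuracy, but involves neither $w$ nor $\varepsilon$; hence [T] is fixed
    before $w$, and the defect allowed to the almost minimizer is chosen last. *)

Section primitive.
Context (R : realType).
Implicit Types f : R -> R.

Lemma primitive_right f (a : R) : continuous f ->
  exists F : R -> R, forall x, a < x -> is_derive x 1 F (f x).
Proof.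
move=> cf; exists (fun x => (\int[@lebesgue_measure R]_(t in [set` `[a, x]]) f t)%R).
move=> x ax; have xx : x < x + 1 by rewrite ltrDl.
have fi : (@lebesgue_measure R).-integrable `[a, x + 1] (EFin \o f).
  apply: continuous_compact_integrable; first exact: segment_compact.
  exact: continuous_subspaceT.
have [d1 d2] := continuous_FTC1_closed xx fi ax (cf x).
by split; [exact: d1|rewrite -d2 derive1E].
Qed.

Lemma is_derive_sub_cst f (g : R -> R) (h : R -> R) (a x y : R) : a < x -> x <= y ->
  (forall z, a < z -> is_derive z 1 f (h z)) ->
  (forall z, a < z -> is_derive z 1 g (h z)) ->
  f y - g y = f x - g x.
Proof.
move=> ax xy df dg.
have dfg z : a < z -> is_derive z 1 (f - g) 0.
  move=> az; rewrite -(subrr (h z)); have := df _ az; have := dg _ az.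
  by move=> ? ?; exact: is_deriveB.
have [] := @MVT_segment R (f - g) (cst 0) x y xy.
- by move=> z; rewrite in_itv/= => /andP[xz _]; apply: dfg; rewrite (lt_trans ax).
- apply: derivable_within_continuous => z; rewrite in_itv/= => /andP[xz _].
  by have [] := dfg z (lt_le_trans ax xz).
by move=> z _; rewrite mul0r => /subr0_eq.
Qed.

(** The primitives on the half-lines above [- n%:R], normalised to vanish at [0], agree where they
    overlap, and are glued with an index [k x] exceeding the modulus of [x]. *)
Lemma primitive f : continuous f ->
  exists F : R -> R, forall x : R, is_derive x 1 F (f x).
Proof.
move=> cf.
have /choice[F HF] : forall n : nat, exists F : R -> R,
    forall x : R, - n%:R < x -> is_derive x 1 F (f x).
  by move=> n; exact: primitive_right.
have FE n m (x : R) : (0 < n)%N -> (n <= m)%N -> - n%:R < x -> F n x - F n 0 = F m x - F m 0.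
  move=> n0 nm nx.
  have H (z : R) : - n%:R < z -> is_derive z 1 (F n) (f z) by exact: HF.
  have H' (z : R) : - n%:R < z -> is_derive z 1 (F m) (f z).
    by move=> nz; apply: HF; rewrite (le_lt_trans _ nz)// lerN2 ler_nat.
  have n0' : - n%:R < (0:R) by rewrite oppr_lt0 ltr0n.
  have [x0|x0] := leP 0 x.
    by have := is_derive_sub_cst n0' x0 H H'; lra.
  by have := is_derive_sub_cst nx (ltW x0) H H'; lra.
pose k (x : R) := (Num.truncn `|x|).+1.
have kP (x : R) : `|x| < (k x)%:R by exact: truncnS_gt.
exists (fun x => F (k x) x - F (k x) 0) => x.
(* One more than [k x], so that this single index serves every [y] within distance [1] of [x]. *)
pose K := (k x).+1.
have nK : - K%:R < x.
  have := kP x; rewrite ltr_norml => /andP[+ _].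
  by apply: le_lt_trans; rewrite lerN2 ler_nat.
have dK : is_derive x 1 (fun x => F K x - F K 0) (f x).
  have := HF K x nK => ?; rewrite -[f x]subr0.
  exact: is_deriveB.
apply: (near_eq_is_derive _ dK).
near=> y.
have xy : `|y - x| < 1 by rewrite distrC; near: y; exact: nbhsx_ballx.
have kK : (k y <= K)%N.
  rewrite /K /k ltnS -(ler_nat R).
  have y0 : 0 <= `|y| by [].
  have := truncn_le `|y|; rewrite y0; have := kP x; have := ler_normD (y - x) x.
  rewrite subrK => H1 H2 H3.
  have : (Num.truncn `|y|)%:R < ((k x).+1)%:R :> R by rewrite -natr1; lra.
  by rewrite ltr_nat ltnS ler_nat.
apply/esym/FE => //; have := kP y; rewrite ltr_norml => /andP[]//.
Unshelve. all: by end_near. Qed.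

End primitive.

(** * Functions of class $C^1$ on $\mathbb R^n$ *)

Section C1_calculus.
Context (R : realType) (n : nat).
Implicit Types (f g : 'rV[R]_n -> R) (T : R -> R).

Lemma continuous_add f g : continuous f -> continuous g ->
  continuous (fun x => f x + g x).
Proof. by move=> cf cg x; exact: (continuousD (cf x) (cg x)). Qed.

Lemma continuous_mul f g : continuous f -> continuous g ->
  continuous (fun x => f x * g x).
Proof. by move=> cf cg x; exact: (continuousM (cf x) (cg x)). Qed.

Lemma is_derive_partial f (i : 'I_n) (x : 'rV[R]_n) : Ck 1 f ->
  is_derive x (rV_basis R i) f (partial i f x).
Proof. by case=> _ df _; exact/derivableP. Qed.

Lemma partialE f i (x : 'rV[R]_n) (l : R) : is_derive x (rV_basis R i) f l ->
  partial i f x = l.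
Proof. by case. Qed.

Lemma Ck1_continuous f : Ck 1 f -> continuous f.
Proof. by case. Qed.

Lemma Ck1_partial_continuous f i : Ck 1 f -> continuous (partial i f).
Proof. by case=> _ _; exact. Qed.

Lemma Ck1_is_derive f (df : 'I_n -> 'rV[R]_n -> R) : continuous f ->
  (forall i x, is_derive x (rV_basis R i) f (df i x)) ->
  (forall i, continuous (df i)) -> Ck 1 f.
Proof.
move=> cf Df cdf; split => //.
move=> i; rewrite (_ : partial i f = df i); first exact: cdf.
by apply/funext => x; exact/partialE.
Qed.

(** Reduces directional derivatives to derivatives in one real variable, where the chain rule
    applies and slices can be compared. *)
Lemma derive_line (V : normedModType R) (f : V -> R) (x v : V) :
  'D_v f x = 'D_1 (fun h : R => f (h *: v + x)) 0.
Proof.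
rewrite /derive; set g1 := fun h => h^-1 *: _; set g2 := fun h => h^-1 *: _.
suff -> : g1 = g2 by [].
by rewrite funeqE /g1 /g2 => h /=; rewrite addr0 scale0r add0r [_%:A]mulr1.
Qed.

Lemma is_derive_comp1 T f (x v : 'rV[R]_n) (df dT : R) :
  is_derive x v f df -> is_derive (f x) 1 T dT ->
  is_derive x v (T \o f) (dT * df).
Proof.
move=> [/derivable1P f1 f2] T1.
have H : is_derive (0:R) 1 (fun h : R => f (h *: v + x)) df.
  by split => //; rewrite -derive_line.
have H' : is_derive (f ((0:R) *: v + x)) 1 T dT by rewrite scale0r add0r.
have [c1 c2] := @is_derive1_comp R T (fun h : R => f (h *: v + x)) 0 _ _ H' H.
by split; [apply/derivable1P|rewrite derive_line].
Qed.

Lemma Ck1_cst (c : R) : Ck 1 (fun _ : 'rV[R]_n => c).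
Proof.
by apply: (@Ck1_is_derive _ (fun _ _ => 0)) => *; (exact: is_derive_cst || exact: cst_continuous).
Qed.

Lemma is_derive_coord (j : 'I_n) (x v : 'rV[R]_n) :
  is_derive x v (fun y : 'rV[R]_n => y ord0 j) (v ord0 j).
Proof.
have H : is_derive (0:R) 1 (fun h : R => (h *: v + x) ord0 j) (v ord0 j).
  rewrite (_ : (fun _ => _) = (fun h : R => h * v ord0 j + x ord0 j)); last first.
    by apply/funext => h; rewrite !mxE.
  by apply: is_derive_eq; rewrite scaler0 add0r addr0 [_%:A]mulr1.
by have [? ?] := H; split; [exact/derivable1P|rewrite derive_line].
Qed.

Lemma Ck1_coord (j : 'I_n) : Ck 1 (fun x : 'rV[R]_n => x ord0 j).
Proof.
apply: (@Ck1_is_derive _ (fun i _ => rV_basis R i ord0 j)).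
- exact: coord_continuous.
- by move=> i x; exact: is_derive_coord.
- by move=> i x; exact: cst_continuous.
Qed.

Lemma partial_coord (i j : 'I_n) x :
  partial i (fun x : 'rV[R]_n => x ord0 j) x = (i == j)%:R.
Proof. by rewrite (partialE (is_derive_coord j x _)) mxE eqxx eq_sym. Qed.

Lemma is_derive_partialD f g i x : Ck 1 f -> Ck 1 g ->
  is_derive x (rV_basis R i) (fun x => f x + g x) (partial i f x + partial i g x).
Proof.
by move=> /(is_derive_partial i x) ? /(is_derive_partial i x) ?; exact: is_deriveD.
Qed.

Lemma Ck1D f g : Ck 1 f -> Ck 1 g -> Ck 1 (fun x => f x + g x).
Proof.
move=> cf cg.
apply: (@Ck1_is_derive _ (fun i x => partial i f x + partial i g x)).
- exact: (continuous_add (Ck1_continuous cf) (Ck1_continuous cg)).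
- by move=> i x; exact: is_derive_partialD.
- move=> i.
  exact: (continuous_add (Ck1_partial_continuous cf) (Ck1_partial_continuous cg)).
Qed.

Lemma is_derive_partialM f g i x : Ck 1 f -> Ck 1 g ->
  is_derive x (rV_basis R i) (fun x => f x * g x)
    (f x * partial i g x + g x * partial i f x).
Proof.
by move=> /(is_derive_partial i x) ? /(is_derive_partial i x) ?; exact: is_deriveM.
Qed.

Lemma partialM f g i x : Ck 1 f -> Ck 1 g ->
  partial i (fun x => f x * g x) x = f x * partial i g x + g x * partial i f x.
Proof. by move=> cf cg; apply/partialE/is_derive_partialM. Qed.

Lemma Ck1M f g : Ck 1 f -> Ck 1 g -> Ck 1 (fun x => f x * g x).
Proof.
move=> cf cg.
apply: (@Ck1_is_derive _ (fun i x => f x * partial i g x + g x * partial i f x)).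
- exact: (continuous_mul (Ck1_continuous cf) (Ck1_continuous cg)).
- by move=> i x; exact: is_derive_partialM.
- move=> i; apply: (@continuous_add (fun x => f x * _) (fun x => g x * _)).
    exact: (continuous_mul (Ck1_continuous cf) (Ck1_partial_continuous cg)).
  exact: (continuous_mul (Ck1_continuous cg) (Ck1_partial_continuous cf)).
Qed.

Lemma Ck1Z (c : R) f : Ck 1 f -> Ck 1 (fun x => c * f x).
Proof. by apply: Ck1M; exact: Ck1_cst. Qed.

Lemma Ck1_sum (I : Type) (r : seq I) (P : pred I) (F : I -> 'rV[R]_n -> R) :
  (forall i, Ck 1 (F i)) -> Ck 1 (fun x => \sum_(i <- r | P i) F i x).
Proof.
move=> cF; elim: r => [|i r IH].
  by under eq_fun do rewrite big_nil; exact: Ck1_cst.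
under eq_fun do rewrite big_cons; case: (P i) => //; exact: Ck1D.
Qed.

Lemma Ck1_prod (I : Type) (r : seq I) (P : pred I) (F : I -> 'rV[R]_n -> R) :
  (forall i, Ck 1 (F i)) -> Ck 1 (fun x => \prod_(i <- r | P i) F i x).
Proof.
move=> cF; elim: r => [|i r IH].
  by under eq_fun do rewrite big_nil; exact: Ck1_cst.
under eq_fun do rewrite big_cons; case: (P i) => //; exact: Ck1M.
Qed.

Lemma is_derive1_continuous T dT : (forall s : R, is_derive s 1 T (dT s)) -> continuous T.
Proof.
move=> DT s; apply/differentiable_continuous/derivable1_diffP.
by have [] := DT s.
Qed.

Lemma partial_comp T dT f i x : (forall s : R, is_derive s 1 T (dT s)) -> Ck 1 f ->
  partial i (T \o f) x = dT (f x) * partial i f x.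
Proof.
by move=> DT cf; apply/partialE/is_derive_comp1; exact: is_derive_partial.
Qed.

Lemma Ck1_comp T dT f : (forall s : R, is_derive s 1 T (dT s)) -> continuous dT ->
  Ck 1 f -> Ck 1 (T \o f).
Proof.
move=> DT cdT cf.
have fc := Ck1_continuous cf.
apply: (@Ck1_is_derive _ (fun i x => dT (f x) * partial i f x)).
- by move=> x; apply: continuous_comp; [exact: fc|exact: (is_derive1_continuous DT)].
- by move=> i x; apply: is_derive_comp1; exact: is_derive_partial.
- move=> i; apply: (@continuous_mul (dT \o f)).
    by move=> x; apply: continuous_comp; [exact: fc|exact: cdT].
  exact: (Ck1_partial_continuous cf).
Qed.

End C1_calculus.

(** * Compactly supported functions *)

Section smoothstep.
Context (R : realType).
Implicit Types F f : R -> R.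

Lemma is_derive_MVT F f (x y : R) : (forall z : R, is_derive z 1 F (f z)) -> x <= y ->
  exists2 c, x <= c <= y & F y - F x = f c * (y - x).
Proof.
move=> dF xy; have [] := @MVT_segment R F f x y xy.
  by apply: derivable_within_continuous => z _; have [] := dF z.
by move=> c; rewrite in_itv/= => cxy ->; exists c.
Qed.

Lemma is_derive_ge0_homo F f : (forall z : R, is_derive z 1 F (f z)) ->
  (forall z, 0 <= f z) -> {homo F : x y / x <= y}.
Proof.
move=> dF f0 x y xy; have [c _] := is_derive_MVT dF xy.
by rewrite -subr_ge0 => ->; rewrite mulr_ge0// subr_ge0.
Qed.

(** The normalised primitive of the bump [Num.max 0 (t * (1 - t))], which is continuous, nonnegative
    and zero outside $[0,1]$. *)
Lemma C1_step : exists s ds : R -> R,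
  [/\ forall x : R, is_derive x 1 s (ds x), continuous ds, {homo s : x y / x <= y},
      forall x, x <= 0 -> s x = 0 & forall x, 1 <= x -> s x = 1].
Proof.
pose f (t : R) : R := Num.max 0 (t * (1 - t)).
have cf : continuous f.
  move=> t; apply: (@continuous_max R R (cst 0) (fun t : R => t * (1 - t))).
    exact: cst_continuous.
  by apply: cvgM; [exact: cvg_id|apply: cvgB; [exact: cvg_cst|exact: cvg_id]].
have f0 (t : R) : 0 <= f t by rewrite le_max lexx.
have [F dF] := primitive cf.
have mF := is_derive_ge0_homo dF f0.
have fz (t : R) : t <= 0 \/ 1 <= t -> f t = 0.
  by move=> tP; apply/max_idPl; case: tP => tP; nra.
(* By the mean value theorem on the middle half of $[0,1]$, where the bump is bounded away from its
   zeros. *)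
have F10 : 0 < F 1 - F 0.
  have h0 : (0:R) <= 1/4 by lra.
  have h1 : (1:R)/4 <= 3/4 by lra.
  have h2 : (3:R)/4 <= 1 by lra.
  have [c cP E] := is_derive_MVT dF h1.
  have := mF _ _ h0; have := mF _ _ h2.
  have : 0 < F (3/4) - F (1/4).
    rewrite E mulr_gt0//; last by lra.
    rewrite /f lt_max; apply/orP; right.
    by move/andP: cP => [c1 c2]; apply: mulr_gt0; lra.
  lra.
exists (fun x => (F x - F 0) / (F 1 - F 0)), (fun x => f x / (F 1 - F 0)); split.
- move=> x; have dFx := dF x.
  have -> : (fun x => (F x - F 0) / (F 1 - F 0)) =
      (F 1 - F 0)^-1 *: (F - cst (F 0)).
    by apply/funext => y; rewrite mulrC.
  apply: is_derive_eq; rewrite subr0 mulrC; exact: erefl.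
- by move=> x; apply: cvgM; [exact: cf|exact: cvg_cst].
- by move=> x y xy; rewrite ler_pM2r ?invr_gt0// lerB// mF.
- move=> x x0; have [c /andP[_ c0]] := is_derive_MVT dF x0.
  by rewrite (fz _ (or_introl c0)) mul0r => H; rewrite -opprB H oppr0 mul0r.
- move=> x x1; have [c /andP[c1 _]] := is_derive_MVT dF x1.
  rewrite (fz _ (or_intror c1)) mul0r => /subr0_eq ->.
  by rewrite divff// gt_eqF.
Qed.

End smoothstep.

(** * Compact supports and exhaustion by superlevel sets *)

Section compact_support.
Context (R : realType) (n : nat).
Implicit Types (f g : 'rV[R]_n -> R) (O K : set 'rV[R]_n).

Lemma Cc_of_compact k O K f : Ck k f -> compact K -> K `<=` O ->
  (forall x, ~ K x -> f x = 0) -> Cc k O f.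
Proof.
move=> ckf cK KO fK.
have sK : tsupport f `<=` K.
  rewrite /tsupport (_ : K = closure K); last first.
    apply/closure_id.
    exact: (compact_closed (@norm_hausdorff _ 'rV[R]_n) cK).
  apply: closure_subset => x /= fx; apply: contrapT => Kx.
  by rewrite fK// eqxx in fx.
split => //; last exact: subset_trans KO.
by apply: subclosed_compact sK => //; exact: closed_closure.
Qed.

Lemma Cc_eq0 k O f x : Cc k O f -> ~ O x -> f x = 0.
Proof.
move=> [_ _ fO] Ox; apply/eqP; apply: contra_notT Ox => fx0.
by apply: fO; exact: subset_closure.
Qed.

Lemma tsupport_eq0 f x : ~ tsupport f x -> f x = 0.
Proof. by move=> fx; apply/eqP; apply: contra_notT fx => fx0; exact: subset_closure. Qed.

(** Heine-Cantor on the compact support. A pair of points with one in the support is covered up to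
    symmetry; for a pair outside it both values are [0]. *)
Lemma Cc_uniform_continuous k O f : Cc k O f -> forall e : R, 0 < e ->
  exists2 d : R, 0 < d & forall x y, `|x - y| < d -> `|f x - f y| < e.
Proof.
move=> [Ckf cK _] e e0.
have cf : continuous f by case: k Ckf => // k [].
set K := tsupport f in cK *.
have H : \forall d \near (0:R)^'+, K `<=` (fun x => forall y, `|x - y| < d -> `|f x - f y| < e).
  apply: ((compact_near_coveringP K).1 cK R (0^'+)
    (fun d x => forall y, `|x - y| < d -> `|f x - f y| < e)) => x Kx.
  have e2 : 0 < e / 2 by rewrite divr_gt0.
  have /nbhs_ballP[r /= r0 rP] : \forall y \near x, `|f x - f y| < e / 2.
    by have /cvgrPdist_lt/(_ _ e2) := cf x.
  have r2 : 0 < r / 2 by rewrite divr_gt0.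
  exists (ball x (r / 2), [set d | 0 < d < r / 2]) => /=.
    split; first exact: nbhsx_ballx.
    near=> d; apply/andP; split; first by near: d; exact: nbhs_right_gt.
    by near: d; exact: nbhs_right_lt.
  move=> [z d] /= [xz /andP[d0 dr]] y zy.
  rewrite -ball_normE/= in xz.
  have h1 : `|f x - f z| < e / 2.
    by apply: rP; rewrite -ball_normE/= (lt_le_trans xz)// ler_pdivrMr// mulr2n; lra.
  have h2 : `|f x - f y| < e / 2.
    apply: rP; rewrite -ball_normE/=.
    by have := ler_distD z x y; lra.
  have := ler_distD (f x) (f z) (f y); rewrite (distrC (f z) (f x)); lra.
have : \forall d \near (0:R)^'+, 0 < d /\
    K `<=` (fun x => forall y, `|x - y| < d -> `|f x - f y| < e).
  by apply: filterI => //; exact: nbhs_right_gt.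
move=> /filter_ex[d [d0 dP]]; exists d => // x y xy.
have [Kx|Kx] := pselect (K x); first exact: dP.
have [Ky|Ky] := pselect (K y); first by rewrite distrC; apply: dP; rewrite // distrC.
by rewrite !tsupport_eq0// subrr normr0.
Unshelve. all: by end_near. Qed.

(* The distance to the complement of [U], truncated at [1] so that the infimum
   is over a nonempty set even when [U] is the whole space. *)
Lemma dist_complement (U : set 'rV[R]_n) : open U -> exists D : 'rV[R]_n -> R,
  [/\ forall x y, `|D x - D y| <= `|x - y|, forall x, 0 <= D x,
      forall x, ~ U x -> D x = 0 & forall x, U x -> 0 < D x].
Proof.
move=> oU.
pose S x := [set t | t = 1 \/ exists2 a, ~ U a & t = `|x - a|].
have S0 x : S x !=set0 by exists 1; left.
have lbS x : lbound (S x) 0 by move=> t [->//|[a _ ->]//].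
have hlS x : has_lbound (S x) by exists 0.
have H x y : inf (S x) - `|x - y| <= inf (S y).
  apply: lb_le_inf => // t [->|[a Ua ->]].
    rewrite lerBlDr (le_trans (y := 1))// ?lerDl//.
    by apply: ge_inf => //; left.
  rewrite lerBlDr (le_trans (y := `|x - a|))//.
    by apply: ge_inf => //; right; exists a.
  by rewrite [leRHS]addrC; exact: ler_distD.
exists (fun x => inf (S x)); split => //.
- move=> x y; rewrite ler_norml; apply/andP; split.
    by have := H y x; rewrite distrC; lra.
  by have := H x y; lra.
- by move=> x; exact: lb_le_inf.
- move=> x Ux; apply/eqP; rewrite eq_le lb_le_inf// andbT.
  by apply: ge_inf => //; right; exists x; rewrite ?subrr ?normr0.
- move=> x Ux; have /nbhs_ballP[r /= r0 rU] : nbhs x U by move: oU; rewrite openE; exact.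
  have : Num.min 1 r <= inf (S x).
    apply: lb_le_inf => // t [->|[a Ua ->]]; first by rewrite ge_min lexx.
    rewrite ge_min; apply/orP; right; rewrite leNgt; apply/negP => xa.
    by apply: Ua; apply: rU; rewrite -ball_normE.
  by apply: lt_le_trans; rewrite lt_min ltr01.
Qed.

Lemma lipschitz1_continuous (D : 'rV[R]_n -> R) :
  (forall x y, `|D x - D y| <= `|x - y|) -> continuous D.
Proof.
move=> DL x; apply/(@cvgrPdist_lt _ _ _ (nbhs (x : 'rV[R]_n))) => e e0; near=> y.
apply: le_lt_trans (DL _ _) _; near: y.
by have := nbhsx_ballx x _ e0; rewrite -ball_normE.
Unshelve. all: by end_near. Qed.

Lemma coord_le_norm (x : 'rV[R]_n) j : `|x ord0 j| <= `|x|.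
Proof.
rewrite (_ : `|x| = mx_norm x)// mx_normrE.
exact: (le_bigmax _ (fun ij : 'I_1 * 'I_n => `|x ij.1 ij.2|) (ord0, j)).
Qed.

Lemma bounded_set_ub (U : set 'rV[R]_n) : bounded_set U ->
  exists2 M : R, 0 < M & forall x, U x -> `|x| <= M.
Proof.
move=> [M [Mr MU]]; exists (`|M| + 1); first by rewrite ltr_wpDl.
by move=> x Ux; apply: MU => //; rewrite (le_lt_trans (ler_norm _))// ltrDl.
Qed.

Lemma superlevel_compact (U : set 'rV[R]_n) (D : 'rV[R]_n -> R) r :
  bounded_set U -> continuous D -> (forall x, ~ U x -> D x = 0) -> 0 < r ->
  compact [set x | r <= D x] /\ [set x | r <= D x] `<=` U.
Proof.
move=> bU cD DU r0.
have sub : [set x | r <= D x] `<=` U.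
  by move=> x /= rD; apply: contrapT => /DU Dx0; rewrite Dx0 leNgt r0 in rD.
split => //; apply: bounded_closed_compact.
  have [M M0 MU] := bounded_set_ub bU.
  exists M; split; first exact: gtr0_real.
  by move=> t Mt x /sub/MU xM; exact: le_trans xM (ltW Mt).
by apply: ((continuous_closedP D).1 cD [set t | r <= t]); exact: closed_ge.
Qed.

(** By a covering argument rather than an attained minimum, so that an empty [K] is included. *)
Lemma compact_superlevel (U K : set 'rV[R]_n) (D : 'rV[R]_n -> R) :
  compact K -> K `<=` U -> continuous D -> (forall x, U x -> 0 < D x) ->
  exists2 r : R, 0 < r & forall x, K x -> r <= D x.
Proof.
move=> cK KU cD D0.
have H : \forall d \near (0:R)^'+, K `<=` (fun x => d <= D x).
  apply: ((compact_near_coveringP K).1 cK R (0^'+) (fun d x => d <= D x)) => x Kx.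
  have Dx := D0 _ (KU _ Kx).
  have Dx2 : 0 < D x / 2 by rewrite divr_gt0.
  exists ([set y | D x / 2 < D y], [set d | d < D x / 2]) => /=.
    split; last exact: nbhs_right_lt.
    apply: cvgr_gt (cD x) _ _; lra.
  by move=> [y d] /= [h1 h2]; rewrite ltW// (lt_trans h2).
have : \forall d \near (0:R)^'+, 0 < d /\ K `<=` (fun x => d <= D x).
  by apply: filterI => //; exact: nbhs_right_gt.
by move=> /filter_ex[d [d0 dP]]; exists d.
Qed.

End compact_support.

(** * Uniform density of $C^1_c$ in $C^0_c$ *)

Section C1_density.
Context (R : realType) (n : nat).
Variables (s ds : R -> R).
Hypothesis ds_s : forall x : R, is_derive x 1 s (ds x).
Hypothesis cds : continuous ds.
Hypothesis s_homo : {homo s : x y / x <= y}.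
Hypothesis s0 : forall x, x <= 0 -> s x = 0.
Hypothesis s1 : forall x, 1 <= x -> s x = 1.

(* Hats of width [2 h] centered at [h * (m - N)]; the sum over [m < 2 N]
   telescopes to [1] on [-h (N - 1), h (N - 1)]. *)
Let hat (h : R) (N m : nat) (t : R) : R :=
  s (t / h + N%:R - m%:R + 1) - s (t / h + N%:R - m%:R).

Let hat_ge0 h N m t : 0 <= hat h N m t.
Proof. by rewrite subr_ge0 s_homo// lerDl. Qed.

Let hat_support h N m t : 0 < h -> hat h N m t != 0 ->
  `|t - h * (m%:R - N%:R)| <= h.
Proof.
move=> h0; apply: contraNT; rewrite -ltNge => H; apply/eqP.
have E : t = h * (t / h) by rewrite mulrCA divff ?mulr1// gt_eqF.
rewrite /hat; set z := t / h in E *.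
rewrite E -mulrBr normrM gtr0_norm// in H.
have {}H : 1 < `|z - (m%:R - N%:R)| by rewrite -(ltr_pM2l h0) mulr1.
have -> : z + N%:R - m%:R = z - (m%:R - N%:R) by lra.
set w := z - _ in H *.
have [w0|w0] := leP 0 w.
  by rewrite ger0_norm// in H; rewrite !s1 ?subrr//; lra.
by rewrite ltr0_norm// in H; rewrite !s0 ?subrr//; lra.
Qed.

Let hat_sum h N t : 0 < h -> `|t| <= h * (N%:R - 1) ->
  \sum_(m < (2 * N)%N) hat h N m t = 1.
Proof.
move=> h0 H.
have E : t = h * (t / h) by rewrite mulrCA divff ?mulr1// gt_eqF.
set z := t / h in E.
have {H} : `|z| <= N%:R - 1.
  by rewrite -(ler_pM2l h0) -[X in X * `|_|](gtr0_norm h0) -normrM -E.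
rewrite ler_norml => /andP[z1 z2].
pose F (m : nat) := - s (z + N%:R - m%:R + 1).
transitivity (\sum_(0 <= m < 2 * N) (F m.+1 - F m)).
  rewrite big_mkord; apply: eq_bigr => m _; rewrite /F /hat -/z opprK addrC -natr1.
  by congr (_ + _); congr (- s _); lra.
rewrite telescope_sumr// /F opprK natrM addrC s1; last by lra.
by rewrite s0 ?subr0//; lra.
Qed.

Let C1_hat h N m (j : 'I_n) : Ck 1 (fun x : 'rV[R]_n => hat h N m (x ord0 j)).
Proof.
have cs c : Ck 1 (fun x : 'rV[R]_n => s (h^-1 * x ord0 j + c)).
  apply: (Ck1_comp ds_s cds); apply: Ck1D; last exact: Ck1_cst.
  by apply: Ck1Z; exact: Ck1_coord.
have := Ck1D (cs (N%:R - m%:R + 1)) (Ck1Z (-1) (cs (N%:R - m%:R))).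
rewrite (_ : (fun _ => _) = (fun x : 'rV[R]_n => hat h N m (x ord0 j)))//.
by apply/funext => x; rewrite /hat mulN1r [x _ _ / h]mulrC -!addrA.
Qed.

(** Samples [f] on a grid of mesh [h] and interpolates with the [B k], products of one-dimensional
    hats: they are nonnegative, supported within [h] of the grid point [p k], and sum to [1] on
    [O]-points with [r <= D x]. Uniform continuity of [f] bounds the error. *)
Lemma Cc1_dense_of_step (O : set 'rV[R]_n) f : open O -> bounded_set O -> Cc 0 O f ->
  forall e : R, 0 < e -> exists2 g, Cc 1 O g & forall x, `|f x - g x| <= e.
Proof.
move=> oO bO Ocf e e0.
have [d d0 dP] := Cc_uniform_continuous Ocf e0.
have [D [DL D0 DO DOp]] := dist_complement oO.
have cD := lipschitz1_continuous DL.
have [_ cK KO] := Ocf.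
have [r0 r0_gt0 r0P] := compact_superlevel cK KO cD DOp.
(* The support of [f] lies in [r0 <= D]. As [D] is 1-Lipschitz and [h <= r], the interpolant lives
   in the compact set [r <= D]. *)
pose r := r0 / 2; have r_gt0 : 0 < r by rewrite divr_gt0.
have [crD rDO] := superlevel_compact bO cD DO r_gt0.
have [M M0 MO] := bounded_set_ub bO.
pose h := Num.min (d / 2) r.
have h0 : 0 < h by rewrite lt_min r_gt0 divr_gt0.
have hd : h < d by rewrite gt_min; apply/orP; left; lra.
have hr : h <= r by rewrite ge_min lexx orbT.
(* The hats sum to [1] on coordinates of modulus at most [h * (N%:R - 1)]; this must cover [M],
   hence the shift by two. *)
pose N := (Num.truncn (M / h)).+2.
have NM : M <= h * (N%:R - 1).
  rewrite mulrC -ler_pdivrMr// /N -natr1 addrK.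
  exact/ltW/truncnS_gt.
pose p (k : {ffun 'I_n -> 'I_(2 * N)}) : 'rV[R]_n := \row_j (h * ((k j)%:R - N%:R)).
pose B (k : {ffun 'I_n -> 'I_(2 * N)}) (x : 'rV[R]_n) := \prod_j hat h N (k j) (x ord0 j).
have B0 k x : 0 <= B k x by apply: prodr_ge0 => j _; exact: hat_ge0.
have Bp k x : B k x != 0 -> `|x - p k| <= h.
  move=> /prodf_neq0 H; rewrite (_ : `|_| = mx_norm (x - p k))// mx_normrE.
  apply/bigmax_leP; split => [|[i j] _]; first exact: ltW.
  rewrite !mxE (ord1 i)/=; apply: hat_support => //.
  exact: H.
pose g x := \sum_k f (p k) * B k x.
have gz x : ~ (r <= D x) -> g x = 0 /\ f x = 0.
  move=> rDx; split; last first.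
    apply: tsupport_eq0 => /r0P; apply/negP; rewrite -ltNge.
    move/negP: rDx; rewrite -ltNge /r; lra.
  apply: big1 => k _; have [->|/Bp Bk] := eqVneq (B k x) 0; first by rewrite mulr0.
  rewrite tsupport_eq0 ?mul0r// => /r0P H; apply: rDx.
  have := DL (p k) x; have := ler_norm (D (p k) - D x); rewrite (distrC (p k) x).
  move: H Bk hr => /=; rewrite /r; lra.
have Bsum x : r <= D x -> \sum_k B k x = 1.
  move=> /rDO/MO xM; rewrite /B.
  (* The sum over grid points of products is the product over coordinates of one-dimensional sums,
     each equal to [1]. *)
  rewrite -(@bigA_distr_bigA _ _ _ _ _ _ _ (fun j m => hat h N (nat_of_ord m) (x ord0 j))).
  rewrite big1// => j _; apply: hat_sum => //; apply: le_trans NM.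
  exact: le_trans (coord_le_norm _ _) xM.
exists g; last first.
  move=> x; have [rDx|/gz[-> ->]] := pselect (r <= D x); last by rewrite subrr normr0 ltW.
  rewrite -[f x]mulr1 -(Bsum _ rDx) mulr_sumr -sumrB.
  apply: le_trans (ler_norm_sum _ _ _) _.
  rewrite -[e]mulr1 -(Bsum _ rDx) mulr_sumr; apply: ler_sum => k _.
  rewrite -mulrBl normrM (ger0_norm (B0 _ _)).
  have [->|/Bp Bk] := eqVneq (B k x) 0; first by rewrite !mulr0.
  by apply: ler_wpM2r => //; apply/ltW/dP; exact: le_lt_trans hd.
apply: (Cc_of_compact _ crD rDO); last by move=> x /gz[].
by apply: Ck1_sum => k; apply: Ck1Z; apply: Ck1_prod => j; exact: C1_hat.
Qed.

End C1_density.

Lemma Cc1_dense (R : realType) (n : nat) (O : set 'rV[R]_n) f :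
  open O -> bounded_set O -> Cc 0 O f ->
  forall e : R, 0 < e -> exists2 g, Cc 1 O g & forall x, `|f x - g x| <= e.
Proof.
by have [s [ds [? ? ? ? ?]]] := C1_step R; exact: (@Cc1_dense_of_step R n s ds).
Qed.

(** * Lebesgue integration on [R^n] *)

Section lebesgue_rV_theory.
Context (R : realType).
Local Notation leb := (lebesgue_rV R _).

Lemma rV_cons0 n (p : R * 'rV[R]_n) : rV_cons p ord0 ord0 = p.1.
Proof.
rewrite (_ : ord0 = lshift n (ord0 : 'I_1)) /rV_cons; last exact/val_inj.
by apply: (etrans (row_mxEl _ _ _ _)); rewrite mxE.
Qed.

Lemma rV_consS n (p : R * 'rV[R]_n) j : rV_cons p ord0 (lift ord0 j) = p.2 ord0 j.
Proof.
rewrite (_ : lift ord0 j = rshift 1 j); last exact/val_inj.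
exact: (row_mxEr _ _ _ _).
Qed.

Lemma rV_consP n (u v : 'rV[R]_n.+1) : u ord0 ord0 = v ord0 ord0 ->
  (forall j, u ord0 (lift ord0 j) = v ord0 (lift ord0 j)) -> u = v.
Proof.
by move=> uv0 uvS; apply/rowP => i; case: (unliftP ord0 i) => [j ->|->].
Qed.

Lemma rV_linE n (h : R) (u v : 'rV[R]_n) i :
  (h *: u + v) ord0 i = h * u ord0 i + v ord0 i.
Proof. by rewrite !mxE. Qed.

Lemma rV_subE n (u v : 'rV[R]_n) i : (u - v) ord0 i = u ord0 i - v ord0 i.
Proof. by rewrite !mxE. Qed.

Lemma rV_basisE n (i j : 'I_n) : rV_basis R i ord0 j = (j == i)%:R.
Proof. by rewrite mxE eqxx. Qed.

Lemma rV_cons_basis0 n (x h : R) (y : 'rV[R]_n) :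
  rV_cons (h + x, y) = h *: rV_basis R ord0 + rV_cons (x, y).
Proof.
apply: rV_consP => [|j]; rewrite rV_linE rV_basisE ?rV_cons0 ?rV_consS/=.
  by rewrite mulr1.
by rewrite mulr0 add0r.
Qed.

Lemma rV_cons_basisS n (x h : R) (y : 'rV[R]_n) j :
  rV_cons (x, h *: rV_basis R j + y) = h *: rV_basis R (lift ord0 j) + rV_cons (x, y).
Proof.
apply: rV_consP => [|k]; rewrite rV_linE rV_basisE ?rV_cons0 ?rV_consS/=.
  by rewrite mulr0 add0r.
by rewrite rV_linE rV_basisE (inj_eq lift_inj).
Qed.

Lemma rV_norm_le n (x : 'rV[R]_n) (M : R) : 0 <= M ->
  (`|x| <= M) = [forall i, `|x ord0 i| <= M].
Proof.
move=> M0; apply/idP/forallP => [xM i|H]; first exact: le_trans (coord_le_norm _ _) xM.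
rewrite (_ : `|x| = mx_norm x)// mx_normrE.
by apply/bigmax_leP; split => // -[i j] _ /=; rewrite (ord1 i).
Qed.

Lemma rV_cons_norm n (x : R) (y : 'rV[R]_n) :
  `|rV_cons (x, y)| = Num.max `|x| `|y|.
Proof.
apply/eqP; rewrite eq_le; apply/andP; split.
  rewrite rV_norm_le ?le_max ?normr_ge0//; apply/forallP => i.
  case: (unliftP ord0 i) => [j ->|->]; rewrite ?rV_cons0 ?rV_consS/= le_max.
    by rewrite coord_le_norm orbT.
  by rewrite lexx.
rewrite ge_max -{1}[x](rV_cons0 (x, y)) coord_le_norm/= rV_norm_le//; apply/forallP => j.
by rewrite -[y ord0 j](rV_consS (x, y)) coord_le_norm.
Qed.

Lemma rV_consB n (x x' : R) (y y' : 'rV[R]_n) :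
  rV_cons (x, y) - rV_cons (x', y') = rV_cons (x - x', y - y').
Proof.
by apply: rV_consP => [|j]; rewrite rV_subE ?rV_cons0 ?rV_consS/= ?rV_subE.
Qed.

Lemma rV_cons_continuousl n (y : 'rV[R]_n) : continuous (fun x : R => rV_cons (x, y)).
Proof.
move=> x; apply/cvgrPdist_lt => e e0; near=> z.
rewrite rV_consB subrr rV_cons_norm normr0 gt_max e0 andbT.
by near: z; have := nbhsx_ballx x _ e0; rewrite -ball_normE.
Unshelve. all: by end_near. Qed.

Lemma rV_cons_continuousr n (x : R) : continuous (fun y : 'rV[R]_n => rV_cons (x, y)).
Proof.
move=> y; apply/(@cvgrPdist_lt _ _ _ (nbhs (y : 'rV[R]_n))) => e e0; near=> z.
rewrite rV_consB subrr rV_cons_norm normr0 gt_max e0/=.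
by near: z; have := nbhsx_ballx y _ e0; rewrite -ball_normE.
Unshelve. all: by end_near. Qed.

Lemma lebesgue_rV_cons n A : lebesgue_rV R n.+1 A =
  (@lebesgue_measure R \x lebesgue_rV R n)%E (@rV_cons R n @^-1` A).
Proof. by []. Qed.

Lemma closed_ball0_measurable n (M : R) : measurable [set x : 'rV[R]_n | `|x| <= M].
Proof.
rewrite -[X in measurable X]setTI.
apply: (@measurable_fun_le _ _ R setT (fun x : 'rV[R]_n => `|x|) (cst M)) => //.
by apply: continuous_measurable_rV; exact: norm_continuous.
Qed.

(** The norm is the sup norm, so a ball of $\mathbb R^{n+1}$ is an interval times a ball of $\mathbb
    R^n$. *)
Lemma lebesgue_rV_ball_fin n (M : R) : (leb [set x : 'rV[R]_n | (`|x| <= M)%R] < +oo)%E.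
Proof.
elim: n => [|n IH].
  by rewrite (le_lt_trans (le_measure (\d_(0 : 'rV[R]_0)) _ _ (@subsetT _ _))) ?inE//=;
    [exact: closed_ball0_measurable|rewrite diracT ltry].
rewrite lebesgue_rV_cons.
rewrite (_ : _ @^-1` _ = `[(- M), M]%classic `*` [set x : 'rV[R]_n | `|x| <= M]); last first.
  by apply/seteqP; split => -[x y] /=; rewrite rV_cons_norm ge_max in_itv/= ler_norml => /andP.
rewrite product_measure1E//; last exact: closed_ball0_measurable.
have fM : @lebesgue_measure R `[(- M), M]%classic \is a fin_num.
  by rewrite lebesgue_measure_itv/=; case: ifP.
by rewrite lte_mul_pinfty.
Qed.

Lemma lebesgue_rV_bounded_fin n (O : set 'rV[R]_n) : measurable O -> bounded_set O ->
  (leb O < +oo)%E.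
Proof.
move=> mO /bounded_set_ub[M _ OM].
apply: le_lt_trans (lebesgue_rV_ball_fin n M).
by apply: le_measure; rewrite ?inE//; exact: closed_ball0_measurable.
Qed.

Lemma bounded_integrable n (O : set 'rV[R]_n) (f : 'rV[R]_n -> R) (M : R) :
  measurable O -> bounded_set O -> measurable_fun O f ->
  (forall x, O x -> `|f x| <= M) ->
  leb.-integrable O (EFin \o f).
Proof.
move=> mO bO mf fM; apply: measurable_bounded_integrable => //.
  exact: lebesgue_rV_bounded_fin.
exists M; split; first exact: num_real.
by move=> t Mt x Ox; exact: le_trans (fM _ Ox) (ltW Mt).
Qed.

End lebesgue_rV_theory.

(** * Fubini's theorem and integrals of partial derivatives *)

Section compact_support_integral.
Context (R : realType).
Local Notation leb := (lebesgue_rV R _).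

Lemma Cc_bounded n (O : set 'rV[R]_n) k (f : 'rV[R]_n -> R) : Cc k O f ->
  exists2 M : R, 0 < M & forall x, `|f x| <= M.
Proof.
move=> [Ckf cK _].
have cf : continuous f by case: k Ckf => // k [].
have /compact_bounded : compact (f @` tsupport f).
  by apply: continuous_compact => //; exact: continuous_subspaceT.
move=> [M [_ MP]]; exists (`|M| + 1); first by rewrite ltr_wpDl.
move=> x; have [xK|xK] := pselect (tsupport f x); last first.
  by rewrite tsupport_eq0// normr0 ltW// ltr_wpDl.
by apply: MP; [rewrite (le_lt_trans (ler_norm _))// ltrDl|exists x].
Qed.

Lemma Cc_support_ball n (O : set 'rV[R]_n) k (f : 'rV[R]_n -> R) : Cc k O f ->
  exists2 M : R, 0 < M & forall x, M < `|x| -> f x = 0.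
Proof.
move=> [_ /compact_bounded/bounded_set_ub[M M0 KM] _]; exists M => // x Mx.
by apply: tsupport_eq0 => /KM; apply/negP; rewrite -ltNge.
Qed.

Lemma Cc_continuous n (O : set 'rV[R]_n) k (f : 'rV[R]_n -> R) : Cc k O f -> continuous f.
Proof. by move=> [Ckf _ _]; case: k Ckf => // k []. Qed.

Lemma Cc_integrableT n (O : set 'rV[R]_n) k (f : 'rV[R]_n -> R) : Cc k O f ->
  leb.-integrable setT (EFin \o f).
Proof.
move=> Cf; have [M M0 fM] := Cc_support_ball Cf; have [N N0 fN] := Cc_bounded Cf.
pose B := [set x : 'rV[R]_n | `|x| <= M].
have mB : measurable B by exact: closed_ball0_measurable.
rewrite (_ : EFin \o f = (EFin \o f) \_ B); last first.
  apply/funext => x; rewrite patchE; case: ifPn => //; rewrite notin_setE /B/= => /negP.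
  by rewrite -ltNge => /fM ->.
apply: ((integrable_mkcond _ mB).1 _); apply: (@bounded_integrable _ _ _ _ N) => //.
  exists M; split; first exact: num_real.
  by move=> t Mt x Bx; exact: le_trans Bx (ltW Mt).
apply: measurable_funS (continuous_measurable_rV (Cc_continuous Cf)) => //.
Qed.

Lemma Cc_integrable n (O : set 'rV[R]_n) k (f : 'rV[R]_n -> R) : measurable O -> Cc k O f ->
  leb.-integrable O (EFin \o f).
Proof. by move=> mO /Cc_integrableT; apply: integrableS. Qed.

Lemma Rintegral_support n (O : set 'rV[R]_n) (f : 'rV[R]_n -> R) :
  (forall x, ~ O x -> f x = 0) -> \int[leb]_(x in O) f x = \int[leb]_x f x.
Proof.
move=> fO; rewrite Rintegral_mkcond; congr (Rintegral _ _ _).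
by apply/funext => x; rewrite patchE; case: ifPn => //; rewrite notin_setE => /fO ->.
Qed.

Lemma Cc_partial n (O : set 'rV[R]_n) (f : 'rV[R]_n -> R) i : Cc 1 O f ->
  Cc 0 O (partial i f).
Proof.
move=> [[cf df cdf] cK KO]; apply: (@Cc_of_compact _ _ 0%N _ _ _ (cdf i) cK KO) => x Kx.
have : \near x, f x = cst 0 x.
  have oK : open (~` tsupport f) by exact/closed_openC/closed_closure.
  have : nbhs x (~` tsupport f) by exact: open_nbhs_nbhs.
  by apply: filterS => y /tsupport_eq0.
move=> /near_eq_derive H; rewrite /partial H; exact: derive_cst.
Qed.

Lemma integral_derive_compact (F f : R -> R) (M : R) : continuous f ->
  (forall x : R, is_derive x 1 F (f x)) -> 0 < M ->
  (forall x, M < `|x| -> F x = 0) ->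
  (\int[@lebesgue_measure R]_x (f x)%:E = 0)%E.
Proof.
move=> cf dF M0 FM.
have fM x : M < `|x| -> f x = 0.
  move=> Mx; have [_ <-] := dF x.
  have : \near x, F x = cst 0 x.
    have : \forall y \near x, M < `|y|.
      have /cvgr_gt := @norm_continuous R R^o x; exact.
    by apply: filterS => y /FM.
  by move=> /near_eq_derive ->; rewrite derive_cst.
have cF : continuous F by exact: is_derive1_continuous.
(* Both endpoints then lie strictly in the region where [F] vanishes. *)
pose N := M + 1.
have MN : M < N by rewrite ltrDl.
have NN : - N < N by lra.
have -> : (\int[@lebesgue_measure R]_x (f x)%:E =
    \int[@lebesgue_measure R]_(x in `[(- N)%R, N]) (f x)%:E)%E.
  rewrite [RHS]integral_mkcond; apply: eq_integral => x _; rewrite patchE.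
  case: ifPn => //; rewrite notin_setE/= in_itv/= -ler_norml => /negP.
  by rewrite -ltNge => Nx; rewrite fM// (lt_trans MN).
rewrite (continuous_FTC2 NN (F := F)).
- by rewrite !FM ?sube0// ?normrN gtr0_norm//; lra.
- exact: continuous_subspaceT.
- split => [x _||]; first by have [] := dF x.
    exact/cvg_at_right_filter/cF.
  exact/cvg_at_left_filter/cF.
- by move=> x _; rewrite derive1E; have [_ ->] := dF x.
Qed.

(** Change of variables for the pushforward that defines Lebesgue measure; it brings integrals on
    $\mathbb R^{n+1}$ into the product form that Fubini's theorem requires. *)
Lemma integral_rV_cons n (f : 'rV[R]_n.+1 -> R) : continuous f ->
  leb.-integrable setT (EFin \o f) ->
  (@lebesgue_measure R \x lebesgue_rV R n)%E.-integrable setT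
     (fun p : measurableTypeR R * 'rV[R]_n => (f (rV_cons p))%:E) /\
  (\int[lebesgue_rV R n.+1]_x (f x)%:E =
   \int[(@lebesgue_measure R \x lebesgue_rV R n)%E]_p (f (rV_cons p))%:E)%E.
Proof.
move=> cf fi.
pose X : measurableType _ := (measurableTypeR R * 'rV[R]_n)%type.
have mc : measurable_fun [set: X] (@rV_cons R n) by exact: measurable_rV_cons.
have mf : measurable_fun setT (EFin \o f).
  by apply/measurable_EFinP; exact: continuous_measurable_rV.
pose mu : {measure set X -> \bar R} :=
  (@lebesgue_measure R \x lebesgue_rV R n)%E.
have I : mu.-integrable setT ((EFin \o f) \o @rV_cons R n).
  apply/integrableP; split; first exact: measurableT_comp.
  have /integrableP[_] := fi.
  have := @ge0_integral_pushforward _ _ X _ R _ mc mu setT (abse \o (EFin \o f)) measurableT.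
  rewrite preimage_setT => <- //; first exact: measurableT_comp.
  by move=> x _; exact: abse_ge0.
split => //.
have := @integral_pushforward _ _ X _ R _ mc mu setT (EFin \o f) mf.
by rewrite preimage_setT => /(_ I measurableT).
Qed.

Lemma Cc1_slice n (h : 'rV[R]_n.+1 -> R) (x : R) : Cc 1 setT h ->
  Cc 1 setT (fun y : 'rV[R]_n => h (rV_cons (x, y))) /\
  forall j y, partial j (fun y : 'rV[R]_n => h (rV_cons (x, y))) y =
    partial (lift ord0 j) h (rV_cons (x, y)).
Proof.
move=> Ch; have [[ch dh cdh] _ _] := Ch.
have cc := @rV_cons_continuousr R n x.
have dhx j y : is_derive y (rV_basis R j) (fun y : 'rV[R]_n => h (rV_cons (x, y)))
    (partial (lift ord0 j) h (rV_cons (x, y))).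
  have E : (fun t : R => h (rV_cons (x, t *: rV_basis R j + y))) =
      (fun t : R => h (t *: rV_basis R (lift ord0 j) + rV_cons (x, y))).
    by apply/funext => t; rewrite rV_cons_basisS.
  split; last by rewrite /partial derive_line [RHS]derive_line E.
  by apply/derivable1P; rewrite E; exact: ((derivable1P _ _ _).1 (dh _ _)).
split; last by move=> j y; exact: (partialE (dhx j y)).
have [M M0 hM] := Cc_support_ball Ch.
apply: (@Cc_of_compact _ _ _ _ [set y : 'rV[R]_n | `|y| <= M]) => //.
- apply: (Ck1_is_derive _ dhx) => [y|j y].
    exact: (@continuous_comp _ _ _ (fun y : 'rV[R]_n => rV_cons (x, y)) h y (cc y) (ch _)).
  exact: (@continuous_comp _ _ _ (fun y : 'rV[R]_n => rV_cons (x, y)) _ y (cc y) (cdh _ _)).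
- apply: bounded_closed_compact.
    exists M; split; first exact: num_real.
    by move=> t Mt y yM; exact: le_trans yM (ltW Mt).
  apply: ((continuous_closedP (fun y : 'rV[R]_n => `|y|)).1 _ [set t | t <= M]);
    last exact: closed_le.
  exact: norm_continuous.
- move=> y /negP; rewrite -ltNge => My; apply: hM.
  by rewrite rV_cons_norm lt_max My orbT.
Qed.

(** Induction on the dimension with Fubini. For a coordinate other than the first the inner integral
    over $\mathbb R^n$ vanishes by induction; for the first one, integrate it first and use the
    fundamental theorem of calculus. *)
Lemma integral_partial n (h : 'rV[R]_n -> R) i : Cc 1 setT h ->
  (\int[leb]_x (partial i h x)%:E = 0)%E.
Proof.
elim: n h i => [|n IH] h i Ch; first by case: i.
have Cdh := Cc_partial i Ch.
have [Ip ->] := integral_rV_cons (Cc_continuous Cdh) (Cc_integrableT Cdh).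
have [[ch dh cdh] _ _] := Ch.
case: (unliftP ord0 i) Ip Cdh => [j ->|->] Ip Cdh.
  rewrite -integral12_prod_meas1// integral0_eq// => x _; rewrite /fubini_F.
  have [Chx E] := Cc1_slice x Ch.
  by under eq_integral do rewrite -E; exact: IH.
rewrite -integral21_prod_meas1// integral0_eq// => y _; rewrite /fubini_G.
have [M M0 hM] := Cc_support_ball Ch.
have D (x : R) : is_derive x 1 (fun t : R => h (rV_cons (t, y)))
    (partial ord0 h (rV_cons (x, y))).
  have E : (fun t : R => h (rV_cons (t *: 1 + x, y))) =
      (fun t : R => h (t *: rV_basis R ord0 + rV_cons (x, y))).
    by apply/funext => t; rewrite -rV_cons_basis0 [_ *: 1]mulr1.
  split; last by rewrite /partial derive_line [RHS]derive_line E.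
  by apply/derivable1P; rewrite E; exact: ((derivable1P _ _ _).1 (dh _ _)).
apply: (integral_derive_compact (F := fun t : R => h (rV_cons (t, y))) (M := M)) => //.
  move=> t; exact: (@continuous_comp _ _ _ (fun t : R => rV_cons (t, y)) _ t
    (@rV_cons_continuousl R n y t) (cdh _ _)).
by move=> x Mx; apply: hM; rewrite rV_cons_norm lt_max Mx.
Qed.

End compact_support_integral.

(** * Positive semidefinite forms *)

Section psd_form.
Context (R : realType) (E : lmodType R).
Implicit Types (X : set E) (q : E -> E -> R).

Definition lin_closed X := X 0 /\ forall (a : R) u v, X u -> X v -> X (a *: u + v).

(** Only semidefinite: functions are not identified up to null sets, so [q u u = 0] does not force
    [u = 0]. *)
Definition psd_form X q :=
  [/\ lin_closed X,
      forall (a : R) u v w, X u -> X v -> X w -> q (a *: u + v) w = a * q u w + q v w,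
      forall u v, X u -> X v -> q u v = q v u &
      forall u, X u -> 0 <= q u u].

Lemma quadratic_ge0_discriminant (a b c : R) : 0 <= c ->
  (forall t : R, 0 <= a + 2 * b * t + c * t ^+ 2) -> b ^+ 2 <= a * c.
Proof.
rewrite le_eqVlt => /predU1P[<-|c0] H.
  have [->|b0] := eqVneq b 0; first by rewrite expr0n mulr0.
  (* At this [t] the affine function [a + 2 * b * t] takes the value [-1]. *)
  have := H (- (a + 1) / (2 * b)); rewrite mul0r addr0 mulrC divfK ?mulf_neq0//.
  by rewrite leNgt => /negP; case; lra.
have := H (- b / c).
have -> : a + 2 * b * (- b / c) + c * (- b / c) ^+ 2 = (a * c - b ^+ 2) / c.
  by field; rewrite gt_eqF.
by rewrite pmulr_lge0 ?invr_gt0// subr_ge0.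
Qed.

Variables (X : set E) (q : E -> E -> R).
Hypothesis Xq : psd_form X q.

Let nrm u := Num.sqrt (q u u).

Lemma psd_form0 : X 0.
Proof. by have [[]] := Xq. Qed.

Lemma psd_form_lin (a : R) u v : X u -> X v -> X (a *: u + v).
Proof. by have [[_ H] _ _ _] := Xq; exact: H. Qed.

Lemma psd_formZ (a : R) u : X u -> X (a *: u).
Proof. by move=> Xu; rewrite -[_ *: _]addr0; apply: psd_form_lin => //; exact: psd_form0. Qed.

Lemma psd_formlr (a : R) u v w : X u -> X v -> X w ->
  q w (a *: u + v) = a * q w u + q w v.
Proof.
move=> Xu Xv Xw; have [_ ql qs _] := Xq.
by rewrite qs//; [rewrite ql// (qs u) ?(qs v)|exact: psd_form_lin].
Qed.

Lemma psd_form_expand (a : R) u v : X u -> X v ->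
  q (a *: u + v) (a *: u + v) = q v v + 2 * q u v * a + q u u * a ^+ 2.
Proof.
move=> Xu Xv; have [_ ql qs _] := Xq; have Xuv := psd_form_lin a Xu Xv.
by rewrite ql// !psd_formlr// (qs v u)//; ring.
Qed.

Lemma psd_form_CS u v : X u -> X v -> q u v ^+ 2 <= q u u * q v v.
Proof.
move=> Xu Xv; have [_ _ _ q0] := Xq; rewrite mulrC.
apply: quadratic_ge0_discriminant; first exact: q0.
by move=> t; rewrite -psd_form_expand//; apply: q0; exact: psd_form_lin.
Qed.

Lemma psd_form_CS_sqrt u v : X u -> X v -> `|q u v| <= nrm u * nrm v.
Proof.
move=> Xu Xv; have [_ _ _ q0] := Xq.
by rewrite -sqrtr_sqr -sqrtrM ?q0// ler_wsqrtr// psd_form_CS.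
Qed.

Lemma psd_form_nrm_sqr u : X u -> nrm u ^+ 2 = q u u.
Proof. by move=> Xu; have [_ _ _ q0] := Xq; rewrite sqr_sqrtr ?q0. Qed.

(** The energy [Q v = q v v / 2 - F v] is at least [- (C ^+ 2 / 2)]. If [w] minimizes it up to
    [e ^+ 2 / 2], then [Q (t *: v + w) - Q w + e ^+ 2 / 2] is a nonnegative quadratic polynomial in
    [t], and its discriminant inequality is the claim. *)
Lemma approximate_riesz (F : E -> R) (C : R) :
  (forall (a : R) u v, X u -> X v -> F (a *: u + v) = a * F u + F v) ->
  (forall v, X v -> `|F v| <= C * nrm v) ->
  forall e : R, 0 < e ->
    exists2 w, X w & forall v, X v -> `|q w v - F v| <= e * nrm v.
Proof.
move=> Flin FC e e0; have [_ _ qs q0] := Xq.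
pose Q v := q v v / 2 - F v.
have Q_ge v : X v -> - (C ^+ 2 / 2) <= Q v.
  move=> Xv; have := FC v Xv; rewrite /Q -psd_form_nrm_sqr//.
  by have := ler_norm (F v); have := sqr_ge0 (nrm v - C); nra.
have inf_S : has_inf [set Q v | v in X].
  split; first by exists (Q 0), 0 => //; exact: psd_form0.
  by exists (- (C ^+ 2 / 2)) => _ [v Xv <-]; exact: Q_ge.
have e2 : 0 < e ^+ 2 / 2 by rewrite divr_gt0// exprn_gt0.
have [_ [w Xw <-] Qw] := inf_adherent e2 inf_S.
exists w => // v Xv.
have Qmin u : X u -> Q w - e ^+ 2 / 2 <= Q u.
  move=> Xu; rewrite lerBlDr; apply/ltW/(lt_le_trans Qw); rewrite lerD2r.
  by apply: (ge_inf inf_S.2); exists u.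
have : ((q w v - F v) / 2) ^+ 2 <= (e ^+ 2 / 2) * (q v v / 2).
  apply: quadratic_ge0_discriminant; first by rewrite divr_ge0// q0.
  move=> t; have := Qmin _ (psd_form_lin t Xv Xw).
  by rewrite /Q psd_form_expand// Flin// (qs v w)//; lra.
rewrite -psd_form_nrm_sqr// -sqrtr_sqr => H.
rewrite -[leRHS]ger0_norm; last by apply: mulr_ge0; [exact: ltW|exact: sqrtr_ge0].
rewrite -sqrtr_sqr ler_wsqrtr// exprMn.
by move: H; rewrite /nrm; lra.
Qed.

End psd_form.

(** * The $L^2$ form *)

Section L2_form.
Context (R : realType) (n : nat).
Local Notation leb := (lebesgue_rV R n).
Implicit Types (O : set 'rV[R]_n) (f g v w : 'rV[R]_n -> R).

Definition l2form O f g : R := \int[leb]_(x in O) (f x * g x).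

Lemma L2_mul_integrable O f g : measurable O -> L2 O f -> L2 O g ->
  leb.-integrable O (fun x => (f x * g x)%:E).
Proof.
move=> mO [mf If] [mg Ig].
apply: (le_integrable mO _ _ (integrableD mO If Ig)).
  by apply/measurable_EFinP; exact: measurable_funM.
move=> x Ox; rewrite -EFinD !abse_EFin lee_fin normrM [leRHS]ger0_norm ?addr_ge0 ?sqr_ge0//.
rewrite -(real_normK (num_real (f x))) -(real_normK (num_real (g x))).
by have := sqr_ge0 (`|f x| - `|g x|); have := sqr_ge0 `|f x|; have := sqr_ge0 `|g x|; nra.
Qed.

Lemma L2_lin O (a : R) f g : measurable O -> L2 O f -> L2 O g -> L2 O (a *: f + g).
Proof.
move=> mO Lf Lg; have [mf If] := Lf; have [mg Ig] := Lg; split.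
  apply: measurable_funD => //.
  exact: measurable_funM.
have I := L2_mul_integrable mO Lf Lg.
have := integrableD mO (integrableD mO (integrableZl mO (a ^+ 2) If)
   (integrableZl mO (2 * a) I)) Ig.
apply: eq_integrable => // x _ /=; rewrite -!EFinM -!EFinD; congr (_%:E).
rewrite !fctE/= /GRing.scale/=; ring.
Qed.

Lemma L2_0 O : measurable O -> L2 O 0.
Proof.
move=> mO; split; first exact: measurable_cst.
apply: eq_integrable (integrable0 _ _) => // x _ /=.
by rewrite expr0n.
Qed.

Lemma l2form_psd O : measurable O -> psd_form (L2 O) (l2form O).
Proof.
move=> mO; split.
- by split; [exact: L2_0|move=> *; exact: L2_lin].
- move=> a u v w Lu Lv Lw; rewrite /l2form.
  rewrite -RintegralZl//; last exact: L2_mul_integrable.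
  rewrite -RintegralD//; last exact: L2_mul_integrable.
    by apply: eq_Rintegral => x _; rewrite !fctE/= /GRing.scale/=; ring.
  exact: eq_integrable (integrableZl mO a (L2_mul_integrable mO Lu Lw)).
- by move=> u v _ _; apply: eq_Rintegral => x _; rewrite mulrC.
- by move=> u _; apply: Rintegral_ge0 => x _; rewrite -expr2 sqr_ge0.
Qed.

Lemma l2formE O f : l2form O f f = sqrL2norm O f.
Proof. by apply: eq_Rintegral => x _; rewrite expr2. Qed.

End L2_form.

(** * Functionals on a dense subspace of a seminormed space *)

Section psd_extension.
Context (R : realType) (E : lmodType R).
Variables (V X : set E) (p : E -> E -> R).
Hypothesis Vp : psd_form V p.
Hypothesis Xlin : lin_closed X.
Hypothesis XV : X `<=` V.

Let nrm u := Num.sqrt (p u u).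

Lemma psd_form_restrict : psd_form X p.
Proof.
have [_ pl ps p0] := Vp; split => //.
- by move=> a u v w /XV Vu /XV Vv /XV Vw; exact: pl.
- by move=> u v /XV Vu /XV Vv; exact: ps.
- by move=> u /XV; exact: p0.
Qed.

Lemma psd_nrmD u v : V u -> V v -> nrm (u + v) <= nrm u + nrm v.
Proof.
move=> Vu Vv; rewrite -[leRHS]ger0_norm ?addr_ge0 ?sqrtr_ge0//.
rewrite -[leRHS]sqrtr_sqr ler_wsqrtr// sqrrD !(psd_form_nrm_sqr Vp)//.
have := psd_form_expand Vp 1 Vu Vv; rewrite scale1r => ->.
have := psd_form_CS_sqrt Vp Vu Vv; have := ler_norm (p u v).
by rewrite -/(nrm u) -/(nrm v) mulr2n; lra.
Qed.

Lemma psd_nrmZ (a : R) u : V u -> nrm (a *: u) = `|a| * nrm u.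
Proof.
move=> Vu; have := psd_form_expand Vp a Vu (psd_form0 Vp).
have [_ pl ps _] := Vp; have V0 := psd_form0 Vp.
have p0 w : V w -> p 0 w = 0.
  by move=> Vw; have := pl (-1) _ _ _ V0 V0 Vw; rewrite scaler0 addr0; lra.
rewrite addr0 p0// (ps _ 0)// p0// => H.
rewrite /nrm (_ : p (a *: u) (a *: u) = a ^+ 2 * p u u); last by rewrite H; ring.
by rewrite sqrtrM ?sqr_ge0// sqrtr_sqr.
Qed.

Lemma psd_nrmB u v : V u -> V v -> nrm (u - v) = nrm (v - u).
Proof.
move=> Vu Vv; have Vuv : V (v - u).
  by rewrite addrC -[- u]scaleN1r; exact: (psd_form_lin Vp).
by have := psd_nrmZ (-1) Vuv; rewrite scaleN1r opprB normrN normr1 mul1r.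
Qed.

Hypothesis Xdense : forall v, V v -> forall e : R, 0 < e ->
  exists2 x, X x & nrm (x - v) < e.

Let VB u v : V u -> V v -> V (u - v).
Proof. by move=> Vu Vv; rewrite addrC -[- v]scaleN1r; exact: (psd_form_lin Vp). Qed.

(** The constant [C] serves only to make [F] continuous; density then carries the constant [k] over
    from [X] to [V]. *)
Lemma psd_bound_dense (F : E -> R) (C k : R) : 0 <= k ->
  (forall (a : R) u v, V u -> V v -> F (a *: u + v) = a * F u + F v) ->
  (forall v, V v -> `|F v| <= C * nrm v) ->
  (forall x, X x -> `|F x| <= k * nrm x) ->
  forall v, V v -> `|F v| <= k * nrm v.
Proof.
move=> k0 Flin FC Fk v Vv; apply/ler_addgt0Pr => e e0.
pose D := `|C| + k + 1.
have D0 : 0 < D by rewrite ltr_wpDl// addr_ge0.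
have [x Xx xv] := Xdense Vv (divr_gt0 e0 D0).
have Vx := XV Xx.
have FB : F v = F x - F (x - v).
  have := Flin (-1) _ _ Vv Vx.
  by rewrite scaleN1r addrC => ->; ring.
have h1 : `|F v| <= k * nrm x + `|C| * nrm (x - v).
  rewrite FB (le_trans (ler_normB _ _))// lerD//; first exact: Fk.
  apply: le_trans (FC _ (VB Vx Vv)) _.
  by rewrite ler_wpM2r ?sqrtr_ge0// ler_norm.
have h2 : nrm x <= nrm (x - v) + nrm v.
  by rewrite -{1}[x](subrK v); apply: psd_nrmD => //; exact: VB.
have h3 : nrm (x - v) * D <= e by rewrite -ler_pdivlMr// ltW.
have h4 : 0 <= nrm (x - v) by exact: sqrtr_ge0.
have h5 : 0 <= `|C| by [].
by move: h3; rewrite /D; nra.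
Qed.

(* The Hahn-Banach bounds [l x - C |x - v| <= l y + C |y - v|] leave room for
   exactly one value at each [v] of the closure of [X]. *)
Lemma psd_extension (l : E -> R) (C : R) : 0 <= C ->
  (forall (a : R) u v, X u -> X v -> l (a *: u + v) = a * l u + l v) ->
  (forall x, X x -> `|l x| <= C * nrm x) ->
  exists F : E -> R,
    [/\ forall (a : R) u v, V u -> V v -> F (a *: u + v) = a * F u + F v,
        forall v, V v -> `|F v| <= C * nrm v & forall x, X x -> F x = l x].
Proof.
move=> C0 llin lC.
have [X0 Xl] := Xlin.
have lB x y : X x -> X y -> `|l x - l y| <= C * nrm (x - y).
  move=> Xx Xy; have Xxy : X (x - y) by rewrite addrC -[- y]scaleN1r; exact: Xl.
  rewrite (_ : l x - l y = l (x - y)); first exact: lC.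
  by rewrite -[x - y]addrC -scaleN1r llin//; ring.
pose F v := sup [set l x - C * nrm (x - v) | x in X].
(* Each [l x] is the value [F v] up to this error; linearity, the bound and the agreement on [X] all
   follow from it by density. *)
have FP v : V v -> forall x, X x -> `|F v - l x| <= C * nrm (x - v).
  move=> Vv x Xx.
  have ub : ubound [set l x - C * nrm (x - v) | x in X] (l x + C * nrm (x - v)).
    move=> _ [y Xy <-]; have := lB _ _ Xy Xx; have := ler_norm (l y - l x).
    have : nrm (y - x) <= nrm (y - v) + nrm (x - v).
      rewrite (psd_nrmB (XV Xx) Vv) (_ : y - x = (y - v) + (v - x)).
        by apply: psd_nrmD; apply: VB => //; exact: XV.
      by rewrite addrA subrK.
    by nra.
  have h1 : F v <= l x + C * nrm (x - v) by apply: ge_sup => //; exists (l x - C * nrm (x - v)), x.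
  have h2 : l x - C * nrm (x - v) <= F v.
    by apply: ub_le_sup; [exists (l x + C * nrm (x - v))|exists x].
  by rewrite ler_norml; lra.
have nrm0 : nrm 0 = 0.
  by have := psd_nrmZ 0 (psd_form0 Vp); rewrite scale0r normr0 mul0r.
exists F; split.
- move=> a u v Vu Vv; apply/eqP; rewrite -subr_eq0 -normr_eq0 eq_le normr_ge0 andbT.
  apply/ler_addgt0Pl => e e0; rewrite addr0.
  (* Replacing [u], [v] by [x], [y] costs twice [C * (|a| * nrm (x - u) + nrm (y - v))]; the divisor
     [D] keeps this below [e]. *)
  pose D := 2 * C * (`|a| + 1) + 1.
  have D0 : 0 < D by rewrite ltr_wpDl// !mulr_ge0// addr_ge0.
  have [x Xx xu] := Xdense Vu (divr_gt0 e0 D0).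
  have [y Xy yv] := Xdense Vv (divr_gt0 e0 D0).
  have Vauv := psd_form_lin Vp a Vu Vv.
  have h1 := FP _ Vu _ Xx; have h2 := FP _ Vv _ Xy; have h3 := FP _ Vauv _ (Xl a _ _ Xx Xy).
  rewrite llin// in h3.
  have h4 : nrm (a *: x + y - (a *: u + v)) <= `|a| * nrm (x - u) + nrm (y - v).
    have Vxu := VB (XV Xx) Vu; have Vyv := VB (XV Xy) Vv.
    rewrite -psd_nrmZ// -[X in nrm X <= _](_ : a *: (x - u) + (y - v) = _).
      apply: psd_nrmD => //; exact: (psd_formZ Vp).
    by rewrite scalerBr opprD addrACA.
  have h1' : `|a * (F u - l x)| <= `|a| * (C * nrm (x - u)).
    by rewrite normrM ler_wpM2l.
  have h5 : nrm (x - u) * D <= e by rewrite -ler_pdivlMr// ltW.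
  have h6 : nrm (y - v) * D <= e by rewrite -ler_pdivlMr// ltW.
  have h7 : 0 <= nrm (x - u) by exact: sqrtr_ge0.
  have h8 : 0 <= nrm (y - v) by exact: sqrtr_ge0.
  have h9 : 0 <= `|a| by [].
  have -> : F (a *: u + v) - (a * F u + F v) = F (a *: u + v) - (a * l x + l y)
     - a * (F u - l x) - (F v - l y) by ring.
  apply: le_trans (ler_normB _ _) _.
  apply: le_trans (lerD (ler_normB _ _) (lexx _)) _.
  move: h1 h2 h3 h4 h5 h6 h7 h8 h9 h1'; rewrite -/(nrm _) => h1 h2 h3 h4 h5 h6 h7 h8 h9 h1'.
  apply: (@le_trans _ _ (2 * C * (`|a| * nrm (x - u) + nrm (y - v)))); first by nra.
  have H : 2 * C * (`|a| + 1) * e <= D * e by rewrite ler_pM2r// /D lerDl.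
  rewrite -(ler_pM2l D0); apply: le_trans H.
  have -> : D * (2 * C * (`|a| * nrm (x - u) + nrm (y - v))) =
    2 * C * (`|a| * (nrm (x - u) * D) + nrm (y - v) * D) by ring.
  by rewrite -[leRHS]mulrA ler_wpM2l ?mulr_ge0//; nra.
- move=> v Vv; apply/ler_addgt0Pr => e e0.
  pose D := 2 * C + 1; have D0 : 0 < D by rewrite ltr_wpDl// mulr_ge0.
  have [x Xx xv] := Xdense Vv (divr_gt0 e0 D0); have Vx := XV Xx.
  have h1 := FP _ Vv _ Xx; have h2 := lC _ Xx.
  have h3 : nrm x <= nrm (x - v) + nrm v.
    by rewrite -{1}[x](subrK v); apply: psd_nrmD => //; exact: VB.
  have h4 : nrm (x - v) * D <= e by rewrite -ler_pdivlMr// ltW.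
  have h5 : 0 <= nrm (x - v) by exact: sqrtr_ge0.
  have h6 : `|F v| <= `|F v - l x| + `|l x| by rewrite -{1}[F v](subrK (l x)) ler_normD.
  by move: h4; rewrite /D; nra.
- move=> x Xx; have := FP _ (XV Xx) _ Xx.
  by rewrite subrr nrm0 mulr0 normr_le0 subr_eq0 => /eqP.
Qed.

End psd_extension.

(** * Test functions *)

Section Cc_closure.
Context (R : realType) (n : nat).
Implicit Types (O K : set 'rV[R]_n) (f g : 'rV[R]_n -> R).

Let leq1_cases k : (k <= 1)%N -> k = 0%N \/ k = 1%N.
Proof. by case: k => [|[|k]]; [left|right|]. Qed.

Lemma Cc_lin k O (a : R) f g : (k <= 1)%N -> Cc k O f -> Cc k O g -> Cc k O (a *: f + g).
Proof.
move=> k1 [Cf cf fO] [Cg cg gO].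
apply: (@Cc_of_compact _ _ _ _ (tsupport f `|` tsupport g)).
- case: (leq1_cases k1) => k_eq; rewrite k_eq in Cf Cg *; last exact: Ck1D (Ck1Z a Cf) Cg.
  apply: (@continuous_add _ _ (fun x => a * f x) g) => //.
  by apply: (@continuous_mul _ _ (cst a) f) => //; exact: cst_continuous.
- exact: compactU.
- by move=> x [/fO|/gO].
- move=> x /not_orP[/tsupport_eq0 fx /tsupport_eq0 gx].
  by rewrite fctE/= fctE fx gx addr0 /GRing.scale/= mulr0.
Qed.

Lemma Cc_0 k O : (k <= 1)%N -> Cc k O (0 : 'rV[R]_n -> R).
Proof.
move=> k1; apply: (@Cc_of_compact _ _ _ _ set0) => //; last exact: compact0.
by case: (leq1_cases k1) => ->; [exact: cst_continuous|exact: Ck1_cst].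
Qed.

Lemma Cc_lin_closed k O : (k <= 1)%N -> lin_closed (Cc k O).
Proof. by move=> k1; split; [exact: Cc_0|move=> *; exact: Cc_lin]. Qed.

Lemma Cc_mull k O f g : (k <= 1)%N -> Cc k O f -> Ck k g -> Cc k O (fun x => f x * g x).
Proof.
move=> k1 [Cf cf fO] Cg; apply: (Cc_of_compact _ cf fO).
- case: (leq1_cases k1) => k_eq; rewrite k_eq in Cf Cg *; last exact: Ck1M.
  exact: continuous_mul.
- by move=> x /tsupport_eq0 ->; rewrite mul0r.
Qed.

Lemma Cc1_Cc0 O f : Cc 1 O f -> Cc 0 O f.
Proof. by move=> [[cf _ _] cK KO]; split. Qed.

Lemma Cc_sub k O O' f : O `<=` O' -> Cc k O f -> Cc k O' f.
Proof. by move=> OO' [Cf cK KO]; split => //; exact: subset_trans KO OO'. Qed.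

Lemma Cc1_comp O (T dT : R -> R) f : (forall s : R, is_derive s 1 T (dT s)) ->
  continuous dT -> T 0 = 0 -> Cc 1 O f -> Cc 1 O (T \o f).
Proof.
move=> TdT cdT T0 [Cf cK KO]; apply: (Cc_of_compact _ cK KO).
  exact: Ck1_comp TdT cdT Cf.
by move=> x /tsupport_eq0 /= ->.
Qed.

Lemma Cc_L2 k O f : measurable O -> (k <= 1)%N -> Cc k O f -> L2 O f.
Proof.
move=> mO k1 Cf; have C0 : Cc 0 O f by case: k k1 Cf => [|[|//]] _ //; exact: Cc1_Cc0.
split.
  exact: measurable_funS (continuous_measurable_rV (Cc_continuous Cf)).
have := Cc_integrable mO (Cc_mull (leq0n 1) C0 (Cc_continuous C0)).
by apply: eq_integrable => // x _ /=; rewrite expr2.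
Qed.

End Cc_closure.

(** * Cutoff functions *)

Section cutoff.
Context (R : realType) (n : nat).
Implicit Types (U K : set 'rV[R]_n).

(** [eta] is [D / r - 1] truncated to $[0,1]$. One [D] serves all [r], so the lemma yields both a
    cutoff equal to [1] on a given compact set and a sequence of cutoffs tending to the indicator of
    [U]. *)
Lemma cutoff U : open U -> bounded_set U ->
  exists D : 'rV[R]_n -> R, [/\ continuous D, forall x, U x -> 0 < D x &
   forall r : R, 0 < r -> exists eta : 'rV[R]_n -> R,
     [/\ Cc 0 U eta, forall x, 0 <= eta x <= 1 & forall x, 2 * r <= D x -> eta x = 1]].
Proof.
move=> oU bU; have [D [DL D0 DU DUp]] := dist_complement oU.
have cD := lipschitz1_continuous DL.
exists D; split => // r r0.
have [cK KU] := superlevel_compact bU cD DU r0.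
pose eta x := Num.min 1 (Num.max 0 (r^-1 * D x + -1)).
exists eta; split.
- apply: (Cc_of_compact _ cK KU).
    have c1 : continuous (fun x => r^-1 * D x + -1).
      apply: (@continuous_add _ _ (fun x => r^-1 * D x) (cst (-1))); last exact: cst_continuous.
      by apply: (@continuous_mul _ _ (cst r^-1) D) => //; exact: cst_continuous.
    move=> x; apply: (@continuous_min R _ (cst 1) (fun x => Num.max 0 (r^-1 * D x + -1))).
      exact: cst_continuous.
    apply: (@continuous_max R _ (cst 0) (fun x => r^-1 * D x + -1)).
      exact: cst_continuous.
    exact: c1.
  move=> x /negP; rewrite -ltNge => Dr; rewrite /eta.
  rewrite max_l; last by rewrite subr_le0 mulrC ler_pdivrMr// mul1r ltW.
  by rewrite min_r.
- move=> x; rewrite /eta le_min ler01 le_max lexx/=.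
  by rewrite ge_min lexx.
- move=> x Dx; rewrite /eta min_l// le_max; apply/orP; right.
  by rewrite -lerBlDr opprK mulrC ler_pdivlMr//; apply: le_trans Dx; lra.
Qed.

Lemma cutoff_compact U K : open U -> bounded_set U -> compact K -> K `<=` U ->
  exists eta : 'rV[R]_n -> R,
    [/\ Cc 0 U eta, forall x, 0 <= eta x <= 1 & forall x, K x -> eta x = 1].
Proof.
move=> oU bU cK KU; have [D [cD DU H]] := cutoff oU bU.
have [r r0 rP] := compact_superlevel cK KU cD DU.
have [eta [e1 e2 e3]] := H (r / 2) (divr_gt0 r0 (ltr0Sn _ _)).
by exists eta; split => // x /rP rD; apply: e3; lra.
Qed.

Lemma cutoff_seq U : open U -> bounded_set U ->
  exists eta : nat -> 'rV[R]_n -> R,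
    [/\ forall m, Cc 0 U (eta m), forall m x, 0 <= eta m x <= 1 &
        forall x, U x -> \forall m \near \oo, eta m x = 1].
Proof.
move=> oU bU; have [D [cD DU H]] := cutoff oU bU.
have /choice[eta etaP] : forall m : nat, exists eta : 'rV[R]_n -> R,
     [/\ Cc 0 U eta, forall x, 0 <= eta x <= 1 &
         forall x, 2 * m.+1%:R^-1 <= D x -> eta x = 1].
  by move=> m; apply: H; rewrite invr_gt0.
exists eta; split; [by move=> m; have [] := etaP m|by move=> m; have [] := etaP m|].
move=> x /DU Dx; have Dx2 : 0 < D x / 2 by rewrite divr_gt0.
have := near_infty_natSinv_lt (PosNum Dx2).
apply: filterS => m /= mD; have [_ _] := etaP m; apply.
by rewrite mulrC -ler_pdivlMr// ltW.
Qed.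

End cutoff.

Section density_charge.
Context (R : realType) (n : nat).
Local Notation leb := (lebesgue_rV R n).

Lemma density_charge (O : set 'rV[R]_n) (w : 'rV[R]_n -> R) : measurable O ->
  leb.-integrable O (EFin \o w) ->
  exists nu : {charge set 'rV[R]_n -> \bar R},
    forall A, measurable A -> nu A = (\int[leb]_(x in A `&` O) (w x)%:E)%E.
Proof.
move=> mO Iw; have I := (integrable_mkcond _ mO).1 Iw.
by exists (induced_charge I) => A mA; rewrite integral_mkcondr.
Qed.

End density_charge.

(** * The fundamental lemma of the calculus of variations *)

Section fundamental_lemma.
Context (R : realType) (n : nat).
Local Notation leb := (lebesgue_rV R n).
Variable O : set 'rV[R]_n.
Hypotheses (oO : open O) (bO : bounded_set O).

Let mO : measurable O. Proof. exact: open_measurable_rV. Qed.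

Lemma integrable_bounded_mul (h f : 'rV[R]_n -> R) (M : R) :
  leb.-integrable O (EFin \o h) -> measurable_fun O f -> (forall x, O x -> `|f x| <= M) ->
  leb.-integrable O (EFin \o (fun x => h x * f x)).
Proof.
move=> Ih mf fM; apply: (le_integrable mO _ _ (integrableZl mO M Ih)).
  apply/measurable_EFinP; apply: measurable_funM => //.
  by apply/measurable_EFinP; case/integrableP : Ih.
move=> x Ox; rewrite -EFinM !abse_EFin lee_fin !normrM mulrC ler_wpM2r//.
by rewrite (le_trans (fM _ Ox))// ler_norm.
Qed.

(** As [h] is integrable, the integral is continuous in [eta] for the uniform norm, in which
    [Cc 1 O] is dense. *)
Lemma integral_Cc0_eq0 (h : 'rV[R]_n -> R) : leb.-integrable O (EFin \o h) ->
  (forall eta, Cc 1 O eta -> \int[leb]_(x in O) (h x * eta x) = 0) ->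
  forall eta, Cc 0 O eta -> \int[leb]_(x in O) (h x * eta x) = 0.
Proof.
move=> Ih H1 eta Ceta; apply/eqP; rewrite -normr_eq0 eq_le normr_ge0 andbT.
apply/ler_addgt0Pl => e e0; rewrite addr0.
pose M := \int[leb]_(x in O) `|h x|.
have M0 : 0 <= M by apply: Rintegral_ge0.
have d0 : 0 < e / (M + 1) by rewrite divr_gt0// ltr_wpDl.
have [f Cf fe] := Cc1_dense oO bO Ceta d0.
have I k g : Cc k O g -> leb.-integrable O (EFin \o (fun x => h x * g x)).
  move=> Cg; have [N N0 gN] := Cc_bounded Cg.
  apply: (integrable_bounded_mul (M := N)) => //.
  exact: measurable_funS (continuous_measurable_rV (Cc_continuous Cg)).
have Iabs : leb.-integrable O (EFin \o (fun x => `|h x|)).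
  exact: integrable_norm.
rewrite -[X in `|X|]subr0 -(H1 _ Cf) -RintegralB//; [|exact: I Ceta|exact: I Cf].
apply: le_trans (le_normr_Rintegral _ _) _ => //.
  apply: eq_integrable (integrableB mO (I _ _ Ceta) (I _ _ Cf)) => //.
apply: (@le_trans _ _ (\int[leb]_(x in O) (e / (M + 1) * `|h x|))).
  apply: le_Rintegral => //.
  - apply: eq_integrable (integrable_norm (integrableB mO (I _ _ Ceta) (I _ _ Cf))) => //.
  - exact: eq_integrable (integrableZl mO (e / (M + 1)) Iabs).
  - move=> x _; rewrite -mulrBr normrM mulrC ler_wpM2r//.
rewrite RintegralZl// -/M -mulrA ler_piMr ?(ltW e0)// mulrC ler_pdivrMr ?mul1r ?lerDl//.
by rewrite ltr_wpDl.
Qed.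

(** The charge [nu] of density [h] vanishes on open sets, by dominated convergence along cutoffs,
    hence on all Borel sets by Dynkin's theorem, open sets being stable under intersection. An
    integrable function with zero integral over every measurable set is zero almost everywhere. *)
Lemma fundamental_lemma (h : 'rV[R]_n -> R) : leb.-integrable O (EFin \o h) ->
  (forall eta, Cc 1 O eta -> \int[leb]_(x in O) (h x * eta x) = 0) ->
  ae_eq leb O (EFin \o h) (EFin \o cst 0).
Proof.
move=> Ih /(integral_Cc0_eq0 Ih) H0.
have [nu nuE] := density_charge mO Ih.
have nu_open U : open U -> nu U = 0%E.
  move=> oU; rewrite nuE; last exact: open_measurable_rV.
  have oUO : open (U `&` O) by exact: openI.
  have bUO : bounded_set (U `&` O).
    have [M M0 OM] := bounded_set_ub bO.
    exists M; split; first exact: num_real.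
    by move=> t Mt x [_ /OM xM]; exact: le_trans xM (ltW Mt).
  have [eta [Ceta eta01 eta1]] := cutoff_seq oUO bUO.
  have mUO := open_measurable_rV oUO.
  pose f_ m (x : 'rV[R]_n) := (h x * eta m x)%:E.
  have mh : measurable_fun O h by apply/measurable_EFinP; case/integrableP : Ih.
  have mf_ m : measurable_fun O (f_ m).
    apply/measurable_EFinP; apply: measurable_funM => //.
    exact: measurable_funS (continuous_measurable_rV (Cc_continuous (Ceta m))).
  have mf : measurable_fun O ((EFin \o h) \_ (U `&` O)).
    rewrite restrict_EFin; apply/measurable_EFinP.
    apply: (@measurable_funS _ _ _ _ setT) => //.
    apply: (measurable_restrictT _ mUO).1.
    by apply: (measurable_funS mO _ mh) => x [].
  have [] := @dominated_convergence _ _ R leb O mO f_ ((EFin \o h) \_ (U `&` O))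
    (fun x => `|(h x)%:E|)%E mf_ mf.
  - apply/aeW => x Ox; rewrite patchE; case: ifPn => [|] UO.
      have := eta1 x; rewrite -in_setE => /(_ UO) H.
      apply: cvg_near_cst; apply: filterS H => m; rewrite /f_ => ->.
      by rewrite mulr1.
    apply: cvg_near_cst; apply: nearW => m; rewrite /f_ (Cc_eq0 (Ceta m)) ?mulr0//.
    by move: UO; rewrite notin_setE.
  - exact: integrable_abse.
  - apply/aeW => x m Ox; rewrite /f_ !abse_EFin lee_fin normrM ler_piMr//.
    by have /andP[e0 e1] := eta01 m x; rewrite ger0_norm.
  move=> _ _; rewrite -integral_mkcondr setIA (setIC O) -setIA setIid => cf.
  have cf0 : [sequence (\int[leb]_(x in O) f_ m x)%E]_m @ \oo --> 0%E.
    rewrite (_ : [sequence _]_m = cst 0%E); first exact: cvg_cst.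
    apply/funext => m /=; have [N N0 etaN] := Cc_bounded (Ceta m).
    have I : leb.-integrable O (f_ m).
      apply: (integrable_bounded_mul (M := N)) => //.
      exact: measurable_funS (continuous_measurable_rV (Cc_continuous (Ceta m))).
    rewrite -(fineK (integrable_fin_num mO I)); congr (_%:E).
    by apply: H0; apply: Cc_sub (Ceta m) => x [].
  exact: (cvg_unique _ cf cf0).
have nu0 A : measurable A -> nu A = 0%E.
  apply: (@dynkin_induction _ _ [set U : set 'rV[R]_n | open U] (fun A => nu A = 0%E)) => //.
  - by move=> U V; exact: openI.
  - by apply: nu_open; exact: openT.
  - move=> S mS S0; have := chargeU nu mS (measurableC mS).
    by rewrite setICr setUv S0 add0e (nu_open _ openT) => /(_ erefl).
  - move=> F mF tF F0.
    have := @charge_semi_sigma_additive _ _ _ nu F mF tF (bigcupT_measurable _ mF).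
    have cf0 : (\sum_(0 <= i < m) nu (F i))%E @[m --> \oo] --> 0%E.
      rewrite (_ : (fun _ => _) = cst 0%E); first exact: cvg_cst.
      by apply/funext => m; rewrite big1.
    by move=> cf; exact: (cvg_unique _ cf cf0).
apply: (integral_ae_eq mO Ih) => [|E EO mE]; first by apply/measurable_EFinP; exact: measurable_cst.
transitivity (nu E); last by rewrite nu0// integral0_eq.
by rewrite nuE// setIidl.
Qed.

End fundamental_lemma.

(** * Sobolev forms and [H^-1] *)

Lemma psd_formD (R : realType) (E : lmodType R) (X : set E) (p q : E -> E -> R) :
  psd_form X p -> psd_form X q -> psd_form X (fun u v => p u v + q u v).
Proof.
move=> [Xl pl ps p0] [_ ql qs q0]; split => //.
- by move=> a u v w Xu Xv Xw; rewrite pl// ql//; ring.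
- by move=> u v Xu Xv; rewrite ps// qs.
- by move=> u Xu; rewrite addr_ge0// ?p0// q0.
Qed.

Lemma psd_form_scale (R : realType) (E : lmodType R) (X : set E) (p : E -> E -> R) (c : R) :
  0 <= c -> psd_form X p -> psd_form X (fun u v => c * p u v).
Proof.
move=> c0 [Xl pl ps p0]; split => //.
- by move=> a u v w Xu Xv Xw; rewrite pl//; ring.
- by move=> u v Xu Xv; rewrite ps.
- by move=> u Xu; rewrite mulr_ge0// p0.
Qed.

(** * Weak gradients, $H^1_0$ and the Poincare inequality *)

Section sobolev_forms.
Context (R : realType) (n : nat).
Local Notation leb := (lebesgue_rV R n).
Variable O : set 'rV[R]_n.
Hypotheses (oO : open O) (bO : bounded_set O).
Implicit Types (v w eta : 'rV[R]_n -> R).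

Let mO : measurable O. Proof. exact: open_measurable_rV. Qed.

Lemma L2_integrable v : L2 O v -> leb.-integrable O (EFin \o v).
Proof.
move=> Lv; have L1 : L2 O (cst 1).
  split; first exact: measurable_cst.
  apply: (@bounded_integrable _ _ _ (fun x => cst 1 x ^+ 2) 1) => //.
    by apply: measurable_funX; exact: measurable_cst.
  by move=> x _; rewrite /= expr1n normr1.
by apply: eq_integrable (L2_mul_integrable mO Lv L1) => // x _ /=; rewrite mulr1.
Qed.

(** The product [eta * v] has compact support, so its derivative integrates to [0]. No support
    condition is put on [v], which is a coordinate function in the Poincare inequality. *)
Lemma integration_by_parts_Cc1 v eta i : Ck 1 v -> Cc 1 O eta ->
  \int[leb]_(x in O) (v x * partial i eta x) = - \int[leb]_(x in O) (partial i v x * eta x).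
Proof.
move=> Cv Ceta; have Ch := Cc_mull (leqnn 1) Ceta Cv.
have C1 := Cc_mull (leq0n 1) (Cc_partial i Ceta) (Ck1_continuous Cv).
have C2 := Cc_mull (leq0n 1) (Cc1_Cc0 Ceta) (Ck1_partial_continuous Cv : Ck 0 (partial i v)).
have /(congr1 fine) := integral_partial i (Cc_sub (@subsetT _ _) Ch).
rewrite -/(Rintegral _ _ _) -(@Rintegral_support _ _ O); last first.
  by move=> x; exact: (Cc_eq0 (Cc_partial i Ch)).
have [Ceta' _ _] := Ceta.
have -> : \int[leb]_(x in O) partial i (fun x => eta x * v x) x =
    \int[leb]_(x in O) (eta x * partial i v x + partial i eta x * v x).
  by apply: eq_Rintegral => x _; rewrite partialM// (mulrC (v x)).
rewrite RintegralD//=; [|exact: Cc_integrable C2|exact: Cc_integrable C1].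
move=> /eqP; rewrite addrC addr_eq0 => /eqP H.
transitivity (\int[leb]_(x in O) (partial i eta x * v x)).
  by apply: eq_Rintegral => x _; rewrite mulrC.
by rewrite H; congr (- _); apply: eq_Rintegral => x _; rewrite mulrC.
Qed.

Lemma weak_gradient_Cc1 v : Cc 1 O v -> weak_gradient O v (fun i => partial i v).
Proof.
move=> Cv; split => [i|i eta Ceta].
  by apply: (Cc_L2 mO (leq0n 1)); exact: Cc_partial.
by apply: integration_by_parts_Cc1 => //; case: Cv.
Qed.

Lemma weak_gradient_lin (a : R) v w g h : L2 O v -> L2 O w ->
  weak_gradient O v g -> weak_gradient O w h ->
  weak_gradient O (a *: v + w) (fun i => a *: g i + h i).
Proof.
move=> Lv Lw [Lg vg] [Lh wh]; have Ll := l2form_psd mO; split.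
  by move=> i; exact: L2_lin.
move=> i eta Ceta; have Leta := Cc_L2 mO (leqnn 1) Ceta.
have Ldeta := Cc_L2 mO (leq0n 1) (Cc_partial i Ceta).
have [_ ll _ _] := Ll.
change (l2form O (a *: v + w) (partial i eta) = - l2form O (a *: g i + h i) eta).
rewrite !ll// /l2form vg// wh//; ring.
Qed.

Lemma weak_gradient_uniq v g h i : weak_gradient O v g -> weak_gradient O v h ->
  l2form O (g i - h i) (g i - h i) = 0.
Proof.
move=> [Lg vg] [Lh vh].
have Lgh : L2 O (g i - h i).
  by rewrite addrC -scaleN1r; exact: L2_lin.
have [_ ll _ _] := l2form_psd mO.
have /(fundamental_lemma oO bO (L2_integrable Lgh)) H : forall eta, Cc 1 O eta ->
    \int[leb]_(x in O) ((g i - h i) x * eta x) = 0.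
  move=> eta Ceta; have Leta := Cc_L2 mO (leqnn 1) Ceta.
  change (l2form O (g i - h i) eta = 0).
  rewrite addrC -scaleN1r ll// /l2form.
  by have := vg i _ Ceta; have := vh i _ Ceta; lra.
have H2 : ae_eq leb O (fun x => ((g i - h i) x * (g i - h i) x)%:E) (cst 0%E).
  have := ae_eq_comp (fun y : \bar R => (fine y * fine y)%:E) H.
  by apply: filterS => x /= Hx Ox; rewrite Hx// mulr0.
rewrite /l2form /Rintegral (ae_eq_integral (cst 0%E))// ?integral0//.
by have := L2_mul_integrable mO Lgh Lgh => /integrableP[].
Qed.

(** Makes [hform] independent of the weak gradient that [grad] happens to select. *)
Lemma weak_gradient_l2form v g h i w : weak_gradient O v g -> weak_gradient O v h ->
  L2 O w -> l2form O (g i) w = l2form O (h i) w.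
Proof.
move=> vg vh Lw; have := weak_gradient_uniq i vg vh.
have [Lg _] := vg; have [Lh _] := vh.
have Lgh : L2 O (g i - h i) by rewrite addrC -scaleN1r; exact: L2_lin.
move=> H; have := psd_form_CS (l2form_psd mO) Lgh Lw.
rewrite H mul0r => H2; have [_ ll _ _] := l2form_psd mO.
have : l2form O (g i - h i) w = 0.
  by apply/eqP; rewrite -sqrf_eq0 eq_le H2 sqr_ge0.
by rewrite addrC -scaleN1r ll//; lra.
Qed.

(** The polarisation of [sqr_grad_norm]. *)
Definition hform v w : R := \sum_(i < n) l2form O (grad O v i) (grad O w i).

Lemma gradP v : H1 O v -> weak_gradient O v (grad O v).
Proof. by move=> [_ [g vg]]; exact: (xgetPex _ (ex_intro _ g vg)). Qed.

Lemma Cc1_H1 v : Cc 1 O v -> H1 O v.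
Proof.
by move=> Cv; split; [exact: Cc_L2 Cv|exists (fun i => partial i v); exact: weak_gradient_Cc1].
Qed.

Lemma H1_lin (a : R) v w : H1 O v -> H1 O w -> H1 O (a *: v + w).
Proof.
move=> [Lv [g vg]] [Lw [h wh]]; split; first exact: L2_lin.
by exists (fun i => a *: g i + h i); exact: weak_gradient_lin.
Qed.

Lemma H1_lin_closed : lin_closed (H1 O).
Proof. by split; [apply: Cc1_H1; exact: Cc_0|exact: H1_lin]. Qed.

Lemma hform_psd : psd_form (H1 O) hform.
Proof.
have [_ ll ls l0] := l2form_psd mO.
have Lgrad v i : H1 O v -> L2 O (grad O v i) by move=> /gradP[].
split; first exact: H1_lin_closed.
- move=> a u v w Hu Hv Hw; rewrite /hform mulr_sumr -big_split/=; apply: eq_bigr => i _.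
  rewrite -ll//; try exact: Lgrad.
  have wl := weak_gradient_lin a Hu.1 Hv.1 (gradP Hu) (gradP Hv).
  by rewrite (weak_gradient_l2form i (gradP (H1_lin a Hu Hv)) wl)//; exact: Lgrad.
- by move=> u v Hu Hv; apply: eq_bigr => i _; rewrite ls//; exact: Lgrad.
- by move=> u Hu; apply: sumr_ge0 => i _; apply: l0; exact: Lgrad.
Qed.

Lemma hform_Cc1 v w : Cc 1 O v -> Cc 1 O w ->
  hform v w = \sum_(i < n) l2form O (partial i v) (partial i w).
Proof.
move=> Cv Cw; have [_ _ ls _] := l2form_psd mO; apply: eq_bigr => i _.
have [Lv _] := gradP (Cc1_H1 Cv); have [Lw _] := gradP (Cc1_H1 Cw).
have [Lv' _] := weak_gradient_Cc1 Cv; have [Lw' _] := weak_gradient_Cc1 Cw.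
transitivity (l2form O (partial i v) (grad O w i)).
  exact: (weak_gradient_l2form i (gradP (Cc1_H1 Cv)) (weak_gradient_Cc1 Cv) (Lw i)).
transitivity (l2form O (grad O w i) (partial i v)).
  exact: (ls _ _ (Lv' i) (Lw i)).
transitivity (l2form O (partial i w) (partial i v)).
  exact: (weak_gradient_l2form i (gradP (Cc1_H1 Cw)) (weak_gradient_Cc1 Cw) (Lv' i)).
exact: (ls _ _ (Lw' i) (Lv' i)).
Qed.

Lemma H10normE v : H10norm O v = Num.sqrt (hform v v).
Proof. by congr Num.sqrt; apply: eq_bigr => i _; rewrite l2formE. Qed.

Let h1form v w := l2form O v w + hform v w.

Let h1form_psd : psd_form (H1 O) h1form.
Proof.
apply: psd_formD hform_psd.
by apply: psd_form_restrict (l2form_psd mO) H1_lin_closed _ => v [].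
Qed.

Let H1normE v : H1norm O v = Num.sqrt (h1form v v).
Proof. by []. Qed.

Lemma Cc1_H10 v : Cc 1 O v -> H10 O v.
Proof.
move=> Cv; split; first exact: Cc1_H1.
move=> e e0; exists v => //; rewrite H1normE subrr.
have := psd_nrmZ h1form_psd 0 (psd_form0 h1form_psd).
by rewrite scale0r normr0 mul0r => ->.
Qed.

Lemma H10_lin (a : R) v w : H10 O v -> H10 O w -> H10 O (a *: v + w).
Proof.
move=> [Hv Dv] [Hw Dw]; split; first exact: H1_lin.
move=> e e0; have d0 : 0 < e / (`|a| + 1) by rewrite divr_gt0// ltr_wpDl.
have [f Cf fv] := Dv _ d0; have [g Cg gw] := Dw _ d0.
exists (a *: f + g); first exact: Cc_lin.
have Hf := Cc1_H1 Cf; have Hg := Cc1_H1 Cg.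
have sub x y : H1 O x -> H1 O y -> H1 O (x - y).
  by move=> Hx Hy; rewrite addrC -scaleN1r; exact: H1_lin.
rewrite (_ : a *: f + g - (a *: v + w) = a *: (f - v) + (g - w)); last first.
  by rewrite scalerBr opprD addrACA.
have Hfv := sub _ _ Hf Hv; have Hgw := sub _ _ Hg Hw.
have H : H1norm O (a *: (f - v) + (g - w)) <= H1norm O (a *: (f - v)) + H1norm O (g - w).
  exact: (psd_nrmD h1form_psd (psd_formZ h1form_psd a Hfv) Hgw).
apply: le_lt_trans H _.
have -> : H1norm O (a *: (f - v)) = `|a| * H1norm O (f - v).
  exact: (psd_nrmZ h1form_psd a Hfv).
rewrite (_ : e = `|a| * (e / (`|a| + 1)) + e / (`|a| + 1)); last first.
  by field; rewrite gt_eqF// ltr_wpDl.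
move: fv gw; move: (H1norm O (f - v)) (H1norm O (g - w)) => s t ss tt.
by apply: ler_ltD => //; apply: ler_wpM2l => //; exact: ltW.
Qed.

Lemma H10_lin_closed : lin_closed (H10 O).
Proof. by split; [apply: Cc1_H10; exact: Cc_0|exact: H10_lin]. Qed.

Lemma hform_psd_H10 : psd_form (H10 O) hform.
Proof. by apply: psd_form_restrict hform_psd H10_lin_closed _ => v []. Qed.

Lemma hform_psd_Cc1 : psd_form (Cc 1 O) hform.
Proof.
by apply: psd_form_restrict hform_psd (Cc_lin_closed _ (leqnn 1)) _ => v; exact: Cc1_H1.
Qed.

(** The closure defining [H10] is taken in the full $H^1$ norm, which dominates the gradient
    seminorm. *)
Lemma Cc1_dense_H10 v : H10 O v -> forall e : R, 0 < e ->
  exists2 eta, Cc 1 O eta & Num.sqrt (hform (eta - v) (eta - v)) < e.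
Proof.
move=> Hv e e0; have [_ /(_ _ e0)[eta Ceta etav]] := Hv; exists eta => //.
apply: le_lt_trans etav; rewrite H1normE ler_wsqrtr// lerDr.
have [_ _ _ l0] := l2form_psd mO; apply: l0.
rewrite addrC -scaleN1r; apply: L2_lin => //; first by case: Hv.1.
exact: Cc_L2 Ceta.
Qed.

Lemma Hm1_extension (l : ('rV[R]_n -> R) -> R) (C : R) : 0 <= C ->
  (forall (a : R) u v, Cc 1 O u -> Cc 1 O v -> l (a *: u + v) = a * l u + l v) ->
  (forall v, Cc 1 O v -> `|l v| <= C * H10norm O v) ->
  exists2 F, Hm1 O F & forall v, Cc 1 O v -> F v = l v.
Proof.
move=> C0 llin lC.
have [|F [F1 F2 F3]] := psd_extension hform_psd_H10 (Cc_lin_closed O (leqnn 1)) Cc1_H10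
    Cc1_dense_H10 C0 llin.
  by move=> v Cv; rewrite -H10normE; exact: lC.
exists F => //; split => //; exists C => v Hv.
by rewrite H10normE; exact: F2.
Qed.

Lemma Hm1_bound_dense F (k : R) : 0 <= k -> Hm1 O F ->
  (forall v, Cc 1 O v -> `|F v| <= k * H10norm O v) ->
  forall v, H10 O v -> `|F v| <= k * H10norm O v.
Proof.
move=> k0 [Flin [C FC]] Fk v Hv; rewrite H10normE.
exact: (psd_bound_dense hform_psd_H10 Cc1_H10 Cc1_dense_H10 k0 Flin FC Fk Hv).
Qed.

Lemma Hm1norm_le F (k : R) : 0 <= k -> Hm1 O F ->
  (forall v, Cc 1 O v -> `|F v| <= k * H10norm O v) -> Hm1norm O F <= k.
Proof.
move=> k0 HF Fk; apply: ge_sup.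
  exists `|F 0|, 0 => //; split; first exact: psd_form0 hform_psd_H10.
  have := psd_nrmZ hform_psd_H10 0 (psd_form0 hform_psd_H10).
  by rewrite scale0r normr0 mul0r H10normE => ->.
move=> _ [v [Hv v1] <-]; apply: le_trans (Hm1_bound_dense k0 HF Fk Hv) _.
by rewrite ler_piMr.
Qed.

(** Integrating $v^2=v^2\,\partial_i x_i$ by parts gives $\int v^2=-2\int x_i v\,\partial_i
    v\le\frac12\int v^2+2M^2\int(\partial_i v)^2$, as $|x_i|\le M$ on [O]; absorbing the half gives
    the constant $4M^2$. *)
Lemma poincare : (0 < n)%N -> exists2 K : R, 0 < K & forall v, Cc 1 O v ->
  l2form O v v <= K * hform v v.
Proof.
move=> n0; have [M M0 OM] := bounded_set_ub bO.
exists (4 * M ^+ 2); first by rewrite mulr_gt0// exprn_gt0.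
move=> v Cv; pose i := Ordinal n0.
have [Cv1 _ _] := Cv.
have Cvv := Cc_mull (leqnn 1) Cv Cv1.
have Ck1x := @Ck1_coord R n i.
have /(congr1 -%R) := integration_by_parts_Cc1 i Ck1x Cvv.
rewrite opprK.
have -> : \int[leb]_(x in O) (partial i (fun y : 'rV[R]_n => y ord0 i) x * (v x * v x)) =
   l2form O v v.
  by apply: eq_Rintegral => x _; rewrite partial_coord eqxx mul1r.
have Lv := Cc_L2 mO (leqnn 1) Cv; have Cdv := Cc_partial i Cv.
have Ldv := Cc_L2 mO (leq0n 1) Cdv.
have I1 := L2_mul_integrable mO Lv Lv; have I2 := L2_mul_integrable mO Ldv Ldv.
move=> H0.
have : - (\int[leb]_(x in O) (x ord0 i * partial i (fun x0 => v x0 * v x0) x)) <=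
   \int[leb]_(x in O) (2^-1 * (v x * v x) + 2 * M ^+ 2 * (partial i v x * partial i v x)).
  have I0 : leb.-integrable O
      (EFin \o (fun x : 'rV[R]_n => x ord0 i * partial i (fun x0 => v x0 * v x0) x)).
    have := Cc_integrable mO (Cc_mull (leq0n 1) (Cc_partial i Cvv) (Ck1_continuous Ck1x)).
    by apply: eq_integrable => // x _ /=; rewrite mulrC.
  have -> : - (\int[leb]_(x in O) (x ord0 i * partial i (fun x0 => v x0 * v x0) x)) =
      \int[leb]_(x in O) (-1 * (x ord0 i * partial i (fun x0 => v x0 * v x0) x)).
    by rewrite (RintegralZl (-1) mO I0) mulN1r.
  apply: le_Rintegral => //.
  - exact: (integrableZl mO (-1) I0).
  - exact: integrableD (integrableZl mO _ I1) (integrableZl mO _ I2).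
  - move=> x Ox; rewrite partialM//.
    have : `|x ord0 i| <= M by exact: le_trans (coord_le_norm _ _) (OM _ Ox).
    rewrite ler_norml => /andP[xM1 xM2].
    set t := x ord0 i in xM1 xM2 *; set p := partial i v x; set z := v x.
    have tM : t ^+ 2 <= M ^+ 2 by nra.
    (* Twice this square is the weighted Young inequality that leaves only half of $v^2$ on the
       right. *)
    have := sqr_ge0 (z / 2 + t * p); have := sqr_ge0 p.
    rewrite !expr2 => h1 h2; rewrite !expr2 in tM.
    have : t * t * (p * p) <= M * M * (p * p) by rewrite ler_wpM2r.
    nra.
rewrite RintegralD//; [|exact: (integrableZl mO 2^-1 I1)|exact: (integrableZl mO (2 * M ^+ 2) I2)].
rewrite !RintegralZl// H0 -/(l2form O v v) -/(l2form O (partial i v) (partial i v)).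
have : l2form O (partial i v) (partial i v) <= hform v v.
  rewrite hform_Cc1// (bigD1 i)//= lerDl; apply: sumr_ge0 => j _.
  have [_ _ _ l0] := l2form_psd mO; apply: l0.
  by apply: (Cc_L2 mO (leq0n 1)); exact: Cc_partial.
have := sqr_ge0 M; nra.
Qed.

End sobolev_forms.

(** * Integration against charges *)

Section bounded_measurable.
Context d (T : measurableType d) (R : realType).

Definition bounded_measurable : set (T -> R) :=
  [set f : T -> R | measurable_fun setT f /\ exists c : R, forall x, `|f x| <= c].

Lemma bounded_measurable_lin (a : R) f g : bounded_measurable f -> bounded_measurable g ->
  bounded_measurable (a *: f + g).
Proof.
move=> [mf [c fc]] [mg [e ge]]; split.
  by apply: measurable_funD => //; exact: measurable_funM.
exists (`|a| * c + e) => x; rewrite !fctE.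
by rewrite (le_trans (ler_normD _ _))// lerD// normrM ler_wpM2l.
Qed.

Lemma bounded_measurable_indic A : measurable A -> bounded_measurable (\1_A : T -> R).
Proof.
move=> mA; split; first exact: measurable_indic.
by exists 1 => x; rewrite indicE; case: (_ \in _); rewrite ?normr1// normr0.
Qed.

(** Turns a floor into a sum of indicators of superlevel sets, to which a linear functional applies
    term by term. *)
Lemma truncn_sum (y : R) N : (Num.truncn y <= N)%N ->
  (Num.truncn y)%:R = \sum_(j < N) (nat_of_bool (j.+1%:R <= y)%R)%:R :> R.
Proof.
move=> yN; set k := Num.truncn y in yN *.
transitivity ((\sum_(j < N) nat_of_bool (j < k))%N%:R : R); last first.
  by rewrite natr_sum; apply: eq_bigr => j _; rewrite truncn_gt_nat.
congr (_%:R); elim: N yN => [|N IH]; first by rewrite leqn0 big_ord0 => /eqP.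
rewrite leq_eqVlt => /predU1P[->|]; last first.
  by rewrite ltnS big_ord_recr/= => yN; rewrite ltnNge yN addn0; exact: IH.
by rewrite (eq_bigr (fun=> 1%N)) ?sum1_card ?card_ord// => j _; rewrite ltn_ord.
Qed.

(* [f] is uniformly approximated by the simple function
   [e * floor ((f + c) / e) - c]. *)
Lemma bounded_functional_eq0 (L : (T -> R) -> R) (K : R) :
  (forall (a : R) f g, bounded_measurable f -> bounded_measurable g ->
    L (a *: f + g) = a * L f + L g) ->
  (forall f c, bounded_measurable f -> (forall x, `|f x| <= c) -> `|L f| <= K * c) ->
  (forall A, measurable A -> L (\1_A) = 0) ->
  forall f, bounded_measurable f -> L f = 0.
Proof.
move=> Llin LK L1 f [mf [c fc]]; apply/eqP; rewrite -normr_eq0 eq_le normr_ge0 andbT.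
apply/ler_addgt0Pl => e0 e00; rewrite addr0.
pose e := e0 / (`|K| + 1); have e_gt0 : 0 < e by rewrite divr_gt0// ltr_wpDl.
pose y x := (f x + c) / e.
have c0 x : 0 <= f x + c by have := fc x; rewrite ler_norml => /andP[]; lra.
have y0 x : 0 <= y x by rewrite divr_ge0// ltW.
pose N := (Num.truncn ((c + c) / e)).
have yN x : (Num.truncn (y x) <= N)%N.
  apply: le_truncn; rewrite /y ler_pM2r ?invr_gt0// lerD2r.
  by have := fc x; rewrite ler_norml => /andP[].
pose B (j : nat) := [set x | j.+1%:R <= y x].
have my : measurable_fun setT y.
  apply: measurable_funM; last exact: measurable_cst.
  by apply: measurable_funD => //; exact: measurable_cst.
have mB j : measurable (B j).
  rewrite -[X in measurable X]setTI.
  apply: (@measurable_fun_le _ _ R setT (cst j.+1%:R) y) => //; exact: measurable_cst.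
pose g (m : nat) : T -> R := fun x => \sum_(j < m) e * \1_(B j) x + (- c) * \1_setT x.
have gE m : bounded_measurable (g m) /\ L (g m) = 0.
  elim: m => [|m [bg Lg]].
    have -> : g 0%N = (- c) *: (\1_setT : T -> R) + 0.
      by apply/funext => x; rewrite /g big_ord0 add0r addr0.
    have b0 : bounded_measurable (0 : T -> R).
      by split; [exact: measurable_cst|exists 0 => x; rewrite normr0].
    have bT := bounded_measurable_indic (@measurableT _ T).
    split; first exact: bounded_measurable_lin.
    rewrite Llin// L1// mulr0 add0r.
    by apply/eqP; rewrite -normr_le0 -[leRHS](mulr0 K); apply: LK => // x; rewrite normr0.
  have -> : g m.+1 = e *: (\1_(B m) : T -> R) + g m.
    by apply/funext => x; rewrite /g big_ord_recr/= addrAC addrC.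
  have bB := bounded_measurable_indic (mB m).
  split; first exact: bounded_measurable_lin.
  by rewrite Llin// L1// Lg mulr0 addr0.
have [bg Lg] := gE N.
have bf : bounded_measurable f by split => //; exists c.
have -> : L f = L ((-1) *: g N + f) by rewrite Llin// Lg mulr0 add0r.
have H : `|L ((-1) *: g N + f)| <= K * e.
  apply: LK; first exact: bounded_measurable_lin.
  move=> x; rewrite !fctE.
  have -> : g N x = e * (Num.truncn (y x))%:R - c.
    rewrite /g indicT/= mulr1 (truncn_sum (yN x)) mulr_sumr; congr (_ - _).
    apply: eq_bigr => j _; rewrite indicE; congr (_ * _%:R).
    by congr nat_of_bool; apply/idP/idP => [/set_mem|H]; rewrite ?mem_setE//.
  have /andP[t1 t2] := truncn_itv (y0 x).
  have fE : f x = e * y x - c by rewrite /y mulrCA divff ?mulr1 ?addrK// gt_eqF.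
  rewrite scaleN1r {1}fE ler_norml; rewrite -natr1 in t2.
  by apply/andP; split; nra.
apply: le_trans H _; apply: (@le_trans _ _ (`|K| * e)).
  by rewrite ler_pM2r// ler_norm.
by rewrite /e mulrCA ler_piMr ?(ltW e00)// ler_pdivrMr ?mul1r ?lerDl// ltr_wpDl.
Qed.

Lemma bounded_measurable_integrable (m : {finite_measure set T -> \bar R}) f :
  bounded_measurable f -> m.-integrable setT (EFin \o f).
Proof.
move=> [mf [c fc]]; apply: measurable_bounded_integrable => //.
  by rewrite ltey_eq fin_num_measure.
exists c; split; first exact: num_real.
by move=> t ct x _; exact: le_trans (fc x) (ltW ct).
Qed.

Lemma bounded_measurable_Rintegral (m : {finite_measure set T -> \bar R}) f (c : R) :
  bounded_measurable f -> (forall x, `|f x| <= c) ->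
  `|\int[m]_x f x| <= fine (m setT) * c.
Proof.
move=> bf fc; have If := bounded_measurable_integrable m bf.
apply: le_trans (le_normr_Rintegral measurableT If) _.
rewrite mulrC -(Rintegral_cst m measurableT c).
apply: le_Rintegral => //.
- exact: integrable_norm.
- exact: finite_measure_integrable_cst.
Qed.

End bounded_measurable.

(** * The integral against a charge as a bounded functional *)

Section charge_integral_theory.
Context (R : realType) (n : nat).
Local Notation leb := (lebesgue_rV R n).
Implicit Types (mu : {charge set 'rV[R]_n -> \bar R}) (f : 'rV[R]_n -> R).

(** Hides the chosen Hahn decomposition behind two finite measures whose difference is [mu]. *)
Lemma charge_integralE mu :
  exists mp mn : {finite_measure set 'rV[R]_n -> \bar R},
    (forall A, measurable A -> mu A = mp A - mn A)%E /\
    forall f, charge_integral mu f = \int[mp]_x f x - \int[mn]_x f x.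
Proof.
rewrite /charge_integral; case: cid => P hP; case: cid => N PN.
exists (jordan_pos PN), (jordan_neg PN); split => // A mA.
by rewrite (jordan_decomp PN mA) /cadd/= /cscale EFinN mulN1e.
Qed.

Lemma Cc_bounded_measurable k O f : Cc k O f -> bounded_measurable f.
Proof.
move=> Cf; split; first exact: continuous_measurable_rV (Cc_continuous Cf).
by have [M _ fM] := Cc_bounded Cf; exists M.
Qed.

Lemma charge_integral_lin mu (a : R) f g : bounded_measurable f -> bounded_measurable g ->
  charge_integral mu (a *: f + g) = a * charge_integral mu f + charge_integral mu g.
Proof.
move=> bf bg; have [mp [mn [_ E]]] := charge_integralE mu; rewrite !E.
have H (m : {finite_measure set 'rV[R]_n -> \bar R}) :
    \int[m]_x (a *: f + g) x = a * \int[m]_x f x + \int[m]_x g x.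
  have If := bounded_measurable_integrable m bf.
  have Ig := bounded_measurable_integrable m bg.
  rewrite -RintegralZl// -RintegralD//.
  exact: eq_integrable (integrableZl measurableT a If).
by rewrite !H; ring.
Qed.

Lemma charge_integral_bound mu : exists2 K : R, 0 <= K &
  forall f (c : R), bounded_measurable f -> (forall x, `|f x| <= c) ->
    `|charge_integral mu f| <= K * c.
Proof.
have [mp [mn [_ E]]] := charge_integralE mu.
exists (fine (mp setT) + fine (mn setT)); first by rewrite addr_ge0// fine_ge0.
move=> f c bf fc; rewrite E mulrDl (le_trans (ler_normB _ _))// lerD//;
  exact: bounded_measurable_Rintegral.
Qed.

(** The Hahn decomposition behind [charge_integral] is an arbitrary choice, so it is not computed.
    The difference of the two sides is linear, bounded for the uniform norm and zero on indicators,
    where both sides are [mu A]; hence it is zero. *)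
Lemma charge_integral_density mu (O : set 'rV[R]_n) (w : 'rV[R]_n -> R) :
  open O -> bounded_set O -> bounded_measurable w ->
  (forall A, measurable A -> mu A = (\int[leb]_(x in A `&` O) (w x)%:E)%E) ->
  forall f, bounded_measurable f -> charge_integral mu f = \int[leb]_(x in O) (w x * f x).
Proof.
move=> oO bO [mw [N wN]] muE f bf.
have mO := open_measurable_rV oO.
have Iw : leb.-integrable O (EFin \o w).
  by apply: (@bounded_integrable _ _ _ _ N) => //; exact: measurable_funS mw.
have I g : bounded_measurable g -> leb.-integrable O (EFin \o (fun x => w x * g x)).
  move=> [mg [c gc]]; apply: (integrable_bounded_mul oO Iw (M := c)) => //.
  exact: measurable_funS mg.
pose L g := charge_integral mu g - \int[leb]_(x in O) (w x * g x).
suff : L f = 0 by move/subr0_eq.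
have [K K0 muK] := charge_integral_bound mu.
pose Nw := \int[leb]_(x in O) `|w x|.
apply: (@bounded_functional_eq0 _ _ _ L (K + Nw)) => //.
- move=> a g h bg bh; rewrite /L charge_integral_lin//.
  have -> : \int[leb]_(x in O) (w x * (a *: g + h) x) =
      a * \int[leb]_(x in O) (w x * g x) + \int[leb]_(x in O) (w x * h x).
    rewrite -RintegralZl//; last exact: I.
    rewrite -RintegralD//; [|exact: eq_integrable (integrableZl mO a (I _ bg))|exact: I].
    by apply: eq_Rintegral => x _; rewrite !fctE /GRing.scale/=; ring.
  ring.
- move=> g c bg gc; rewrite /L mulrDl (le_trans (ler_normB _ _))// lerD//; first exact: muK.
  apply: le_trans (le_normr_Rintegral mO (I _ bg)) _.
  rewrite -RintegralZr//; last exact: integrable_norm.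
  apply: le_Rintegral => //.
  + exact: integrable_norm (I _ bg).
  + exact: eq_integrable (integrableZr mO c (integrable_norm Iw)).
  + by move=> x _; rewrite normrM ler_wpM2l.
- move=> A mA; have [mp [mn [muE' E]]] := charge_integralE mu.
  have mI (m : {finite_measure set 'rV[R]_n -> \bar R}) : \int[m]_x (\1_A x : R) = fine (m A).
    by rewrite /Rintegral integral_indic// setIT.
  rewrite /L E !mI -fineB ?fin_num_measure//.
  rewrite -muE'// muE// /Rintegral -[X in _ - fine X]/(\int[leb]_(x in O) (w x * \1_A x)%:E)%E.
  rewrite setIC integral_mkcondr; apply/eqP; rewrite subr_eq0; apply/eqP; congr fine.
  apply: eq_integral => x _; rewrite patchE indicE; case: ifPn => _; rewrite ?mulr1// mulr0//.
Qed.

End charge_integral_theory.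

(** * Convex functions *)

Section convex_smoothing.
Context (R : realType) (psi : R -> R) (C : R).
Hypothesis psi_convex : forall t x y : R, 0 <= t <= 1 ->
  psi (t * x + (1 - t) * y) <= t * psi x + (1 - t) * psi y.
Hypothesis psi_ge0 : forall x, 0 <= psi x.
Hypothesis psi_even : forall x, psi x = psi (- x).
Hypothesis C0 : 0 < C.
Hypothesis psi_growth : forall x, psi x <= C * (1 + `|x|).

Lemma convex_slope (x y z : R) : x < y -> y < z ->
  (psi y - psi x) * (z - x) <= (psi z - psi x) * (y - x).
Proof.
move=> xy yz; have zx : 0 < z - x by lra.
pose t := (y - x) / (z - x).
have t01 : 0 <= t <= 1 by rewrite divr_ge0 ?ler_pdivrMr//; lra.
have yE : y = t * z + (1 - t) * x by rewrite /t; field; rewrite gt_eqF.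
have := psi_convex z x t01; rewrite -yE => H.
have -> : y - x = t * (z - x) by rewrite /t divfK// gt_eqF.
rewrite mulrA ler_pM2r//; lra.
Qed.

(** A chord of slope larger than [C] would, by convexity, make [psi] outgrow every affine function
    of slope [C]. *)
Lemma convex_lipschitz_le (x y : R) : x <= y -> psi y - psi x <= C * (y - x).
Proof.
rewrite le_eqVlt => /predU1P[->|xy]; first by rewrite !subrr mulr0.
rewrite leNgt; apply/negP => H.
pose g := psi y - psi x - C * (y - x); have g0 : 0 < g by rewrite /g; lra.
pose B : R := `|C * (y - x) + (psi y - psi x) * x|.
(* Convexity and the growth bound give [g * z <= B], whereas this [z] has [g * z >= B + g]. *)
pose z : R := `|y| + B / g + 1.
have B0 : 0 <= B / g by apply: divr_ge0; [exact: normr_ge0|exact: ltW].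
have yz : y < z by rewrite /z; have := ler_norm y; lra.
have z0 : 0 <= z by rewrite /z; have := normr_ge0 y; lra.
have := convex_slope xy yz; have := psi_growth z; rewrite (ger0_norm z0).
have := psi_ge0 x => h1 h2 h3.
have h4 : (psi z - psi x) * (y - x) <= C * (1 + z) * (y - x).
  by rewrite ler_wpM2r//; lra.
have h5 : g * z <= B.
  by have := ler_norm (C * (y - x) + (psi y - psi x) * x); rewrite -/B /g; lra.
have : g * z = g * `|y| + B + g by rewrite /z; field; rewrite gt_eqF.
have : 0 <= g * `|y| by rewrite mulr_ge0// ltW.
lra.
Qed.

Lemma convex_lipschitz (x y : R) : `|psi x - psi y| <= C * `|x - y|.
Proof.
wlog xy : x y / x <= y => [H|].
  have [/H//|/ltW/H] := leP x y.
  by rewrite distrC (distrC y).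
rewrite [X in _ <= _ * X]distrC (ger0_norm (_ : 0 <= y - x)) ?subr_ge0//.
rewrite ler_norml; apply/andP; split; first by have := convex_lipschitz_le xy; lra.
have : - y <= - x by rewrite lerN2.
by move/convex_lipschitz_le; rewrite -!psi_even; lra.
Qed.

Lemma convex_continuous : continuous psi.
Proof.
move=> x; apply/cvgrPdist_le => e e0; near=> y.
apply: le_trans (convex_lipschitz _ _) _.
rewrite mulrC -ler_pdivlMr//; apply/ltW; near: y.
by have := nbhsx_ballx x _ (divr_gt0 e0 C0); rewrite -ball_normE.
Unshelve. all: by end_near. Qed.

(** [y] and [x + h] are convex combinations of [y + h] and [x] with the weights [t] and [1 - t]
    exchanged; the two convexity inequalities add up to the claim. *)
Lemma convex_increment_homo (h x y : R) : 0 < h -> x <= y ->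
  psi (x + h) - psi x <= psi (y + h) - psi y.
Proof.
move=> h0 xy; have d0 : 0 < y + h - x by lra.
pose t := (y - x) / (y + h - x).
have t01 : 0 <= t <= 1 by rewrite divr_ge0 ?ler_pdivrMr//; lra.
have t01' : 0 <= 1 - t <= 1 by lra.
have := psi_convex (y + h) x t01; have := psi_convex (y + h) x t01'.
have -> : t * (y + h) + (1 - t) * x = y by rewrite /t; field; rewrite gt_eqF.
have -> : (1 - t) * (y + h) + (1 - (1 - t)) * x = x + h.
  by rewrite /t; field; rewrite gt_eqF.
lra.
Qed.

(** * A smoothed derivative of a convex function *)

Section difference_quotient.
Variable h : R.
Hypothesis h0 : 0 < h.

(** Centred rather than one-sided, so that the evenness of [psi] makes it odd, whence [T 0 = 0]
    later. *)
Let q (s : R) : R := (psi (s + h) - psi (s - h)) / (2 * h).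

Let h20 : 0 < 2 * h. Proof. by rewrite mulr_gt0. Qed.

Let qE s : psi (s + h) - psi (s - h) = 2 * h * q s.
Proof. by rewrite mulrC divfK// gt_eqF. Qed.

Let q_odd s : q (- s) = - q s.
Proof.
rewrite /q -mulNr opprB; congr (_ / _); rewrite psi_even [X in _ - X]psi_even.
by congr (psi _ - psi _); lra.
Qed.

Let q_homo : {homo q : x y / x <= y}.
Proof.
move=> x y xy; rewrite ler_pM2r ?invr_gt0//.
have := @convex_increment_homo (2 * h) (x - h) (y - h) h20.
rewrite lerD2r => /(_ xy).
by rewrite (_ : x - h + 2 * h = x + h) 1?(_ : y - h + 2 * h = y + h)//; lra.
Qed.

Let q_bound s : `|q s| <= C.
Proof.
rewrite normrM normfV (gtr0_norm h20) ler_pdivrMr//.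
apply: le_trans (convex_lipschitz _ _) _; rewrite ler_pM2l//.
by rewrite (_ : s + h - (s - h) = 2 * h) ?gtr0_norm//; lra.
Qed.

Let q_continuous : continuous q.
Proof.
move=> x; apply: cvgM; last exact: cvg_cst.
apply: cvgB; apply: continuous_comp; try exact: convex_continuous.
  by apply: cvgD; [exact: cvg_id|exact: cvg_cst].
by apply: cvgB; [exact: cvg_id|exact: cvg_cst].
Qed.

(** For [y] beyond [r + h], chords from [r - h] have increasing slopes, and moving the base point
    from [r - h] to [r] costs [2 * C * h]. Points below [r - h] follow by reflection; within
    distance [h] the Lipschitz bound suffices. *)
Let q_subgradient r y : q r * (y - r) <= psi y - psi r + 2 * C * h.
Proof.
have h_gt0 := h0; have C_gt0 := C0.
have H (s z : R) : s + h <= z -> q s * (z - s) <= psi z - psi s + 2 * C * h.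
  move=> sz.
  have k1 : (psi (s + h) - psi (s - h)) * (z - (s - h)) <= (psi z - psi (s - h)) * (2 * h).
    have := sz; rewrite le_eqVlt => /predU1P[<-|sz'].
      by rewrite (_ : s + h - (s - h) = 2 * h)//; lra.
    have s1 : s - h < s + h by lra.
    have := convex_slope s1 sz'.
    by rewrite (_ : s + h - (s - h) = 2 * h)//; lra.
  have k2 : q s * (z - (s - h)) <= psi z - psi (s - h).
    by rewrite -(ler_pM2r h20); apply: le_trans k1; rewrite qE; lra.
  have := q_bound s; rewrite ler_norml => /andP[k3 _].
  have sh : s - h <= s by lra.
  by have := convex_lipschitz_le sh; nra.
have [|ry] := leP (r + h) y; first exact: H.
have [yr|yr] := leP y (r - h).
  have /H : - r + h <= - y by lra.
  by rewrite q_odd -!psi_even; lra.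
have rh : `|y - r| <= h by rewrite ler_norml; lra.
have := convex_lipschitz y r; rewrite ler_norml => /andP[k1 _].
have : q r * (y - r) <= C * h.
  by rewrite (le_trans (ler_norm _))// normrM ler_pM// q_bound.
have : C * `|y - r| <= C * h by rewrite ler_pM2l.
lra.
Qed.

(** [T] averages [q] over $[s-h,s+h]$ by means of a primitive [G], so it is $C^1$ with $0\le T'\le
    C/h$. By the mean value theorem [T s = q c] with [c] within [h] of [s]; to the error [2 * C * h]
    of [q_subgradient] this adds [C * h] for the slope and [C * h] for [psi]. *)
Lemma smooth_subgradient_step : exists T dT : R -> R, exists2 M : R, 0 <= M &
  [/\ forall s : R, is_derive s 1 T (dT s), continuous dT, T 0 = 0,
      forall s, 0 <= dT s <= M &
      forall s y, T s * y - psi y <= T s * s - psi s + 4 * C * h].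
Proof.
have h_gt0 := h0; have C_gt0 := C0.
have [G dG] := primitive q_continuous.
pose T (s : R) : R := (G (s + h) - G (s - h)) / (2 * h).
pose dT (s : R) : R := (q (s + h) - q (s - h)) / (2 * h).
have dT0 s : 0 <= dT s.
  by apply: divr_ge0; [rewrite subr_ge0; apply: q_homo; lra|exact: ltW].
exists T, dT, (C / h); first by rewrite divr_ge0// ltW.
have dTT (s : R) : is_derive s 1 T (dT s).
  have sh c : is_derive s 1 (fun s : R => G (s + c)) (q (s + c)).
    have D : is_derive s 1 (fun s : R => s + c) 1.
      by apply: is_derive_eq; rewrite addr0.
    by have := @is_derive1_comp R G (fun s : R => s + c) s _ _ (dG (s + c)) D; rewrite mulr1.
  have D1 := sh h; have D2 := sh (- h).
  have -> : T = (2 * h)^-1 *: ((fun s => G (s + h)) - (fun s => G (s + - h))).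
    by apply/funext => x; rewrite /T mulrC.
  by apply: is_derive_eq; rewrite /dT [RHS]mulrC.
have Tq (s : R) : exists2 c, s - h <= c <= s + h & T s = q c.
  have sh : s - h <= s + h by lra.
  have [c cP GE] := is_derive_MVT dG sh; exists c => //.
  rewrite /T GE (_ : s + h - (s - h) = 2 * h); last by lra.
  by rewrite mulfK// gt_eqF.
split => //.
- move=> x; apply: cvgM; last exact: cvg_cst.
  have sh c : q (y + c) @[y --> x] --> q (x + c).
    apply: (@continuous_comp _ _ _ (fun y => y + c) q); last exact: q_continuous.
    by apply: cvgD; [exact: cvg_id|exact: cvg_cst].
  by apply: cvgB; [exact: (sh h)|exact: (sh (- h))].
(* [q] is odd, so [G] is even and its increment over $[-h,h]$ is [0]. *)
- have E (s : R) : is_derive s 1 (fun s : R => G s - G (- s)) 0.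
    have D : is_derive s 1 (fun s : R => - s) (-1) by exact: is_deriveNid.
    have D2 := @is_derive1_comp R G (fun s : R => - s) s _ _ (dG (- s)) D.
    have D1 := dG s.
    have -> : (fun s : R => G s - G (- s)) = G - (G \o (fun s : R => - s)) by [].
    by apply: is_derive_eq; rewrite q_odd mulrN1 opprK subrr.
  have [c _] := is_derive_MVT E (ltW h0); rewrite mul0r oppr0 subrr subr0 => GE.
  by rewrite /T add0r sub0r GE mul0r.
- move=> s; rewrite dT0/= /dT ler_pdivrMr//.
  rewrite (_ : C / h * (2 * h) = 2 * C); last by field; rewrite gt_eqF.
  have := q_bound (s + h); have := q_bound (s - h); rewrite !ler_norml; lra.
- move=> s y; have [c /andP[c1 c2] ->] := Tq s.
  have := q_subgradient c y.
  have cs : `|c - s| <= h by rewrite ler_norml; lra.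
  have k1 : q c * (c - s) <= C * h.
    by rewrite (le_trans (ler_norm _))// normrM ler_pM// q_bound.
  have := convex_lipschitz c s; rewrite ler_norml => /andP[k2 _].
  have : C * `|c - s| <= C * h by rewrite ler_pM2l.
  lra.
Qed.

End difference_quotient.

(* [T] is a C^1 substitute for the derivative of [psi]: [T s] lies in the
   [k]-subdifferential of [psi] at [s]. *)
Lemma smooth_subgradient k : 0 < k -> exists T dT : R -> R, exists2 M : R, 0 <= M &
  [/\ forall s : R, is_derive s 1 T (dT s), continuous dT, T 0 = 0,
      forall s, 0 <= dT s <= M &
      forall s y, T s * y - psi y <= T s * s - psi s + k].
Proof.
move=> k0; have h0 : 0 < k / (4 * C) by rewrite divr_gt0// mulr_gt0.
have := smooth_subgradient_step h0.
by rewrite (_ : 4 * C * (k / (4 * C)) = k)//; field; rewrite gt_eqF.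
Qed.

End convex_smoothing.

(** * The convex conjugate *)

Section conjugate_theory.
Context (R : realType) (psi : R -> R).
Hypothesis psi_ge0 : forall x, 0 <= psi x.
Hypothesis psi0 : psi 0 = 0.
Hypothesis psi_even : forall x, psi x = psi (- x).
Local Notation conj := (conjugate psi).
Local Open Scope ereal_scope.

Lemma fenchel_young x y : (x * y - psi y)%:E <= conj x.
Proof. by apply: ereal_sup_ubound; exists y. Qed.

Lemma conjugate_le x (c : \bar R) : (forall y, (x * y - psi y)%:E <= c) -> conj x <= c.
Proof. by move=> H; apply: ge_ereal_sup => _ [y _ <-]. Qed.

Lemma conjugate_ge0 x : 0 <= conj x.
Proof. by have := fenchel_young x 0; rewrite mulr0 psi0 subr0. Qed.

Lemma conjugate0 : conj 0 = 0.
Proof.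
apply/eqP; rewrite eq_le conjugate_ge0 andbT; apply: conjugate_le => y.
by rewrite mul0r sub0r lee_fin oppr_le0.
Qed.

Lemma conjugate_even x : conj (- x)%R = conj x.
Proof.
have H z : conj z <= conj (- z)%R.
  apply: conjugate_le => y; have := fenchel_young (- z) (- y).
  by rewrite mulrNN -psi_even.
by apply/eqP; rewrite eq_le H -{2}[x]opprK H.
Qed.

Lemma conjugate_convex (t x y : R) : (0 <= t <= 1)%R ->
  conj (t * x + (1 - t) * y)%R <= t%:E * conj x + (1 - t)%:E * conj y.
Proof.
move=> /andP[t0 t1]; apply: conjugate_le => z.
have -> : ((t * x + (1 - t) * y) * z - psi z =
    t * (x * z - psi z) + (1 - t) * (y * z - psi z))%R by ring.
rewrite EFinD !EFinM leeD// lee_wpmul2l ?fenchel_young// lee_fin//; lra.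
Qed.

Lemma conjugate_scale (t x : R) : (0 <= t <= 1)%R -> conj (t * x)%R <= t%:E * conj x.
Proof.
move=> t01; have := conjugate_convex x 0 t01.
by rewrite mulr0 addr0 conjugate0 mule0 adde0.
Qed.

Lemma conjugate_scale_le (t x : R) : (0 <= t <= 1)%R -> conj (t * x)%R <= conj x.
Proof.
move=> t01; apply: le_trans (conjugate_scale x t01) _.
by rewrite -[leRHS]mul1e lee_wpmul2r ?conjugate_ge0// lee_fin; case/andP: t01.
Qed.

Lemma conjugate_le_norm (x m : R) : (`|x| <= m)%R -> conj x <= conj m.
Proof.
move=> xm; have [m0|m0] := eqVneq m 0%R.
  by move: xm; rewrite m0 normr_le0 => /eqP ->.
have mp : (0 < m)%R by rewrite lt_neqAle eq_sym m0 (le_trans _ xm).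
have H : conj `|x|%R <= conj m.
  have -> : `|x|%R = (`|x| / m * m)%R by rewrite divfK.
  by apply: conjugate_scale_le; rewrite divr_ge0 ?(ltW mp)//= ler_pdivrMr// mul1r.
have [x0|x0] := leP 0%R x; first by rewrite -(ger0_norm x0).
by rewrite -conjugate_even -(ltr0_norm x0).
Qed.

(** A supremum of affine functions is lower semicontinuous. *)
Lemma conjugate_measurable : measurable_fun setT conj.
Proof.
apply: lower_semicontinuous_measurable; apply/lower_semicontinuousP => a.
rewrite (_ : [set _ | _] = \bigcup_y [set x | (a < x * y - psi y)%R]); last first.
  apply/seteqP; split => [x /= /ereal_sup_gt[_ [y _ <-]]|x [y _ /= ax]].
    by rewrite lte_fin => ay; exists y.
  by apply: lt_le_trans (fenchel_young x y); rewrite lte_fin.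
apply: bigcup_open => y _.
have cf : continuous (fun x : R => x * y - psi y)%R; last first.
  have /continuousP H := cf; exact: (H _ (@open_gt R a)).
move=> x; apply: cvgB; last exact: cvg_cst.
by apply: cvgM; [exact: cvg_id|exact: cvg_cst].
Qed.

End conjugate_theory.

(** With [m = psi y0 / y0], convexity and [psi 0 = 0] put [psi] above the line of slope [m] beyond
    [y0], so [m * y - psi y <= 0] there; up to [y0] it is at most [m * y0], as [psi] is
    nonnegative. *)
Lemma conjugate_finite_near0 (R : realType) (psi : R -> R) :
  (forall t x y : R, 0 <= t <= 1 ->
     psi (t * x + (1 - t) * y) <= t * psi x + (1 - t) * psi y) ->
  (forall x, 0 <= psi x) -> psi 0 = 0 -> (forall x, psi x = psi (- x)) ->
  (exists2 y : R, 0 < y & 0 < psi y) ->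
  exists2 m : R, 0 < m & exists2 c : R, 0 <= c & (conjugate psi m <= c%:E)%E.
Proof.
move=> psi_convex psi_ge0 psi0 psi_even [y0 y00 py0].
pose m := psi y0 / y0; have m0 : 0 < m by rewrite divr_gt0.
have mE : psi y0 = m * y0 by rewrite divfK// gt_eqF.
exists m => //; exists (m * y0); first by rewrite mulr_ge0// ltW.
apply: conjugate_le => y; rewrite lee_fin.
have [yy0|yy0] := leP y y0.
  by have := psi_ge0 y; have : m * y <= m * y0 by [rewrite ler_pM2l]; lra.
have y_gt0 : 0 < y by exact: lt_trans yy0.
have t01 : 0 <= y0 / y <= 1 by rewrite divr_ge0 ?(ltW y00) ?(ltW y_gt0)//= ler_pdivrMr// mul1r ltW.
have := psi_convex _ y 0 t01; rewrite mulr0 addr0 psi0 mulr0 addr0 divfK ?gt_eqF//.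
rewrite mE => H.
have : m * y <= psi y.
  rewrite -(ler_pM2l (divr_gt0 y00 y_gt0)).
  by rewrite (_ : y0 / y * (m * y) = m * y0)//; field; rewrite gt_eqF.
have : 0 <= m * y0 by rewrite mulr_ge0// ltW.
lra.
Qed.

(** * Convex functions of measures *)

Section total_variation.
Context (R : realType) (n : nat).
Local Notation leb := (lebesgue_rV R n).
Variables (O : set 'rV[R]_n) (psi : R -> R).
Hypotheses (oO : open O) (bO : bounded_set O).
Hypothesis psi_ge0 : forall x, 0 <= psi x.
Hypothesis psi0 : psi 0 = 0.
Hypothesis psi_even : forall x, psi x = psi (- x).
Implicit Types (v eta : 'rV[R]_n -> R) (mu : {charge set 'rV[R]_n -> \bar R}).
Local Notation psis := (conjugate psi).
Local Open Scope ereal_scope.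

Let mO : measurable O. Proof. exact: open_measurable_rV. Qed.

Let conj_ge0 := conjugate_ge0 psi0.

Lemma measurable_conjugate_comp k v : Cc k O v -> measurable_fun O (fun x => psis (v x)).
Proof.
move=> Cv; apply: (measurableT_comp (conjugate_measurable psi)).
exact: measurable_funS (continuous_measurable_rV (Cc_continuous Cv)).
Qed.

Lemma conjugate_dom_le v eta : Cc 0 O v -> conjugate_dom psi O eta ->
  (forall x, O x -> psis (v x) <= psis (eta x)) -> conjugate_dom psi O v.
Proof.
move=> Cv [Ceta Ieta] H; split => //.
apply: (le_integrable mO _ _ Ieta); first exact: measurable_conjugate_comp Cv.
by move=> x Ox; rewrite !gee0_abs ?conj_ge0// H.
Qed.

Lemma conjugate_dom0 : conjugate_dom psi O (0%R : 'rV[R]_n -> R).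
Proof.
split; first exact: Cc_0.
by apply: eq_integrable (integrable0 _ _) => // x _ /=; rewrite conjugate0.
Qed.

Lemma charge_integral0 mu (f : 'rV[R]_n -> R) : (forall x, f x = 0%R) ->
  charge_integral mu f = 0%R.
Proof.
move=> f0; have [K K0 muK] := charge_integral_bound mu.
have bf : bounded_measurable f.
  rewrite (_ : f = cst 0%R); last exact/funext.
  by split; [exact: measurable_cst|exists 0%R => x; rewrite normr0].
apply/eqP; rewrite -normr_le0 -[leRHS](mulr0 K); apply: muK => // x.
by rewrite f0 normr0.
Qed.

(** The dual formula for the total variation of [psi] of a measure, with the test class and the
    functional as parameters: the class shrinks to $C^1$ functions, and the functional may be a
    measure, an element of $H^{-1}$ or an $L^2$ pairing. *)
Definition dual_energy (D : set ('rV[R]_n -> R)) (l : ('rV[R]_n -> R) -> R) : \bar R :=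
  ereal_sup [set (l v)%:E - \int[leb]_(x in O) psis (v x) | v in D].

(** Upper bound: drop the negative part of [eta] and use [v * etap] as a competitor, since the
    conjugate at [t * x] is at most [t] times its value at [x] for [t] in $[0,1]$. Lower bound: for
    each [v] test with a cutoff equal to [1] on its support. *)
Lemma TVnorm_psi_measure mu :
  TVnorm O (psi_measure psi O mu) = dual_energy (conjugate_dom psi O) (charge_integral mu).
Proof.
pose P := psi_measure_pos psi O mu.
have P0 eta : (forall x, eta x = 0%R) -> P eta = 0.
  move=> eta0; rewrite /P /psi_measure_pos (_ : [set _ | _ in _] = [set 0]) ?ereal_sup1//.
  have E v : (charge_integral mu (fun x => v x * eta x)%R)%:E -
      \int[leb]_(x in O) (psis (v x) * (eta x)%:E) = 0.
    rewrite charge_integral0 => [|x]; last by rewrite eta0 mulr0.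
    by rewrite sub0e integral0_eq ?oppe0// => x _; rewrite eta0 mule0.
  apply/seteqP; split => [_ [v _ <-] //|_ ->].
  by exists 0%R; [exact: conjugate_dom0|exact: E].
have P_ge0 eta : 0 <= P eta.
  apply: ereal_sup_ubound; exists 0%R; first exact: conjugate_dom0.
  rewrite charge_integral0 => [|x]; last by rewrite mul0r.
  by rewrite sub0e integral0_eq ?oppe0// => x _; rewrite conjugate0// mul0e.
apply/eqP; rewrite eq_le; apply/andP; split.
  apply: ge_ereal_sup => _ [eta [[ceta etaO] eta1] <-].
  pose etap x := Num.max (eta x) 0%R.
  apply: (@le_trans _ _ (P etap)).
    rewrite /psi_measure -/(P _) -/(P _) -[leRHS]sube0.
    by apply: leeB.
  apply: ge_ereal_sup => _ [v [Cv Iv] <-].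
  have etap01 x : (0 <= etap x <= 1)%R.
    rewrite le_max lexx orbT/= ge_max ler01 andbT.
    exact: le_trans (ler_norm _) (eta1 x).
  have cetap : continuous etap.
    by move=> x; apply: (@continuous_max R _ eta (cst 0%R)); [exact: ceta|exact: cst_continuous].
  have Cve : Cc 0 O (fun x => v x * etap x)%R by exact: Cc_mull.
  have le1 x : psis (v x * etap x)%R <= psis (v x) * (etap x)%:E.
    by rewrite mulrC muleC; apply: conjugate_scale.
  have dve : conjugate_dom psi O (fun x => v x * etap x)%R.
    apply: (conjugate_dom_le Cve (Logic.conj Cv Iv)) => x Ox.
    by rewrite mulrC; apply: conjugate_scale_le.
  apply: (@le_trans _ _ ((charge_integral mu (fun x => v x * etap x)%R)%:E -
      \int[leb]_(x in O) (psis (v x * etap x)%R))).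
    apply: leeB => //; apply: ge0_le_integral => //.
    - exact: measurable_conjugate_comp Cve.
    - apply: emeasurable_funM; first exact: measurable_conjugate_comp Cv.
      apply/measurable_EFinP.
      exact: measurable_funS (continuous_measurable_rV cetap).
  by apply: ereal_sup_ubound; exists (fun x => v x * etap x)%R.
apply: ge_ereal_sup => _ [v [Cv Iv] <-].
have [_ cK KO] := Cv.
have [eta [Ceta eta01 eta1]] := cutoff_compact oO bO cK KO.
have veta x : (v x * eta x)%R = v x.
  have [/eta1 ->|/tsupport_eq0 ->] := pselect (tsupport v x); first by rewrite mulr1.
  by rewrite mul0r.
apply: (@le_trans _ _ (psi_measure psi O mu eta)); last first.
  apply: ereal_sup_ubound; exists eta => //; split.
    by split; [exact: Cc_continuous Ceta|move=> x; exact: Cc_eq0 Ceta].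
  by move=> x; have /andP[e0 e1] := eta01 x; rewrite ger0_norm.
rewrite /psi_measure.
have -> : psi_measure_pos psi O mu (fun x => Num.max (- eta x)%R 0%R) = 0.
  by apply: P0 => x; apply/max_r; rewrite oppr_le0; case/andP: (eta01 x).
rewrite sube0; apply: ereal_sup_ubound; exists v => //.
have maxE x : Num.max (eta x) 0%R = eta x by apply/max_l; case/andP: (eta01 x).
congr ((charge_integral mu _)%:E - _).
  by apply/funext => x; rewrite maxE veta.
apply: eq_integral => x _; rewrite maxE.
have [/eta1 ->|/tsupport_eq0 ->] := pselect (tsupport v x); first by rewrite mule1.
by rewrite conjugate0// mul0e.
Qed.

(** The conjugate may jump to [+oo], so a uniform approximation [f] of [v] need not be admissible.
    The shrunk [(1 - dl) * f] is: it equals [(1 - dl) * v + dl * z] with [z] bounded by [m], where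
    the conjugate is at most [c], and convexity controls the rest. *)
Lemma dual_energy_Cc1 mu (m c : R) : (0 < m)%R -> (0 <= c)%R -> psis m <= c%:E ->
  dual_energy (conjugate_dom psi O) (charge_integral mu) =
  dual_energy (Cc 1 O `&` conjugate_dom psi O) (charge_integral mu).
Proof.
move=> m0 c0 psim; set l := charge_integral mu.
apply/eqP; rewrite eq_le; apply/andP; split; last first.
  by apply: ereal_sup_le => _ [v [_ dv] <-]; exists v.
apply: ge_ereal_sup => _ [v [Cv Iv] <-].
apply/lee_addgt0Pr => e e0.
have [K K0 lK] := charge_integral_bound mu.
have leb_fin : leb O \is a fin_num.
  by rewrite ge0_fin_numE//; exact: lebesgue_rV_bounded_fin.
pose V := fine (leb O); have V0 : (0 <= V)%R by rewrite fine_ge0.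
(* The losses, each to be multiplied by [dl]: shrinking [v], approximating it uniformly within
   [m * dl], and enlarging the conjugate by [dl * c] over [O]. *)
pose D : R := (`|l v| + K * m + c * V + 1)%R.
have D0 : (0 < D)%R by rewrite ltr_wpDl// !addr_ge0// mulr_ge0// ltW.
pose dl : R := Num.min (2^-1)%R (e / D)%R.
have dl0 : (0 < dl)%R by rewrite lt_min invr_gt0// ltr0n/= divr_gt0.
have dl1 : (dl <= 2^-1)%R by rewrite ge_min lexx.
have dle : (dl * D <= e)%R.
  by rewrite -ler_pdivlMr// ge_min lexx orbT.
have [f Cf vf] := Cc1_dense oO bO Cv (mulr_gt0 m0 dl0).
pose w := ((1 - dl) *: f + 0)%R : 'rV[R]_n -> R.
have Cw : Cc 1 O w by apply: Cc_lin => //; exact: Cc_0.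
have wE x : w x = ((1 - dl) * f x)%R by rewrite /w !fctE addr0.
have psiw x : psis (w x) <= psis (v x) + (dl * c)%:E.
  pose z := ((1 - dl) * (f x - v x) / dl)%R.
  have zm : (`|z| <= m)%R.
    rewrite /z normrM normfV (gtr0_norm dl0) ler_pdivrMr// normrM ger0_norm; last by lra.
    have := vf x; rewrite distrC; have := normr_ge0 (f x - v x)%R; nra.
  have -> : w x = ((1 - dl) * v x + (1 - (1 - dl)) * z)%R.
    by rewrite wE /z; field; rewrite gt_eqF.
  have t01 : (0 <= 1 - dl <= 1)%R by lra.
  apply: le_trans (conjugate_convex _ _ _ t01) _.
  apply: leeD.
    by rewrite -[leRHS]mul1e lee_wpmul2r ?conj_ge0// lee_fin; lra.
  rewrite EFinM subKr; apply: lee_wpmul2l; first by rewrite lee_fin ltW.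
  exact: le_trans (conjugate_le_norm psi_ge0 psi0 psi_even zm) psim.
have Icst : leb.-integrable O (EFin \o cst (dl * c)%R).
  apply: (@bounded_integrable _ _ _ _ `|dl * c|%R) => //; exact: measurable_cst.
have mw := measurable_conjugate_comp Cw.
have dw : conjugate_dom psi O w.
  split; first exact: Cc1_Cc0.
  apply: (le_integrable mO _ _ (integrableD mO Iv Icst)) => // x Ox.
  have dc0 : 0 <= (dl * c)%:E by rewrite lee_fin mulr_ge0// ltW.
  by rewrite !gee0_abs ?conj_ge0//; exact: adde_ge0.
have intw : \int[leb]_(x in O) psis (w x) <= \int[leb]_(x in O) psis (v x) + (dl * c * V)%:E.
  have -> : (dl * c * V)%:E = \int[leb]_(x in O) (EFin \o cst (dl * c)%R) x.
    rewrite (_ : EFin \o cst _ = cst (dl * c)%:E)// integral_cst//.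
    by rewrite EFinM /V fineK.
  rewrite -integralD//; apply: ge0_le_integral => //.
  by case/integrableP : (integrableD mO Iv Icst).
have fw : \int[leb]_(x in O) psis (w x) \is a fin_num by apply: integrable_fin_num => //; case: dw.
have fv : \int[leb]_(x in O) psis (v x) \is a fin_num by exact: integrable_fin_num.
have lw : (l v <= l w + dl * (`|l v| + K * m))%R.
  have bv := Cc_bounded_measurable Cv; have bf := Cc_bounded_measurable Cf.
  have b0 := Cc_bounded_measurable (@Cc_0 R n 0 O isT).
  have -> : l w = ((1 - dl) * l f)%R.
    by rewrite /l charge_integral_lin// [X in (_ + X)%R]charge_integral0// addr0.
  have : (`|l f - l v| <= K * (m * dl))%R.
    have -> : (l f - l v = l (-1 *: v + f))%R.
      by rewrite /l charge_integral_lin//; ring.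
    apply: lK; first exact: bounded_measurable_lin.
    by move=> x; have := vf x; rewrite !fctE scaleN1r addrC distrC.
  rewrite ler_norml => /andP[h1 h2]; have := ler_norm (l v).
  have : (0 <= K * (m * dl))%R by rewrite !mulr_ge0// ltW.
  nra.
apply: (@le_trans _ _ ((l w)%:E - \int[leb]_(x in O) psis (w x) + e%:E)); last first.
  by apply: leeD => //; apply: ereal_sup_ubound; exists w.
move: intw; rewrite -(fineK fw) -(fineK fv) -!EFinD !lee_fin.
move: dle; rewrite /D => dle intw; lra.
Qed.

(** [phi] picks some measure [nu] representing [F], possibly other than [mu]. Over test functions in
    [Cc 1 O] the dual energy of [nu] is that of [F], so the choice does not matter. *)
Lemma phi_dual_energy mu F (m c : R) : (0 < m)%R -> (0 <= c)%R -> psis m <= c%:E ->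
  radon_Hm1 O mu -> represents O mu F ->
  phi psi O F = dual_energy (Cc 1 O `&` conjugate_dom psi O) F.
Proof.
move=> m0 c0 psim Rmu muF; rewrite /phi; case: pselect => [H|[]]; last by exists mu.
case: (cid H) => nu [Rnu nuF] /=.
rewrite TVnorm_psi_measure (dual_energy_Cc1 nu m0 c0 psim) /dual_energy.
congr ereal_sup; apply/seteqP; split => _ [v [Cv dv] <-]; exists v => //;
  by have [_ ->] := nuF.
Qed.

End total_variation.

(** * The approximate resolvent *)

(** The arithmetic behind [nq (T \o w) <= M * nq w], on squared seminorms. *)
Lemma weighted_sum_le (R : realFieldType) (e M x x' y y' z z' : R) : 0 <= e ->
  z' <= e * x' + y' -> e * x + y <= z -> x' <= M ^+ 2 * x -> y' <= M ^+ 2 * y ->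
  z' <= M ^+ 2 * z.
Proof.
move=> e0 h1 h2 h3 h4; apply: le_trans h1 _.
apply: (@le_trans _ _ (M ^+ 2 * (e * x + y))); last by rewrite ler_wpM2l ?sqr_ge0.
by rewrite mulrDr mulrCA lerD// ler_wpM2l.
Qed.

Section resolvent.
Context (R : realType) (n : nat).
Local Notation leb := (lebesgue_rV R n).
Variable O : set 'rV[R]_n.
Hypotheses (oO : open O) (bO : bounded_set O).
Implicit Types (v w eta : 'rV[R]_n -> R).

Let mO : measurable O. Proof. exact: open_measurable_rV. Qed.

Let b := l2form O.
Let a := hform O.
Let nb v := Num.sqrt (b v v).
Let na v := Num.sqrt (a v v).

Let b_psd : psd_form (L2 O) b. Proof. exact: l2form_psd. Qed.
Let a_psd : psd_form (Cc 1 O) a. Proof. exact: hform_psd_Cc1. Qed.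

Let L2_Cc0 v : Cc 0 O v -> L2 O v. Proof. exact: Cc_L2. Qed.
Let L2_Cc1 v : Cc 1 O v -> L2 O v. Proof. exact: Cc_L2. Qed.

Lemma l2norm_uniform_le v (c : R) : L2 O v -> 0 <= c -> (forall x, `|v x| <= c) ->
  l2form O v v <= c ^+ 2 * fine (leb O).
Proof.
move=> Lv c0 vc; rewrite -(Rintegral_cst _ mO (c ^+ 2)).
apply: le_Rintegral => //.
- exact: L2_mul_integrable.
- apply: (@bounded_integrable _ _ _ _ (`|c ^+ 2|)) => //; exact: measurable_cst.
- by move=> x _; rewrite -expr2 -(real_normK (num_real (v x))) ler_pXn2r// nnegrE.
Qed.

Lemma l2norm_partial_le v i : Cc 1 O v -> Num.sqrt (l2form O (partial i v) (partial i v)) <=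
  Num.sqrt (hform O v v).
Proof.
move=> Cv; apply: ler_wsqrtr; rewrite hform_Cc1// (bigD1 i)//= lerDl.
have [_ _ _ b0] := b_psd; apply: sumr_ge0 => j _; apply: b0.
by apply: L2_Cc0; exact: Cc_partial.
Qed.

Variables (l : ('rV[R]_n -> R) -> R) (C : R).
Hypothesis C0 : 0 <= C.
Hypothesis l_lin : forall (c : R) u v, Cc 1 O u -> Cc 1 O v -> l (c *: u + v) = c * l u + l v.
Hypothesis l_bound : forall v, Cc 1 O v -> `|l v| <= C * Num.sqrt (hform O v v).

(* Up to [e |v|_a] the functional is [a g], and then [b f] after replacing the
   gradient of [g] by a field in [Cc 1 O] and integrating by parts. *)
Lemma functional_interpolation e : 0 < e -> exists2 K : R, 0 <= K &
  forall v, Cc 1 O v -> `|l v| <= e * Num.sqrt (hform O v v) + K * Num.sqrt (l2form O v v).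
Proof.
move=> e0; have e2 : 0 < e / 2 by rewrite divr_gt0.
have [g Cg gP] := approximate_riesz a_psd l_lin l_bound e2.
pose V := Num.sqrt (fine (leb O)); have V0 : 0 <= V by exact: sqrtr_ge0.
pose D : R := 2 * n%:R * V + 1.
have D0 : 0 < D by rewrite ltr_wpDl// !mulr_ge0.
pose dl := e / D; have dl0 : 0 < dl by rewrite divr_gt0.
have /choice[f fP] : forall i, exists f, Cc 1 O f /\ forall x, `|partial i g x - f x| <= dl.
  by move=> i; have [f Cf fd] := Cc1_dense oO bO (Cc_partial i Cg) dl0; exists f.
(* The price of moving the derivative from [v] to the field [f] that approximates the gradient of
   [g]. *)
pose K := \sum_i nb (partial i (f i)).
exists K; first by apply: sumr_ge0 => i _; exact: sqrtr_ge0.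
move=> v Cv.
have Lv := L2_Cc1 Cv.
have Lg i : L2 O (partial i g) by apply: L2_Cc0; exact: Cc_partial.
have Ldv i : L2 O (partial i v) by apply: L2_Cc0; exact: Cc_partial.
have Lf i : L2 O (f i) by apply: L2_Cc1; have [] := fP i.
have Ldf i : L2 O (partial i (f i)) by apply: L2_Cc0; apply: Cc_partial; have [] := fP i.
have agv : `|a g v| <= n%:R * (dl * V) * na v + K * nb v.
  rewrite /a hform_Cc1//.
  have -> : n%:R * (dl * V) * na v + K * nb v =
      \sum_(i < n) (dl * V * na v + nb (partial i (f i)) * nb v).
    rewrite big_split/= -!mulr_suml; congr (_ + _).
    by rewrite sumr_const card_ord /dl -[e *+ n]mulr_natl; ring.
  apply: le_trans (ler_norm_sum _ _ _) _; apply: ler_sum => i _.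
  pose gf := (-1) *: f i + partial i g.
  have Lgf : L2 O gf by exact: L2_lin.
  (* [gf] is the uniformly small remainder of the approximation; only [f i] is integrated by
     parts. *)
  have -> : l2form O (partial i g) (partial i v) = b gf (partial i v) - b (partial i (f i)) v.
    have [_ bl _ _] := b_psd; rewrite /gf bl//.
    have [Cf _] := fP i; have [Cf1 _ _] := Cf.
    have := integration_by_parts_Cc1 oO i Cf1 Cv; rewrite /b /l2form; lra.
  apply: le_trans (ler_normB _ _) _; apply: lerD.
    apply: le_trans (psd_form_CS_sqrt b_psd Lgf (Ldv i)) _.
    apply: ler_pM; [exact: sqrtr_ge0|exact: sqrtr_ge0| |exact: l2norm_partial_le].
    rewrite -[dl * V]ger0_norm; last by rewrite mulr_ge0// ltW.
    rewrite -[leRHS]sqrtr_sqr; apply: ler_wsqrtr.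
    rewrite exprMn sqr_sqrtr ?fine_ge0//; apply: l2norm_uniform_le => //; first exact: ltW.
    by move=> x; have [_ /(_ x)] := fP i; rewrite /gf !fctE scaleN1r addrC.
  exact: (psd_form_CS_sqrt b_psd).
have h1 := gP _ Cv.
have h2 : `|l v| <= `|a g v - l v| + `|a g v|.
  by rewrite -{1}[l v](subrK (a g v)) (le_trans (ler_normD _ _))// distrC.
have h3 : n%:R * (dl * V) <= e / 2.
  rewrite ler_pdivlMr//.
  rewrite (_ : n%:R * _ * 2 = e * (2 * n%:R * V) / D); last first.
    by rewrite /dl; field; rewrite gt_eqF.
  by rewrite ler_pdivrMr// ler_pM2l// /D lerDl.
have h4 : n%:R * (dl * V) * na v <= e / 2 * na v by rewrite ler_wpM2r// sqrtr_ge0.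
rewrite -/(na v) -/(nb v); rewrite -/(na v) in h1; lra.
Qed.

Variables (P : R).
Hypothesis P0 : 0 < P.
Hypothesis poinc : forall v, Cc 1 O v -> l2form O v v <= P * hform O v v.

Lemma norm_le_of_deriv (T dT : R -> R) (M : R) : (forall s : R, is_derive s 1 T (dT s)) ->
  T 0 = 0 -> (forall s, 0 <= dT s <= M) -> forall s, `|T s| <= M * `|s|.
Proof.
move=> TdT T0 dTM s; have [s0|s0] := leP 0 s.
  have [c _] := is_derive_MVT TdT s0; rewrite T0 !subr0 => ->.
  by have /andP[c0 c1] := dTM c; rewrite normrM ler_wpM2r// ger0_norm.
have [c _] := is_derive_MVT TdT (ltW s0); rewrite T0 !sub0r mulrN => /oppr_inj ->.
have /andP[c0 c1] := dTM c.
by rewrite normrM ler_wpM2r// ger0_norm.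
Qed.

Lemma hform_comp_ge0 (T dT : R -> R) w : (forall s : R, is_derive s 1 T (dT s)) ->
  continuous dT -> T 0 = 0 -> (forall s, 0 <= dT s) -> Cc 1 O w -> 0 <= hform O w (T \o w).
Proof.
move=> TdT cdT T0 dT0 Cw; rewrite hform_Cc1//; last exact: Cc1_comp Cw.
apply: sumr_ge0 => i _; apply: Rintegral_ge0 => x _.
have [Cw1 _ _] := Cw.
by rewrite (partial_comp i x TdT Cw1) mulrCA mulr_ge0// -expr2 sqr_ge0.
Qed.

Lemma hform_comp_le (T dT : R -> R) (M : R) w : (forall s : R, is_derive s 1 T (dT s)) ->
  continuous dT -> T 0 = 0 -> (forall s, 0 <= dT s <= M) -> Cc 1 O w ->
  hform O (T \o w) (T \o w) <= M ^+ 2 * hform O w w.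
Proof.
move=> TdT cdT T0 dTM Cw; have CT := Cc1_comp TdT cdT T0 Cw.
rewrite !hform_Cc1// mulr_sumr; apply: ler_sum => i _.
have L1 : L2 O (partial i w) by apply: L2_Cc0; exact: Cc_partial.
have L2 : L2 O (partial i (T \o w)) by apply: L2_Cc0; exact: Cc_partial.
have I1 := L2_mul_integrable mO L1 L1; have I2 := L2_mul_integrable mO L2 L2.
rewrite /l2form -(RintegralZl _ mO I1); apply: le_Rintegral => //.
  exact: (integrableZl mO (M ^+ 2) I1).
move=> x _; have [Cw1 _ _] := Cw.
rewrite (partial_comp i x TdT Cw1) mulrACA -!expr2.
rewrite ler_wpM2r ?sqr_ge0//; have /andP[d0 d1] := dTM (w x).
by rewrite ler_pXn2r// nnegrE// (le_trans d0).
Qed.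

Lemma l2form_comp_le (T dT : R -> R) (M : R) w : (forall s : R, is_derive s 1 T (dT s)) ->
  continuous dT -> T 0 = 0 -> (forall s, 0 <= dT s <= M) -> Cc 1 O w ->
  l2form O (T \o w) (T \o w) <= M ^+ 2 * l2form O w w.
Proof.
move=> TdT cdT T0 dTM Cw; have CT := Cc1_comp TdT cdT T0 Cw.
have I1 := L2_mul_integrable mO (L2_Cc1 Cw) (L2_Cc1 Cw).
have I2 := L2_mul_integrable mO (L2_Cc1 CT) (L2_Cc1 CT).
rewrite /l2form -(RintegralZl _ mO I1); apply: le_Rintegral => //.
  exact: (integrableZl mO (M ^+ 2) I1).
move=> x _ /=; have H := norm_le_of_deriv TdT T0 dTM (w x).
rewrite -!expr2 -exprMn -(real_normK (num_real (T (w x)))) -[leRHS](real_normK (num_real _)).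
rewrite ler_pXn2r ?nnegrE// normrM (ger0_norm (_ : 0 <= M))//.
by have /andP[d0 d1] := dTM 0; exact: le_trans d0 d1.
Qed.

(* [w] solves [w - eps Laplace w = l] up to [dl]; testing with [w] bounds
   [eps |w|_a], and testing with [T w] uses [a w (T w) >= 0]. *)
Lemma approximate_resolvent k (T dT : R -> R) (M : R) : 0 < k ->
  (forall s : R, is_derive s 1 T (dT s)) -> continuous dT -> T 0 = 0 ->
  (forall s, 0 <= dT s <= M) ->
  exists w, [/\ Cc 1 O w,
    forall v, Cc 1 O v -> `|l2form O w v - l v| <= k * Num.sqrt (hform O v v) &
    l2form O w (T \o w) <= l (T \o w) + k].
Proof.
move=> k0 TdT cdT T0 dTM; have C_ge0 := C0; have P_gt0 := P0.
have M0 : 0 <= M by have /andP[d0 d1] := dTM 0; exact: le_trans d0 d1.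
have k8 : 0 < k / 8 by rewrite divr_gt0.
have [K K0 lK] := functional_interpolation k8.
(* The square root of the resolvent parameter [ep]; [rt * (K + 1) <= k / 8] neutralises the
   interpolation constant [K]. *)
pose rt : R := Num.min 1 (k / (8 * (K + 1))).
have K1 : 0 < 8 * (K + 1) by rewrite mulr_gt0// ltr_wpDl.
have rt0 : 0 < rt by rewrite lt_min ltr01 divr_gt0.
have rt1 : rt <= 1 by rewrite ge_min lexx.
have rtK : rt * (8 * (K + 1)) <= k.
  by rewrite -ler_pdivlMr// ge_min lexx orbT.
pose ep := rt ^+ 2; have ep0 : 0 < ep by rewrite exprn_gt0.
have ep1 : ep <= 1 by rewrite /ep expr2; nra.
pose q u v := ep * a u v + b u v.
have bX : psd_form (Cc 1 O) b.
  by apply: psd_form_restrict b_psd (Cc_lin_closed O (leqnn 1)) _ => v; exact: L2_Cc1.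
have q_psd : psd_form (Cc 1 O) q.
  by apply: psd_formD bX; apply: psd_form_scale a_psd; exact: ltW.
pose nq v := Num.sqrt (q v v).
have a_ge0 v : Cc 1 O v -> 0 <= a v v by have [_ _ _] := a_psd; exact.
have b_ge0 v : Cc 1 O v -> 0 <= b v v by have [_ _ _] := bX; exact.
have na_ge0 v : 0 <= na v by exact: sqrtr_ge0.
have nb_ge0 v : 0 <= nb v by exact: sqrtr_ge0.
have nq_ge0 v : 0 <= nq v by exact: sqrtr_ge0.
have na2 v : Cc 1 O v -> na v ^+ 2 = a v v by exact: (psd_form_nrm_sqr a_psd).
have nb2 v : Cc 1 O v -> nb v ^+ 2 = b v v by exact: (psd_form_nrm_sqr bX).
have nq2 v : Cc 1 O v -> nq v ^+ 2 = ep * na v ^+ 2 + nb v ^+ 2.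
  by move=> Cv; rewrite (psd_form_nrm_sqr q_psd Cv) na2// nb2.
have le_nq v c : 0 <= c -> nq v ^+ 2 <= c ^+ 2 -> nq v <= c.
  by move=> c0; rewrite ler_pXn2r ?nnegrE.
have na_nq v : Cc 1 O v -> rt * na v <= nq v.
  move=> Cv; rewrite -(@ler_pXn2r _ 2) ?nnegrE ?mulr_ge0 ?(ltW rt0)// nq2// exprMn.
  by rewrite lerDl sqr_ge0.
have nq_ab v : Cc 1 O v -> nq v <= na v + nb v.
  move=> Cv; apply: le_nq; first exact: addr_ge0.
  rewrite nq2//; have := na_ge0 v; have := nb_ge0 v; have := sqr_ge0 (na v); nra.
have nq_a v : Cc 1 O v -> nq v <= (1 + P) * na v.
  move=> Cv; apply: le_nq; first by rewrite mulr_ge0// addr_ge0// ltW.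
  rewrite nq2// nb2//; have := poinc Cv; rewrite -/(b v v) -/(a v v) -na2//.
  have := sqr_ge0 (na v); nra.
pose N := C / rt + 1; have N0 : 0 < N by rewrite ltr_wpDl// divr_ge0// ltW.
(* The Riesz defect is measured in [nq]. The second entry converts [nq] to the gradient seminorm
   through the Poincare inequality; the third handles the test function [T \o w], whose [nq] is at
   most [M * N]. *)
pose dl : R := Num.min 1 (Num.min (k / (8 * (1 + P))) (k / (M * N + 1))).
have D1 : 0 < 8 * (1 + P) by lra.
have D2 : 0 < M * N + 1 by rewrite ltr_wpDl// mulr_ge0// ltW.
have dl0 : 0 < dl by rewrite !lt_min ltr01 !divr_gt0.
have dl1 : dl <= 1 by rewrite ge_min lexx.
have dlP : dl * (8 * (1 + P)) <= k.
  by rewrite -ler_pdivlMr// !ge_min lexx orbT.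
have dlN : dl * (M * N + 1) <= k.
  by rewrite -ler_pdivlMr// !ge_min lexx !orbT.
have dlP8 : dl * (1 + P) <= k / 8 by lra.
have k2k : k / 8 + 3 * (k / 8) <= k by lra.
have lq v : Cc 1 O v -> `|l v| <= (C / rt) * nq v.
  move=> Cv; apply: le_trans (l_bound Cv) _.
  rewrite mulrAC ler_pdivlMr// -mulrA ler_wpM2l// mulrC.
  exact: na_nq.
have [w Cw wP] := approximate_riesz q_psd l_lin lq dl0.
have CT := Cc1_comp TdT cdT T0 Cw.
have qw : nq w ^+ 2 <= l w + dl * nq w.
  have := wP _ Cw; rewrite -/(nq w) -(psd_form_nrm_sqr q_psd Cw) -/(nq w) ler_norml.
  by move=> /andP[_]; lra.
have nqw : nq w <= N.
  have := lq _ Cw; have := ler_norm (l w); have := nq_ge0 w => h1 h2 h3.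
  have : nq w ^+ 2 <= N * nq w by rewrite /N; nra.
  have [->|w0] := eqVneq (nq w) 0; first by rewrite (ltW N0).
  by rewrite expr2 ler_pM2r// lt_neqAle eq_sym w0.
(* By Cauchy-Schwarz, [z] bounds the contribution of [ep * a w v] to the residual, as a multiple of
   [na v]. *)
pose z := ep * na w; have z0 : 0 <= z by rewrite mulr_ge0// ltW.
have zk : z <= 3 * (k / 8).
  have := lK _ Cw; rewrite -/(na w) -/(nb w) => h1.
  have h2 := ler_norm (l w); have h3 := nq_ab _ Cw.
  have h4 : dl <= k / 8 by nra.
  have h5 : ep * na w ^+ 2 + nb w ^+ 2 <= (k / 4) * na w + (K + 1) * nb w.
    rewrite -nq2//; have := na_ge0 w; have := nb_ge0 w; nra.
  have h6 : ep * na w ^+ 2 <= k / 4 * na w + (K + 1) ^+ 2 / 4.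
    by have := sqr_ge0 (nb w - (K + 1) / 2); nra.
  (* Testing with [w], interpolation and completing the square in [nb w] give [h6]; times [ep] it is
     a quadratic inequality for [z] alone, violated as soon as [z] exceeds [3 * (k / 8)]. *)
  have h7 : z ^+ 2 <= k / 4 * z + (rt * (K + 1)) ^+ 2 / 4.
    have -> : z ^+ 2 = ep * (ep * na w ^+ 2) by rewrite /z; ring.
    have -> : k / 4 * z + (rt * (K + 1)) ^+ 2 / 4 =
       ep * (k / 4 * na w + (K + 1) ^+ 2 / 4) by rewrite /z /ep; ring.
    by rewrite ler_pM2l.
  have h8 : (rt * (K + 1)) ^+ 2 <= (k / 8) ^+ 2.
    by rewrite ler_pXn2r ?nnegrE ?mulr_ge0 ?(ltW rt0) ?(ltW k8) ?addr_ge0//; lra.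
  by rewrite leNgt; apply/negP => h9; nra.
exists w; split; first exact: Cw.
- move=> v Cv; change (`|b w v - l v| <= k * na v).
  have h1 : `|q w v - l v| <= dl * nq v := wP _ Cv.
  have h2 : `|a w v| <= na w * na v := psd_form_CS_sqrt a_psd Cw Cv.
  have -> : b w v - l v = (q w v - l v) - ep * a w v by rewrite /q; ring.
  apply: le_trans (ler_normB _ _) _.
  rewrite [X in _ + X]normrM (gtr0_norm ep0).
  have h3 : ep * `|a w v| <= z * na v by rewrite /z -mulrA ler_pM2l.
  have h4 : z * na v <= 3 * (k / 8) * na v by rewrite ler_wpM2r.
  have h5 : dl * nq v <= dl * ((1 + P) * na v) by rewrite (ler_pM2l dl0); exact: nq_a.
  have h6 : dl * ((1 + P) * na v) <= k / 8 * na v.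
    by rewrite mulrA; apply: ler_wpM2r; [exact: na_ge0|exact: dlP8].
  apply: (@le_trans _ _ (dl * nq v + z * na v)); first by apply: lerD; [exact: h1|exact: h3].
  apply: (@le_trans _ _ (k / 8 * na v + 3 * (k / 8) * na v)).
    by apply: lerD; [exact: le_trans h5 h6|exact: h4].
  by rewrite -mulrDl; apply: ler_wpM2r; [exact: na_ge0|exact: k2k].
- have h1 : `|q w (T \o w) - l (T \o w)| <= dl * nq (T \o w) := wP _ CT.
  have h2 : 0 <= a w (T \o w).
    by apply: (hform_comp_ge0 TdT cdT T0) Cw => s; have /andP[] := dTM s.
  have h3 : nq (T \o w) <= M * nq w.
    apply: le_nq; first by apply: mulr_ge0; [exact: M0|exact: nq_ge0].
    have e1 : nq (T \o w) ^+ 2 <= ep * na (T \o w) ^+ 2 + nb (T \o w) ^+ 2.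
      by move/eqP: (nq2 _ CT); rewrite eq_le => /andP[].
    have e2 : ep * na w ^+ 2 + nb w ^+ 2 <= nq w ^+ 2.
      by move/eqP: (nq2 _ Cw); rewrite eq_le => /andP[].
    have e3 : na (T \o w) ^+ 2 <= M ^+ 2 * na w ^+ 2.
      rewrite [X in X <= _](na2 _ CT) [X in _ * X](na2 _ Cw).
      exact: (hform_comp_le TdT cdT T0 dTM Cw).
    have e4 : nb (T \o w) ^+ 2 <= M ^+ 2 * nb w ^+ 2.
      rewrite [X in X <= _](nb2 _ CT) [X in _ * X](nb2 _ Cw).
      exact: (l2form_comp_le TdT cdT T0 dTM Cw).
    by rewrite [leRHS]exprMn; exact: (weighted_sum_le (ltW ep0) e1 e2 e3 e4).
  have h4 : dl * nq (T \o w) <= k.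
    apply: le_trans dlN; rewrite (ler_pM2l dl0); apply: le_trans h3 _.
    by apply: ler_wpDr; [exact: ler01|apply: ler_wpM2l; [exact: M0|exact: nqw]].
  have h5 : 0 <= ep * a w (T \o w) by apply: mulr_ge0; [exact: ltW|exact: h2].
  change (b w (T \o w) <= l (T \o w) + k).
  rewrite -lerBlDl; apply: le_trans h4; apply: le_trans h1.
  apply: le_trans (ler_norm _); apply: lerB; [rewrite /q lerDr; exact: h5|exact: lexx].
Qed.

End resolvent.

(** * Energy estimate for the approximants *)

Section energy.
Context (R : realType) (n : nat).
Local Notation leb := (lebesgue_rV R n).
Variables (O : set 'rV[R]_n) (psi : R -> R) (G : R).
Hypotheses (oO : open O) (bO : bounded_set O).
Hypothesis psi_convex : forall t x y : R, 0 <= t <= 1 ->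
  psi (t * x + (1 - t) * y) <= t * psi x + (1 - t) * psi y.
Hypothesis psi_ge0 : forall x, 0 <= psi x.
Hypothesis psi0 : psi 0 = 0.
Hypothesis psi_even : forall x, psi x = psi (- x).
Hypothesis G0 : 0 < G.
Hypothesis psi_growth : forall x, psi x <= G * (1 + `|x|).
Implicit Types (v w eta : 'rV[R]_n -> R).

Let mO : measurable O. Proof. exact: open_measurable_rV. Qed.

Lemma Cc0_psi w : Cc 0 O w -> Cc 0 O (psi \o w).
Proof.
move=> [cw cK KO]; apply: (@Cc_of_compact _ _ _ _ _ _ _ cK KO).
  have cpsi := convex_continuous psi_convex psi_ge0 psi_even G0 psi_growth.
  by move=> x; apply: continuous_comp; [exact: cw|exact: cpsi].
by move=> x /tsupport_eq0 /= ->.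
Qed.

(** The integrated Fenchel-Young inequality; it bounds [phi] of the measure with density [w]. *)
Lemma dual_energy_le_integral w : Cc 0 O w ->
  (dual_energy O psi (Cc 1 O `&` conjugate_dom psi O) (l2form O w) <=
   (\int[leb]_(x in O) psi (w x))%:E)%E.
Proof.
move=> Cw; apply: ge_ereal_sup => _ [v [Cv [_ Iv]] <-].
have Ipsi := Cc_integrable mO (Cc0_psi Cw).
have Lw : L2 O w by exact: Cc_L2 Cw.
have Lv : L2 O v by exact: Cc_L2 Cv.
have Iwv := L2_mul_integrable mO Lw Lv.
have fv : (\int[leb]_(x in O) conjugate psi (v x))%E \is a fin_num by exact: integrable_fin_num.
have : (\int[leb]_(x in O) (w x * v x - psi (w x))%:E <=
    \int[leb]_(x in O) conjugate psi (v x))%E.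
  apply: le_integral => //.
    exact: eq_integrable (integrableB mO Iwv Ipsi).
  by move=> x _; rewrite [(w x * _)%R]mulrC; exact: fenchel_young.
have -> : (\int[leb]_(x in O) (w x * v x - psi (w x))%:E =
    (l2form O w v - \int[leb]_(x in O) psi (w x))%:E)%E.
  rewrite /l2form -RintegralB// /Rintegral fineK//; apply: integrable_fin_num => //.
  exact: eq_integrable (integrableB mO Iwv Ipsi).
rewrite -(fineK fv) lee_fin -EFinB lee_fin; lra.
Qed.

Variables (l : ('rV[R]_n -> R) -> R) (C P : R).
Hypothesis C0 : 0 <= C.
Hypothesis l_lin : forall (c : R) u v, Cc 1 O u -> Cc 1 O v -> l (c *: u + v) = c * l u + l v.
Hypothesis l_bound : forall v, Cc 1 O v -> `|l v| <= C * H10norm O v.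
Hypothesis P0 : 0 < P.
Hypothesis poinc : forall v, Cc 1 O v -> l2form O v v <= P * hform O v v.

(** The near-equality in Fenchel-Young at [T \o w] gives $\int\psi(w)+\int\psi^*(T(w))\le\int
    wT(w)+k/2$, and the resolvent gives $\int wT(w)\le l(T(w))+k/2$. As [T \o w] is admissible,
    $l(T(w))-\int\psi^*(T(w))$ is at most the dual energy of [l]. *)
Lemma energy_recovery k : 0 < k -> exists w, [/\ Cc 1 O w,
    forall v, Cc 1 O v -> `|l2form O w v - l v| <= k * H10norm O v &
    ((\int[leb]_(x in O) psi (w x))%:E <=
      dual_energy O psi (Cc 1 O `&` conjugate_dom psi O) l + k%:E)%E].
Proof.
move=> k0.
have leb_fin : leb O \is a fin_num.
  by rewrite ge0_fin_numE//; exact: lebesgue_rV_bounded_fin.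
pose V := fine (leb O); have V0 : 0 <= V by rewrite fine_ge0.
have k2 : 0 < k / 2 by rewrite divr_gt0.
have kV : 0 < k / (2 * (V + 1)) by rewrite divr_gt0// mulr_gt0// ltr_wpDl.
(* The pointwise subgradient error, small enough that its integral over [O] is at most [k / 2]; the
   resolvent takes the other half. *)
set ka := k / _ in kV.
have kaV : ka * V <= k / 2.
  have : ka * (2 * (V + 1)) = k by rewrite /ka divfK// gt_eqF// mulr_gt0// ltr_wpDl.
  by move: kV V0 k0; lra.
have [T [dT [M M0 [TdT cdT T0 dTM Tsub]]]] :=
  smooth_subgradient psi_convex psi_ge0 psi_even G0 psi_growth kV.
have l_bound' v : Cc 1 O v -> `|l v| <= C * Num.sqrt (hform O v v).
  by move=> Cv; rewrite -H10normE; exact: l_bound.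
have [w [Cw wP wT]] := approximate_resolvent oO bO C0 l_lin l_bound' P0 poinc k2 TdT cdT T0 dTM.
exists w; split; first exact: Cw.
  move=> v Cv; rewrite H10normE; apply: le_trans (wP v Cv) _.
  by apply: ler_wpM2r; [exact: sqrtr_ge0|rewrite ler_pdivrMr// ler_peMr ?(ltW k0)// ler1n].
have CT := Cc1_comp TdT cdT T0 Cw.
have conj_ub s : (conjugate psi (T s) <= (T s * s - psi s + ka)%:E)%E.
  by apply: conjugate_le => y; rewrite lee_fin; exact: Tsub.
have Ipsi := Cc_integrable mO (Cc0_psi (Cc1_Cc0 Cw)).
have Lw : L2 O w by exact: Cc_L2 Cw.
have LT : L2 O (T \o w) by exact: Cc_L2 CT.
have IwT := L2_mul_integrable mO Lw LT.
have Icst : leb.-integrable O (EFin \o cst ka).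
  apply: (@bounded_integrable _ _ _ _ `|ka|) => //; exact: measurable_cst.
pose h x := w x * (T \o w) x - psi (w x).
have Ih : leb.-integrable O (EFin \o h).
  exact: eq_integrable (integrableB mO IwT Ipsi).
have Ihk : leb.-integrable O (EFin \o (fun x => h x + ka)).
  exact: eq_integrable (integrableD mO Ih Icst).
have conj_h x : (conjugate psi ((T \o w) x) <= (h x + ka)%:E)%E.
  by rewrite /h [w x * _]mulrC; exact: conj_ub.
have mconj := measurable_conjugate_comp psi CT.
(* The subgradient inequality bounds the conjugate at [T (w x)] by an integrable function, so it is
   finite there even if the conjugate is [+oo] elsewhere. *)
have dT_dom : conjugate_dom psi O (T \o w).
  split; first exact: Cc1_Cc0.
  apply: (le_integrable mO mconj _ Ihk) => x _.
  rewrite gee0_abs; last exact: conjugate_ge0.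
  by apply: le_trans (conj_h x) _; rewrite abse_EFin lee_fin ler_norm.
have Iconj := dT_dom.2.
have fconj : (\int[leb]_(x in O) conjugate psi ((T \o w) x))%E \is a fin_num.
  exact: integrable_fin_num.
have int_le : (\int[leb]_(x in O) conjugate psi ((T \o w) x) <=
    (l2form O w (T \o w) - \int[leb]_(x in O) psi (w x) + ka * V)%:E)%E.
  have -> : (l2form O w (T \o w) - \int[leb]_(x in O) psi (w x) + ka * V)%R =
      \int[leb]_(x in O) (h x + ka).
    rewrite RintegralD// Rintegral_cst// /h RintegralB//.
  rewrite /Rintegral fineK; last exact: integrable_fin_num.
  by apply: le_integral => // x _; exact: conj_h.
apply: (@le_trans _ _ ((l (T \o w))%:E -
    \int[leb]_(x in O) conjugate psi ((T \o w) x) + k%:E)%E); last first.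
  by apply: leeD => //; apply: ereal_sup_ubound; exists (T \o w).
move: int_le; rewrite -(fineK fconj) -EFinB -EFinD !lee_fin.
move: wT kaV; move: (l2form O w (T \o w)) (l (T \o w)) (fine _) (Rintegral _ _ _) => x1 x2 x3 x4.
by lra.
Qed.

End energy.

(** * The recovery sequence *)

Section dual_energy_limit.
Context (R : realType) (n : nat).
Variables (O : set 'rV[R]_n) (psi : R -> R) (D : set ('rV[R]_n -> R)).
Hypothesis D_fin : forall v, D v ->
  (\int[lebesgue_rV R n]_(x in O) conjugate psi (v x))%E \is a fin_num.
Local Notation E := (dual_energy O psi D).

Lemma eq_dual_energy l l' : (forall v, D v -> l v = l' v) -> E l = E l'.
Proof.
by move=> ll'; congr ereal_sup; apply/seteqP; split => _ [v Dv <-]; exists v; rewrite // ll'.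
Qed.

Lemma dual_energy_lsc (l_ : nat -> ('rV[R]_n -> R) -> R) l (r : R) :
  (forall v, D v -> l_ m v @[m --> \oo] --> l v) -> (r%:E < E l)%E ->
  \forall m \near \oo, (r%:E < E (l_ m))%E.
Proof.
move=> ll /ereal_sup_gt[_ [v Dv <-]].
rewrite -(fineK (D_fin Dv)) -EFinB lte_fin ltrBrDr => rl.
have H : \forall m \near \oo,
      r + fine (\int[lebesgue_rV R n]_(x in O) conjugate psi (v x))%E < l_ m v.
  exact: (cvgr_gt _ (ll v Dv) _ rl).
apply: filterS H => m rm; apply: (@lt_le_trans _ _ ((l_ m v)%:E -
    \int[lebesgue_rV R n]_(x in O) conjugate psi (v x))%E).
  by rewrite -(fineK (D_fin Dv)) -EFinB lte_fin ltrBrDr.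
by apply: ereal_sup_ubound; exists v.
Qed.

(** [dual_energy_lsc] controls the lower limit and [ub] the upper one. The split on [E l] avoids
    proving beforehand that the limit energy is finite. *)
Lemma dual_energy_cvg (l_ : nat -> ('rV[R]_n -> R) -> R) l (k : nat -> R) :
  (forall v, D v -> l_ m v @[m --> \oo] --> l v) ->
  k m @[m --> \oo] --> 0 -> (forall m, (E (l_ m) <= E l + (k m)%:E)%E) ->
  E (l_ m) @[m --> \oo] --> E l.
Proof.
move=> ll k0 ub; have lb r := @dual_energy_lsc l_ l r ll.
case: (E l) ub lb => [s| |] ub lb.
- apply/fine_cvgP; split.
    have h : \forall m \near \oo, ((s - 1)%:E < E (l_ m))%E.
      by apply: lb; rewrite lte_fin; lra.
    apply: filterS h => m sm; rewrite fin_numE; apply/andP; split.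
      by rewrite gt_eqF// (lt_trans (ltNyr _) sm).
    by rewrite lt_eqF// (le_lt_trans (ub m))// ltry.
  apply/cvgrPdist_lt => e e0.
  have h1 : \forall m \near \oo, ((s - e)%:E < E (l_ m))%E.
    by apply: lb; rewrite lte_fin ltrBlDr ltrDl.
  have h2 : \forall m \near \oo, k m < e by exact: (cvgr_lt _ k0 _ e0).
  near=> m.
  have m1 : ((s - e)%:E < E (l_ m))%E by near: m.
  have m2 : k m < e by near: m.
  rewrite /=; have := ub m; move: m1; case: (E (l_ m)) => [t| |] //=.
  by rewrite lte_fin lee_fin => m1 m3; rewrite ltr_norml; lra.
- by apply/cvgeyPgt => r; apply: lb; rewrite ltry.
- rewrite (_ : (fun m => E (l_ m)) = cst -oo%E); first exact: cvg_cst.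
  by apply/funext => m; apply/eqP; rewrite -leeNy_eq; exact: ub.
Unshelve. all: by end_near. Qed.

End dual_energy_limit.

(** * Measures as elements of $H^{-1}$ *)

Section Hm1_measures.
Context (R : realType) (n : nat).
Variable O : set 'rV[R]_n.
Hypotheses (oO : open O) (bO : bounded_set O).
Implicit Types (mu : {charge set 'rV[R]_n -> \bar R}).

Lemma charge_integral_Cc1_lin mu (a : R) u v : Cc 1 O u -> Cc 1 O v ->
  charge_integral mu (a *: u + v) = a * charge_integral mu u + charge_integral mu v.
Proof.
by move=> /Cc_bounded_measurable bu /Cc_bounded_measurable bv; exact: charge_integral_lin.
Qed.

(** The bound in [radon_Hm1] is one-sided; applied to [- eta] as well it gives the modulus. *)
Lemma charge_integral_Hm1_bound mu (C : R) :
  (forall eta, Cc 1 O eta -> charge_integral mu eta <= C * H10norm O eta) ->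
  forall eta, Cc 1 O eta -> `|charge_integral mu eta| <= C * H10norm O eta.
Proof.
move=> muC eta Ceta; have C0 : Cc 1 O (0 : 'rV[R]_n -> R) by exact: Cc_0.
have CN : Cc 1 O ((-1) *: eta + 0) by exact: Cc_lin.
have H := muC _ CN; have H' := muC _ Ceta.
have E1 : charge_integral mu ((-1) *: eta + 0) = - charge_integral mu eta.
  rewrite (charge_integral_Cc1_lin mu (-1) Ceta C0).
  by rewrite (charge_integral0 mu (f := 0)) => [|x //]; rewrite addr0 mulN1r.
have E2 : H10norm O ((-1) *: eta + 0) = H10norm O eta.
  rewrite addr0.
  rewrite (H10normE O ((-1) *: eta)) (H10normE O eta).
  transitivity (`|-1| * Num.sqrt (hform O eta eta)).
    exact: (psd_nrmZ (hform_psd_Cc1 oO bO) (-1) Ceta).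
  by rewrite normrN normr1 mul1r.
rewrite E1 E2 in H; move: H H'; clear E1 E2.
move: (charge_integral mu eta) (H10norm O eta) => x y H H'.
by rewrite ler_norml; lra.
Qed.

(** The extension from [Cc 1 O] exists, so [xget] does not fall back on its default. *)
Lemma represents_Hm1_of mu : radon_Hm1 O mu -> represents O mu (Hm1_of O mu).
Proof.
move=> [_ [C C0 /charge_integral_Hm1_bound muC]].
have [F HF Fmu] := Hm1_extension oO bO C0 (@charge_integral_Cc1_lin mu) muC.
by apply: (xgetPex 0 (P := [set F | represents O mu F])); exists F; split.
Qed.

Lemma Hm1_lin (a : R) F G : Hm1 O F -> Hm1 O G -> Hm1 O (a *: F + G).
Proof.
move=> [Fl [C FC]] [Gl [D GD]]; split.
  by move=> b u v Hu Hv; rewrite !fctE Fl// Gl// /GRing.scale/=; ring.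
exists (`|a| * C + D) => v Hv; rewrite !fctE mulrDl.
apply: le_trans (ler_normD _ _) _; apply: lerD; last exact: GD.
by rewrite normrM -mulrA ler_wpM2l//; exact: FC.
Qed.

(** By density the bound on [Cc 1 O] gives [Hm1norm O (F_ m - F) <= k m], and elements of the dual
    are continuous for that norm. *)
Lemma Hm1_strong_cvg_weak (F_ : nat -> ('rV[R]_n -> R) -> R) F (k : nat -> R) :
  Hm1 O F -> (forall m, Hm1 O (F_ m)) -> (forall m, 0 <= k m) -> k m @[m --> \oo] --> 0 ->
  (forall m v, Cc 1 O v -> `|F_ m v - F v| <= k m * H10norm O v) ->
  weak_cvg (Hm1 O) (Hm1norm O) F_ F.
Proof.
move=> HF HF_ k0 kc Fk L [Llin [C LC]].
have bound m : `|L F - L (F_ m)| <= `|C| * k m.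
  have H := Hm1_lin (-1) HF (HF_ m).
  rewrite distrC (_ : L (F_ m) - L F = L (-1 *: F + F_ m)); last by rewrite Llin//; ring.
  apply: le_trans (LC _ H) _.
  have N0 : Hm1norm O (-1 *: F + F_ m) <= k m.
    apply: Hm1norm_le => // v Cv; rewrite !fctE scaleN1r addrC; exact: Fk.
  (* Whether the set of values has a supremum or [sup] takes its default [0]; this allows [C], of
     unknown sign, to be replaced by its modulus. *)
  have N1 : 0 <= Hm1norm O (-1 *: F + F_ m).
    rewrite /Hm1norm /dual_norm; set S := [set _ | _ in _].
    have [[[x Sx] ubS]|/sup_out ->//] := pselect (has_sup S).
    by apply: le_trans (ub_le_sup ubS Sx); case: Sx => v _ <-.
  apply: (@le_trans _ _ (`|C| * Hm1norm O (-1 *: F + F_ m))).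
    by apply: ler_wpM2r => //; exact: ler_norm.
  by apply: ler_wpM2l.
apply/cvgrPdist_le => e e0.
have : `|C| * k m @[m --> \oo] --> 0.
  by rewrite -[X in _ --> X](mulr0 `|C|); apply: cvgM => //; exact: cvg_cst.
move=> /cvgr_lt/(_ _ e0); apply: filterS => m Ck.
by apply: le_trans (bound m) _; exact: ltW.
Qed.

End Hm1_measures.

Theorem theorem3p8 (R : realType) (d : nat) (O : set 'rV[R]_d) (psi : R -> R)
    (u : {charge set 'rV[R]_d -> \bar R})
    (d_gt0 : (0 < d)%N)
    (O_domain : bounded_smooth_domain O)
    (psi_ge0 : forall x, 0 <= psi x)
    (psi_convex : convex_function setT psi)
    (psi_lsc : lower_semicontinuous (EFin \o psi))
    (psi0 : psi 0 = 0)
    (psi_even : forall x, psi x = psi (- x))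
    (psi_growth : exists2 C : R, 0 < C & forall x, psi x <= C * (1 + `|x|))
    (psi_nontrivial : exists2 y : R, 0 < y & 0 < psi y)
    (u_Hm1 : radon_Hm1 O u) :
  exists u_ : nat -> {charge set 'rV[R]_d -> \bar R},
    [/\ forall n, has_L2_density O (u_ n),
        weak_cvg (Hm1 O) (Hm1norm O) (fun n => Hm1_of O (u_ n)) (Hm1_of O u) &
        phi psi O (Hm1_of O (u_ n)) @[n --> \oo] --> phi psi O (Hm1_of O u)].
Proof.
have [_ oO _ bO _] := O_domain.
have mO := open_measurable_rV oO.
have psi_conv (t x y : R) : 0 <= t <= 1 ->
    psi (t * x + (1 - t) * y) <= t * psi x + (1 - t) * psi y.
  by move=> /andP[t0 t1]; apply: (psi_convex (Itv01 t0 t1)); rewrite inE.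
have [G G0 psiG] := psi_growth.
(* The nontriviality of [psi] enters here: the conjugate is at most [c] on $[-m,m]$, which permits
   restricting the dual formula to [Cc 1 O]. *)
have [m m0 [c c0 psim]] := conjugate_finite_near0 psi_conv psi_ge0 psi0 psi_even psi_nontrivial.
have [P P0 poinc] := poincare oO bO d_gt0.
have u_rep := represents_Hm1_of oO bO u_Hm1.
have [_ [C C0 /(charge_integral_Hm1_bound oO bO) uC]] := u_Hm1.
pose l := charge_integral u.
pose k (n : nat) : R := n.+1%:R^-1.
have k0 n : 0 < k n by rewrite invr_gt0.
have kc : k n @[n --> \oo] --> 0 by exact: cvg_harmonic.
have /choice[w wP] : forall n, exists w, [/\ Cc 1 O w,
    forall v, Cc 1 O v -> `|l2form O w v - l v| <= k n * H10norm O v &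
    ((\int[lebesgue_rV R d]_(x in O) psi (w x))%:E <=
      dual_energy O psi (Cc 1 O `&` conjugate_dom psi O) l + (k n)%:E)%E].
  move=> n; apply: (energy_recovery oO bO psi_conv psi_ge0 psi0 psi_even G0 psiG C0 _ uC P0 poinc).
    exact: charge_integral_Cc1_lin.
  exact: k0.
have Cw n : Cc 1 O (w n) by have [] := wP n.
have /choice[u_ uE] : forall n, exists nu : {charge set 'rV[R]_d -> \bar R},
    forall A, measurable A -> nu A = (\int[lebesgue_rV R d]_(x in A `&` O) (w n x)%:E)%E.
  by move=> n; apply: density_charge => //; exact: Cc_integrable (Cw n).
have uw n v : Cc 1 O v -> charge_integral (u_ n) v = l2form O (w n) v.
  move=> Cv; exact: (charge_integral_density oO bO (Cc_bounded_measurable (Cw n)) (uE n)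
    (Cc_bounded_measurable Cv)).
have u_radon n : radon_Hm1 O (u_ n).
  split.
    move=> A mA; rewrite !uE//; last exact: measurableI.
    by rewrite -setIA setIid.
  exists (C + k n); first by rewrite addr_ge0// ltW.
  move=> v Cv; rewrite uw// mulrDl.
  have [_ /(_ v Cv) h _] := wP n; have h2 := uC v Cv.
  have := ler_norm (l2form O (w n) v - l v); have := ler_norm (l v).
  move: h h2; rewrite -/l.
  move: (l2form O (w n) v) (l v) (H10norm O v) => x1 x2 x3.
  by lra.
have u_rep_ n := represents_Hm1_of oO bO (u_radon n).
have D_fin v : (Cc 1 O `&` conjugate_dom psi O) v ->
    (\int[lebesgue_rV R d]_(x in O) conjugate psi (v x))%E \is a fin_num.
  by move=> [_ [_ Iv]]; exact: integrable_fin_num.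
exists u_; split.
- move=> n; exists (w n); last exact: uE.
  exact: Cc_L2 (Cw n).
- apply: (Hm1_strong_cvg_weak oO bO (k := k)) => //.
  + exact: u_rep.1.
  + by move=> n; exact: (u_rep_ n).1.
  + by move=> n; exact: ltW.
  + move=> n v Cv; rewrite (u_rep_ n).2// u_rep.2// uw//.
    by have [_ + _] := wP n; exact.
(* On [Cc 1 O] the functionals [Hm1_of O u] and [Hm1_of O (u_ n)] are [l] and [l2form O (w n)], so
   both sides become dual energies of explicit functionals. *)
- rewrite (phi_dual_energy oO bO psi_ge0 psi0 psi_even m0 c0 psim u_Hm1 u_rep).
  under eq_fun do rewrite (phi_dual_energy oO bO psi_ge0 psi0 psi_even m0 c0 psim
    (u_radon _) (u_rep_ _)).
  have E n : dual_energy O psi (Cc 1 O `&` conjugate_dom psi O) (Hm1_of O (u_ n)) =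
      dual_energy O psi (Cc 1 O `&` conjugate_dom psi O) (l2form O (w n)).
    by apply: eq_dual_energy => v [Cv _]; rewrite (u_rep_ n).2// uw.
  have E' : dual_energy O psi (Cc 1 O `&` conjugate_dom psi O) (Hm1_of O u) =
      dual_energy O psi (Cc 1 O `&` conjugate_dom psi O) l.
    by apply: eq_dual_energy => v [Cv _]; rewrite u_rep.2.
  under eq_fun do rewrite E; rewrite E'.
  apply: (dual_energy_cvg D_fin (k := k)) => //.
    move=> v [Cv _]; apply/cvgrPdist_le => e e0.
    have kv : k n * H10norm O v @[n --> \oo] --> 0.
      by rewrite -[X in _ --> X](mul0r (H10norm O v)); apply: cvgM => //; exact: cvg_cst.
    have H : \forall n \near \oo, k n * H10norm O v < e by exact: (cvgr_lt _ kv _ e0).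
    apply: filterS H => n kn.
    have [_ /(_ v Cv) h _] := wP n.
    by rewrite distrC; apply: le_trans h _; exact: ltW.
  (* The integral of [psi (w n)] lies between the dual energy of [w n] and that of [l] plus
     [k n]. *)
  move=> n; have [_ _] := wP n; apply: le_trans.
  apply: (dual_energy_le_integral oO psi_conv psi_ge0 psi0 psi_even G0 psiG).
  exact: Cc1_Cc0.
Qed.
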